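(* Let $E \geq 0$. If $u \in H^{1/2}(\mathbb{R}^3)$ is radial and satisfies $$\sqrt{-\Delta}\, u - \big(|u|^2 * |x|^{-1}\big) u = E u \quad \text{in } \mathbb{R}^3,$$ then $u \equiv 0$.
   Context: The function $u$ may be complex-valued. Here $*$ denotes convolution on $\mathbb{R}^3$, $H^{1/2}(\mathbb{R}^3)$ is the inhomogeneous Sobolev space of order $1/2$, and $\sqrt{-\Delta}$ is the Fourier multiplier by $|\xi|$, with the convention $\hat u(\xi) = (2\pi)^{-3/2}\int_{\mathbb{R}^3} u(x) e^{-i\xi\cdot x}\,dx$. The equation is understood in the $H^{-1/2}$ sense: for all $v \in H^{1/2}(\mathbb{R}^3)$, $$\int_{\mathbb{R}^3} |\xi|\, \overline{\hat v(\xi)}\, \hat u(\xi)\, d\xi - \iint_{\mathbb{R}^3\times\mathbb{R}^3} \frac{\overline{v(x)}\, u(x)\, |u(y)|^2}{|x-y|}\, dx\, dy = E\int_{\mathbb{R}^3} \overline{v(x)}\, u(x)\, dx .$$ *)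

(* Defs.v *)
From HB Require Import structures.
From mathcomp Require Import all_boot all_order all_algebra.
From mathcomp Require Import complex.
From mathcomp Require Import all_classical all_reals all_analysis.

Set Implicit Arguments.
Unset Strict Implicit.
Unset Printing Implicit Defensive.

Import Order.TTheory GRing.Theory Num.Theory.
Import numFieldNormedType.Exports.
Import ComplexField.Normc.

Local Open Scope classical_set_scope.
Local Open Scope ring_scope.
Local Open Scope complex_scope.

(* R^3 carries the product sigma-algebra, which is the Borel one: functions are
   Borel representatives of their Lebesgue classes.  The factors are written
   measurableTypeR R, the domain type of lebesgue_measure, because R has another
   measurable structure with the same sets but a different display. *)
Notation R3 R :=
  (measurableTypeR R * measurableTypeR R * measurableTypeR R)%type.

(* In the library the canonical sigma-finite structure of \x only applies to
   products of subprobabilities, so leb2 and leb3 get theirs explicitly. *)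
Lemma product_sigma_finite d1 d2 (T1 : measurableType d1)
    (T2 : measurableType d2) (R : realType)
    (m1 : {sigma_finite_measure set T1 -> \bar R})
    (m2 : {sigma_finite_measure set T2 -> \bar R}) :
  sigma_finite setT (m1 \x m2)%E.
Proof.
have /sigma_finiteP[F [TF ndF Foo]] := sigma_finiteT m1.
have /sigma_finiteP[G [TG ndG Goo]] := sigma_finiteT m2.
exists (fun n => F n `*` G n).
  rewrite -setXTT TF TG predeqE => -[x y]; split.
    move=> [/= [n _ Fnx] [k _ Gky]]; exists (maxn n k) => //; split.
    - by move: x Fnx; exact/subsetPset/ndF/leq_maxl.
    - by move: y Gky; exact/subsetPset/ndG/leq_maxr.
  by move=> [n _ []/= ? ?]; split; exists n.
move=> k; have [? ?] := Foo k; have [? ?] := Goo k.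
split; first exact: measurableX.
by rewrite product_measure1E// lte_mul_pinfty// ge0_fin_numE.
Qed.

Definition leb2 {R : realType} :
    set (measurableTypeR R * measurableTypeR R) -> \bar R :=
  (@lebesgue_measure R \x @lebesgue_measure R)%E.
HB.instance Definition _ (R : realType) := Measure.on (@leb2 R).
HB.instance Definition _ (R : realType) :=
  Measure_isSigmaFinite.Build _ _ _ (@leb2 R)
    (product_sigma_finite (@lebesgue_measure R) (@lebesgue_measure R)).

Definition leb3 {R : realType} : set (R3 R) -> \bar R :=
  (@leb2 R \x @lebesgue_measure R)%E.
HB.instance Definition _ (R : realType) := Measure.on (@leb3 R).
HB.instance Definition _ (R : realType) :=
  Measure_isSigmaFinite.Build _ _ _ (@leb3 R)
    (product_sigma_finite (@leb2 R) (@lebesgue_measure R)).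

Section R3_analysis.
Context {R : realType}.
Implicit Types (x y xi : R3 R) (u v g : R3 R -> R[i]).

Local Notation mu3 := (@leb3 R).

Definition dot3 x y : R :=
  (x.1.1 : R) * y.1.1 + (x.1.2 : R) * y.1.2 + (x.2 : R) * y.2.

(* The library norm on a product type is the sup norm; |x| is Euclidean. *)
Definition norm3 x : R := Num.sqrt (dot3 x x).

Definition cmeasurable u :=
  measurable_fun setT (fun x => complex.Re (u x)) /\
  measurable_fun setT (fun x => complex.Im (u x)).

Definition cintegral d (T : measurableType d) (mu : {measure set T -> \bar R})
    (D : set T) (f : T -> R[i]) : R[i] :=
  (\int[mu]_(x in D) complex.Re (f x)) +i* (\int[mu]_(x in D) complex.Im (f x)).

Definition L2 u :=
  cmeasurable u /\ (\int[mu3]_x ((normc (u x) ^+ 2)%:E) < +oo)%E.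

(* exp (- i t) *)
Definition expIN (t : R) : R[i] := cos t -i* sin t.

(* Fourier transform of u restricted to the ball |x| <= n, where an L^2
   function is integrable. *)
Definition fourier_trunc u (n : nat) xi : R[i] :=
  ((2 * pi) `^ (- (3 / 2)))%:C *
  cintegral mu3 [set x | norm3 x <= n%:R] (fun x => u x * expIN (dot3 xi x)).

(* g represents the Fourier-Plancherel transform of u: the L^2-limit of the
   truncated transforms. *)
Definition is_fourier u g :=
  L2 g /\
  (fun n => \int[mu3]_xi ((normc (g xi - fourier_trunc u n xi) ^+ 2)%:E))%E
    @ \oo --> 0%E.

Definition sobolev_half u :=
  L2 u /\ exists2 g, is_fourier u g &
    (\int[mu3]_xi ((Num.sqrt (1 + norm3 xi ^+ 2) * normc (g xi) ^+ 2)%:E)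
       < +oo)%E.

Definition radial u :=
  exists f : R -> R[i], {ae mu3, forall x, u x = f (norm3 x)}.

(* uh and vh range over all representatives of the transforms of u and v,
   which are unique up to a null set. *)
Definition weak_solution (E : R) u :=
  forall v, sobolev_half v ->
  forall uh vh, is_fourier u uh -> is_fourier v vh ->
    cintegral mu3 setT (fun xi => (norm3 xi)%:C * conjc (vh xi) * uh xi)
    - cintegral (mu3 \x mu3)%E setT
        (fun p => conjc (v p.1) * u p.1 *
                  (normc (u p.2) ^+ 2)%:C /
                  (norm3 ((p.1 : R * R * R) - p.2))%:C)
    = E%:C * cintegral mu3 setT (fun x => conjc (v x) * u x).

End R3_analysis.

(* Main.v *)
From HB Require Import structures.
Require Import Defs.
From mathcomp Require Import all_boot all_order all_algebra.
From mathcomp Require Import complex.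
From mathcomp Require Import all_classical all_reals all_analysis.
From mathcomp Require Import measurable_realfun ring lra.

Set Implicit Arguments.
Unset Strict Implicit.
Unset Printing Implicit Defensive.

Import Order.TTheory GRing.Theory Num.Theory.
Import numFieldNormedType.Exports.
Import ComplexField.Normc.

Local Open Scope classical_set_scope.
Local Open Scope ring_scope.

(** The equation is tested with dilations of the solution. Let [rho] be the
    square of the modulus of [u], let [V] be the potential of [rho], and let
    [R_l x] be the real part of [conj (u (l x)) * u x]. The kinetic form pairs
    [u] with its dilations by [1 / l] and by [l] in the proportion [l ^ 2], so
    that it can be eliminated between the two tested equations. There remains
    ([virial])

      l * int R_l(x) V(l x) dx - int R_l(x) V(x) dx = (1 - l) E int R_l(x) dx,

    which is Pohozaev's identity written with a difference quotient: nothing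
    has to be differentiated, and [u] needs no more regularity than it has.
    Writing [2 l ^ (3/2) R_l] as [l ^ 3 rho (l x) + rho x] minus the defect
    [| l ^ (3/2) u (l x) - u x | ^ 2] turns the left-hand side into [l - 1]
    times the interaction energy [D = int rho V], up to an integral of the
    defect against [l V (l x) - V x]. As [V] decreases along rays, this factor
    is at most [(l - 1) V x]; and because [E >= 0], the right-hand side has a
    favourable sign up to the mass of the defect. Therefore ([interaction_le])

      D <= int defect * V + E int defect,

    and the right-hand side tends to zero as [l] tends to one
    ([defect_small], [defect_potential_small]). So [D = 0], which forces
    [rho = 0] almost everywhere.

    Symmetry enters through Newton's theorem ([newton]): for a radial density
    the kernel [1 / |x - y|] may be replaced by [1 / max(|x|, |y|)], whence the
    monotonicity of [V] along rays. It follows from Archimedes' theorem on the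
    sphere ([leb3_archimedes]) and an explicit primitive.

    All this presupposes that [D] is finite. By Newton's theorem again, it is
    enough that [rho |x| ^ (-1/2)] be integrable, and this holds because the
    mass of the ball of radius [r] around the origin is of order [r ^ (3/4)]
    ([weighted_mass_fin]). That mass is controlled by the mean square increment
    of [u] at a scale [e] ([ball_mass]), and the increment by the high
    frequencies of [u] ([energy_le_frequencies]), hence by [e] times the
    squared norm of [u] in the Sobolev space.

    The Fourier analysis rests on a single identity ([poisson_identity]), which
    is Plancherel's identity with the damping factor [exp3 e] on the side of the
    frequencies and the mean square increment as a correction. Letting [e] tend
    to zero gives Bessel's inequality ([bessel]) in general, and the converse
    inequality ([radial_plancherel_ge]) for radial functions, which are limits
    of continuous ones of compact support ([radial_density]). *)

(** * Measurability *)
Section measurability.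
Context {R : realType}.
Context d (T : measurableType d).
Implicit Types (f g : T -> R) (D : set T).

Lemma mfun_comp (F : R -> R) D f :
  measurable_fun setT F -> measurable_fun D f -> measurable_fun D (fun x => F (f x)).
Proof. exact: measurableT_comp. Qed.

Lemma measurable_sin : measurable_fun setT (@sin R).
Proof. apply: continuous_measurable_fun; exact: continuous_sin. Qed.

Lemma measurable_cos : measurable_fun setT (@cos R).
Proof. apply: continuous_measurable_fun; exact: continuous_cos. Qed.

Lemma measurable_sqrtr : measurable_fun setT (@Num.sqrt R).
Proof. apply: continuous_measurable_fun; exact: sqrt_continuous. Qed.

Lemma measurable_invr : measurable_fun setT (@GRing.inv R).
Proof.
have -> : @GRing.inv R = fun x => if x == 0 then 0 else x^-1.
  by apply/funext => x; case: (eqVneq x 0) => [->|//]; rewrite invr0.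
apply: measurable_fun_if => //.
- by apply: measurable_fun_eqr.
- rewrite setTI; apply: open_continuous_measurable_fun.
    rewrite [X in open X](_ : _ = ~` [set 0]).
      by apply: closed_openC; exact: closed_eq.
    by apply/seteqP; split => x /=; [move/eqP|move/eqP/negbTE].
  by move=> x; rewrite inE/= => /negbT x0; exact: inv_continuous.
Qed.

Lemma mfunV D f : measurable_fun D f -> measurable_fun D (fun x => (f x)^-1).
Proof. exact: (mfun_comp measurable_invr). Qed.

Lemma mfun_abs D f : measurable_fun D f -> measurable_fun D (fun x => `|f x|).
Proof. by apply: mfun_comp; exact: normr_measurable. Qed.

Lemma mfun_EFin D f : measurable_fun D f -> measurable_fun D (fun x => (f x)%:E).
Proof. by move=> mf; exact/measurable_EFinP. Qed.

End measurability.

Lemma measurable_fun_fst_comp d d1 d2 (T : measurableType d)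
    (T1 : measurableType d1) (T2 : measurableType d2) D (f : T -> T1 * T2) :
  measurable_fun D f -> measurable_fun D (fun x => (f x).1).
Proof. exact: measurableT_comp. Qed.

Lemma measurable_fun_snd_comp d d1 d2 (T : measurableType d)
    (T1 : measurableType d1) (T2 : measurableType d2) D (f : T -> T1 * T2) :
  measurable_fun D f -> measurable_fun D (fun x => (f x).2).
Proof. exact: measurableT_comp. Qed.

(** Follows the syntax of the function; the hypotheses in the context serve for
    its atoms, and are tried before the function is taken apart. *)
Ltac mfun := intros;
  lazymatch goal with
  | H : measurable_fun _ ?a |- measurable_fun _ ?a => exact: H
  | |- measurable_fun _ (fun x => x) => exact: measurable_id
  | |- measurable_fun _ id => exact: measurable_id
  | |- measurable_fun _ (fun _ => ?c) => exact: measurable_cst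
  | |- measurable_fun _ (fun x => (@?f x)%:E) => apply: mfun_EFin; mfun
  | |- measurable_fun _ (EFin \o _) => apply: mfun_EFin; mfun
  | |- measurable_fun _ (fun x => (@?f x + @?g x)%R) => apply: measurable_funD; mfun
  | |- measurable_fun _ (fun x => (- @?f x)%R) => apply: measurable_funN; mfun
  | |- measurable_fun _ (fun x => (@?f x * @?g x)%R) => apply: measurable_funM; mfun
  | |- measurable_fun _ (fun x => ((@?f x) ^-1)%R) => apply: mfunV; mfun
  | |- measurable_fun _ (fun x => (@?f x ^+ _)%R) => apply: measurable_funX; mfun
  | |- measurable_fun _ (fun x => `|@?f x|%R) => apply: mfun_abs; mfun
  | |- measurable_fun _ (fun x => Num.sqrt (@?f x)) =>
      apply: (mfun_comp measurable_sqrtr); mfun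
  | |- measurable_fun _ (fun x => cos (@?f x)) =>
      apply: (mfun_comp measurable_cos); mfun
  | |- measurable_fun _ (fun x => sin (@?f x)) =>
      apply: (mfun_comp measurable_sin); mfun
  | |- measurable_fun _ (fun x => expR (@?f x)) =>
      apply: (mfun_comp (@measurable_expR _)); mfun
  | |- measurable_fun _ (fun x => (@?f x <= @?g x)%R) => apply: measurable_fun_ler; mfun
  | |- measurable_fun _ (fun x => (@?f x < @?g x)%R) => apply: measurable_fun_ltr; mfun
  | |- measurable_fun _ (fun x => Order.max (@?f x) (@?g x)) => apply: measurable_maxr; mfun
  | |- measurable_fun _ (fun x => Order.min (@?f x) (@?g x)) => apply: measurable_minr; mfun
  | |- measurable_fun _ (fun x => (@?f x) && (@?g x)) => apply: measurable_and; mfun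
  | |- measurable_fun _ (fun x => (@?f x, @?g x)) => apply: measurable_fun_pair; mfun
  | |- measurable_fun _ (fun x => (@?f x).1) => apply: measurable_fun_fst_comp; mfun
  | |- measurable_fun _ (fun x => (@?f x).2) => apply: measurable_fun_snd_comp; mfun
  | |- measurable_fun _ (fun x => (@?f x + @?g x)%E) => apply: emeasurable_funD; mfun
  | |- measurable_fun _ (fun x => (@?f x * @?g x)%E) => apply: emeasurable_funM; mfun
  | H : measurable_fun setT ?a |- measurable_fun _ (fun x => ?a (@?f x)) =>
      apply: (measurableT_comp H); mfun
  | |- measurable_fun ?D (@Order.lt ?d ?T ?c) =>
      change (measurable_fun D (fun x => @Order.lt d T (cst c x) (id x)));
      apply: measurable_fun_ltr; mfun
  | |- measurable_fun ?D (@Order.le ?d ?T ?c) =>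
      change (measurable_fun D (fun x => @Order.le d T (cst c x) (id x)));
      apply: measurable_fun_ler; mfun
  | |- measurable_fun ?D (@GRing.mul ?T ?c) =>
      change (measurable_fun D (fun x => @GRing.mul T (cst c x) (id x)));
      apply: measurable_funM; mfun
  | |- measurable_fun ?D (@Algebra.add ?T ?c) =>
      change (measurable_fun D (fun x => @Algebra.add T (cst c x) (id x)));
      apply: measurable_funD; mfun
  | |- measurable_fun _ (cst _) => exact: measurable_cst
  | |- measurable_fun _ (@GRing.inv _) =>
      apply: measurable_funTS; exact: measurable_invr
  | |- measurable_fun _ (@cos _) => apply: measurable_funTS; exact: measurable_cos
  | |- measurable_fun _ (@sin _) => apply: measurable_funTS; exact: measurable_sin
  | |- measurable_fun _ (@Num.sqrt _) =>
      apply: measurable_funTS; exact: measurable_sqrtr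
  | |- measurable_fun _ (@expR _) => apply: measurable_funTS; exact: measurable_expR
  | |- measurable_fun _ fst => apply: measurable_funTS; exact: measurable_fst
  | |- measurable_fun _ snd => apply: measurable_funTS; exact: measurable_snd
  | |- measurable_fun _ _ => try (apply: measurable_fun_ifT; mfun)
  | |- _ => idtac
  end.

(** * Integrals of nonnegative functions *)

Section nonneg_integral.
Context d (T : measurableType d) (R : realType) (m : {measure set T -> \bar R}).

Lemma ge0_integralZl_fin (k : R) (f : T -> \bar R) : (0 <= k)%R ->
  measurable_fun setT f -> (forall x, 0 <= f x)%E ->
  (\int[m]_x (k%:E * f x) = k%:E * \int[m]_x f x)%E.
Proof. by move=> k0 mf f0; rewrite ge0_integralZl_EFin. Qed.

End nonneg_integral.

Section lebesgue_affine.
Context {R : realType}.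
Notation mu := (@lebesgue_measure R).
Local Open Scope ereal_scope.

(** The image of the measure under the affine map is identified through its
    values on intervals, which determine Lebesgue measure. *)
Lemma ge0_integral_shift (a : R) (f : R -> \bar R) :
  measurable_fun setT f -> (forall x, 0 <= f x) ->
  \int[mu]_x f (x + a)%R = \int[mu]_x f x.
Proof.
move=> mf f0; pose phi : measurableTypeR R -> measurableTypeR R := fun x => (x + a)%R.
have mphi : measurable_fun setT phi by rewrite /phi; mfun.
have -> : \int[mu]_x f x = \int[pushforward mu phi]_x f x.
  apply: eq_measure_integral => A mA _; apply: lebesgue_measure_unique => //.
  move=> _ [[b c] _ <-]; transitivity (mu (phi @^-1` [set` `]b, c]])); last by [].
  rewrite (_ : _ @^-1` _ = [set` `](b - a)%R, (c - a)%R]]).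
    rewrite !lebesgue_measure_itv/= !lte_fin ltrD2r -!EFinB.
    by case: ifP => // _; congr EFin; ring.
  by apply/seteqP; split => x /=; rewrite /phi !in_itv/= ltrBlDr lerBrDr.
by rewrite ge0_integral_pushforward//=.
Qed.

Lemma ge0_integral_scale (k : R) (f : R -> \bar R) : (0 < k)%R ->
  measurable_fun setT f -> (forall x, 0 <= f x) ->
  \int[mu]_x f (k * x)%R = k^-1%:E * \int[mu]_x f x.
Proof.
move=> k0 mf f0; pose phi : measurableTypeR R -> measurableTypeR R := fun x => (k * x)%R.
have mphi : measurable_fun setT phi by rewrite /phi; mfun.
have -> : \int[mu]_x f x = \int[mscale (NngNum (ltW k0)) (pushforward mu phi)]_x f x.
  move=> ?; apply: eq_measure_integral => A mA _; apply: lebesgue_measure_unique => //.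
  move=> _ [[b c] _ <-].
  transitivity (k%:E * mu (phi @^-1` [set` `]b, c]])); last by [].
  rewrite (_ : _ @^-1` _ = [set` `](b / k)%R, (c / k)%R]]).
    rewrite !lebesgue_measure_itv/= !lte_fin ltr_pM2r ?invr_gt0// -!EFinB.
    case: ifP => // _; last by rewrite mule0.
    by rewrite -EFinM; congr EFin; field; rewrite gt_eqF.
  apply/seteqP; split => x /=; rewrite /phi !in_itv/=.
    by rewrite ltr_pdivrMr// ler_pdivlMr// ![(x * k)%R]mulrC.
  by rewrite ltr_pdivrMr// ler_pdivlMr// ![(x * k)%R]mulrC.
rewrite ge0_integral_mscale// ge0_integral_pushforward//=.
by rewrite muleA -EFinM mulVf ?gt_eqF// mul1e.
Qed.

End lebesgue_affine.

(** * Lebesgue measure on the plane and in space *)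

Section tonelli.
Context d1 d2 (T1 : measurableType d1) (T2 : measurableType d2) (R : realType).
Variable m1 : {sigma_finite_measure set T1 -> \bar R}.
Variable m2 : {sigma_finite_measure set T2 -> \bar R}.
Local Open Scope ereal_scope.

Lemma mfun_int2 (f : T1 -> T2 -> \bar R) :
  measurable_fun setT (fun z : T1 * T2 => f z.1 z.2) -> (forall x y, 0 <= f x y) ->
  measurable_fun setT (fun x => \int[m2]_y f x y).
Proof.
move=> mf f0; exact: (measurable_fun_fubini_tonelli_F (fun z => f z.1 z.2)).
Qed.

Lemma tonelli_swap (f : T1 -> T2 -> \bar R) :
  measurable_fun setT (fun z : T1 * T2 => f z.1 z.2) -> (forall x y, 0 <= f x y) ->
  \int[m1]_x \int[m2]_y f x y = \int[m2]_y \int[m1]_x f x y.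
Proof.
move=> mf f0; exact: (fubini_tonelli (fun z => f z.1 z.2)).
Qed.

End tonelli.

Section space.
Context {R : realType}.
Notation mu := (@lebesgue_measure R).
Notation mu2 := (@leb2 R).
Notation mu3 := (@leb3 R).
Notation R2 := (measurableTypeR R * measurableTypeR R)%type.
Local Open Scope ereal_scope.

Lemma measurable_dot3 d (T : measurableType d) D (f g : T -> R3 R) :
  measurable_fun D f -> measurable_fun D g ->
  measurable_fun D (fun t => dot3 (f t) (g t)).
Proof. by move=> mf mg; rewrite /dot3; mfun. Qed.

Lemma measurable_norm3 d (T : measurableType d) D (f : T -> R3 R) :
  measurable_fun D f -> measurable_fun D (fun t => norm3 (f t)).
Proof.
move=> mf; apply: (mfun_comp measurable_sqrtr).
exact: measurable_dot3.
Qed.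

Lemma leb2E (f : R -> R -> \bar R) :
  measurable_fun setT (fun p : R2 => f p.1 p.2) -> (forall x y, 0 <= f x y) ->
  \int[mu2]_p f p.1 p.2 = \int[mu]_x \int[mu]_y f x y.
Proof.
by move=> mf f0; rewrite /leb2 (fubini_tonelli1 (fun p : R2 => f p.1 p.2)).
Qed.

Lemma leb3E (f : R2 -> R -> \bar R) :
  measurable_fun setT (fun p : R3 R => f p.1 p.2) -> (forall x y, 0 <= f x y) ->
  \int[mu3]_p f p.1 p.2 = \int[mu2]_x \int[mu]_y f x y.
Proof.
by move=> mf f0; rewrite /leb3 (fubini_tonelli1 (fun p : R3 R => f p.1 p.2)).
Qed.

Lemma leb3E123 (f : R -> R -> R -> \bar R) :
  measurable_fun setT (fun p : R3 R => f p.1.1 p.1.2 p.2) ->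
  (forall x y z, 0 <= f x y z) ->
  \int[mu3]_p f p.1.1 p.1.2 p.2 = \int[mu]_x \int[mu]_y \int[mu]_z f x y z.
Proof.
move=> mf f0; rewrite (leb3E (f := fun p z => f p.1 p.2 z))//.
rewrite (leb2E (f := fun x y => \int[mu]_z f x y z))//.
- exact: (mfun_int2 mu (f := fun (p : R2) z => f p.1 p.2 z)).
- by move=> x y; exact: integral_ge0.
Qed.

Lemma leb2_shear1 (a : R) (f : R -> R -> \bar R) :
  measurable_fun setT (fun p : R2 => f p.1 p.2) -> (forall x y, 0 <= f x y) ->
  \int[mu2]_p f (p.1 + a * p.2)%R p.2 = \int[mu2]_p f p.1 p.2.
Proof.
move=> mf f0.
have ms : measurable_fun setT (fun p : R2 => (p.1 + a * p.2, p.2)%R : R2) by mfun.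
rewrite (leb2E (f := fun x y => f (x + a * y)%R y))//; last first.
  exact: (measurableT_comp mf ms).
have mg : measurable_fun setT (fun p : R2 => f (p.1 + a * p.2)%R p.2).
  exact: (measurableT_comp mf ms).
rewrite [RHS](leb2E mf f0) [RHS](tonelli_swap mu mu mf f0).
apply: (etrans (tonelli_swap mu mu (f := fun x y => f (x + a * y)%R y) mg (fun x y => f0 _ _))).
apply: eq_integral => y _; rewrite (ge0_integral_shift _ (f := f ^~ y))//.
apply: (measurableT_comp mf (f := fun p : R2 => f p.1 p.2) (g := fun x => (x, y))).
by apply: measurable_fun_pair => //.
Qed.

Lemma leb2_swap (f : R -> R -> \bar R) :
  measurable_fun setT (fun p : R2 => f p.1 p.2) -> (forall x y, 0 <= f x y) ->
  \int[mu2]_p f p.2 p.1 = \int[mu2]_p f p.1 p.2.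
Proof.
move=> mf f0.
have ms : measurable_fun setT (fun p : R2 => (p.2, p.1)%R : R2) by mfun.
rewrite (leb2E (f := fun x y => f y x))//; last first.
  exact: (measurableT_comp mf ms).
by rewrite [RHS](leb2E mf f0) [RHS](tonelli_swap mu mu mf f0).
Qed.

Lemma leb2_shear2 (a : R) (f : R -> R -> \bar R) :
  measurable_fun setT (fun p : R2 => f p.1 p.2) -> (forall x y, 0 <= f x y) ->
  \int[mu2]_p f p.1 (p.2 + a * p.1)%R = \int[mu2]_p f p.1 p.2.
Proof.
move=> mf f0.
have ms : measurable_fun setT (fun p : R2 => (p.2, p.1)%R : R2) by mfun.
have mt : measurable_fun setT (fun p : R2 => (p.1, p.2 + a * p.1)%R : R2) by mfun.
rewrite -(leb2_swap (f := fun x y => f x (y + a * x)%R))//; last first.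
  exact: (measurableT_comp mf mt).
rewrite -(leb2_swap (f := f))//.
rewrite -(leb2_shear1 a (f := fun x y => f y x))//.
exact: (measurableT_comp mf ms).
Qed.

(** A rotation is a product of three shears, and a shear only translates each
    line parallel to an axis, so that it preserves the measure by Tonelli. *)
Lemma leb2_rotation (c s : R) (f : R -> R -> \bar R) :
  (c ^+ 2 + s ^+ 2 = 1)%R -> s != 0%R ->
  measurable_fun setT (fun p : R2 => f p.1 p.2) -> (forall x y, 0 <= f x y) ->
  \int[mu2]_p f (c * p.1 - s * p.2)%R (s * p.1 + c * p.2)%R =
  \int[mu2]_p f p.1 p.2.
Proof.
move=> cs s0 mf f0; pose a := ((c - 1) / s)%R.
have as1 : (a * s = c - 1)%R by rewrite /a mulfVK.
pose g1 x y := f (x + a * y)%R y.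
pose g2 x y := g1 x (y + s * x)%R.
have m1 : measurable_fun setT (fun p : R2 => (p.1 + a * p.2, p.2)%R : R2) by mfun.
have m2 : measurable_fun setT (fun p : R2 => (p.1, p.2 + s * p.1)%R : R2) by mfun.
have mg1 : measurable_fun setT (fun p : R2 => g1 p.1 p.2).
  exact: (measurableT_comp mf m1).
have mg2 : measurable_fun setT (fun p : R2 => g2 p.1 p.2).
  exact: (measurableT_comp mg1 m2).
rewrite -[RHS](leb2_shear1 a)// -/g1 -[RHS](leb2_shear2 s (f := g1))//; last first.
  by move=> *; exact: f0.
rewrite -[RHS](leb2_shear1 a (f := g2))//; last by move=> *; exact: f0.
rewrite /g2 /g1.
apply: eq_integral => -[x y] _ /=.
have e2 : (y + s * (x + a * y) = s * x + c * y)%R.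
  by rewrite mulrDr mulrA [(s * a)%R]mulrC as1; ring.
have e1 : (x + a * y + a * (s * x + c * y) = c * x - s * y)%R.
  apply: (mulIf s0).
  have -> : ((x + a * y + a * (s * x + c * y)) * s =
    x * s + (a * s) * y + (a * s) * (s * x + c * y))%R by ring.
  have cs' : (s ^+ 2 = 1 - c ^+ 2)%R by rewrite -cs addrAC subrr add0r.
  transitivity (c * s * x - s ^+ 2 * y)%R; last by ring.
  by rewrite as1 cs'; ring.
by rewrite e2 e1.
Qed.

End space.

Section affine_space.
Context {R : realType}.
Notation mu := (@lebesgue_measure R).
Notation mu2 := (@leb2 R).
Notation mu3 := (@leb3 R).
Notation R2 := (measurableTypeR R * measurableTypeR R)%type.
Local Open Scope ereal_scope.

Definition nsq (x : R3 R) : R := dot3 x x.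
Definition scale3 (k : R) (x : R3 R) : R3 R := (k * x.1.1, k * x.1.2, k * x.2)%R.
Definition shift3 (a x : R3 R) : R3 R := (x.1.1 + a.1.1, x.1.2 + a.1.2, x.2 + a.2)%R.

Lemma nsq_ge0 (x : R3 R) : (0 <= nsq x)%R.
Proof. by rewrite /nsq /dot3 !addr_ge0// -expr2 sqr_ge0. Qed.

Lemma norm3E (x : R3 R) : norm3 x = Num.sqrt (nsq x). Proof. by []. Qed.

Lemma norm3_ge0 (x : R3 R) : (0 <= norm3 x)%R. Proof. exact: sqrtr_ge0. Qed.

Lemma norm3_sqr (x : R3 R) : (norm3 x ^+ 2 = nsq x)%R.
Proof. by rewrite norm3E sqr_sqrtr// nsq_ge0. Qed.

Lemma nsq_scale k (x : R3 R) : nsq (scale3 k x) = (k ^+ 2 * nsq x)%R.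
Proof. by rewrite /nsq /dot3/=; ring. Qed.

Lemma norm3_scale k (x : R3 R) : (0 <= k)%R -> norm3 (scale3 k x) = (k * norm3 x)%R.
Proof.
by move=> k0; rewrite !norm3E nsq_scale sqrtrM ?sqr_ge0// sqrtr_sqr ger0_norm.
Qed.

Lemma scale3K k : k != 0%R -> cancel (scale3 k) (scale3 k^-1).
Proof.
by move=> k0 [[x y] z]; rewrite /scale3/= !mulrA mulVf// !mul1r.
Qed.

Lemma scale3VK k : k != 0%R -> cancel (scale3 k^-1) (scale3 k).
Proof.
by move=> k0 [[x y] z]; rewrite /scale3/= !mulrA mulfV// !mul1r.
Qed.

Lemma measurable_nsq d (T : measurableType d) D (f : T -> R3 R) :
  measurable_fun D f -> measurable_fun D (fun t => nsq (f t)).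
Proof. by move=> mf; exact: measurable_dot3. Qed.

Lemma measurable_scale3 d (T : measurableType d) (k : T -> R) (f : T -> R3 R) :
  measurable_fun setT k -> measurable_fun setT f ->
  measurable_fun setT (fun t => scale3 (k t) (f t)).
Proof. by move=> mk mf; rewrite /scale3; mfun. Qed.

Lemma measurable_shift3 d (T : measurableType d) (f g : T -> R3 R) :
  measurable_fun setT f -> measurable_fun setT g ->
  measurable_fun setT (fun t => shift3 (f t) (g t)).
Proof. by move=> mf mg; rewrite /shift3; mfun. Qed.

Lemma leb2_scale (k : R) (f : R -> R -> \bar R) : (0 < k)%R ->
  measurable_fun setT (fun p : R2 => f p.1 p.2) -> (forall x y, 0 <= f x y) ->
  \int[mu2]_p f (k * p.1)%R (k * p.2)%R = (k ^- 2)%:E * \int[mu2]_p f p.1 p.2.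
Proof.
move=> k0 mf f0.
have mfx x : measurable_fun setT (f x).
  apply: (measurableT_comp mf (f := fun p : R2 => f p.1 p.2) (g := fun y => (x, y))).
  by apply: measurable_fun_pair => //.
have ms : measurable_fun setT (fun p : R2 => (k * p.1, k * p.2)%R : R2) by mfun.
rewrite (leb2E (f := fun x y => f (k * x) (k * y))%R)//; last first.
  exact: (measurableT_comp mf ms).
rewrite leb2E//.
under eq_integral do rewrite (ge0_integral_scale k0 (f := f _))//.
have mF : measurable_fun setT (fun x => \int[mu]_y f x y) by exact: mfun_int2.
rewrite ge0_integralZl_fin; last 3 first.
- by rewrite invr_ge0 ltW.
- by apply: (measurableT_comp mF); mfun.
- by move=> x; exact: integral_ge0.
rewrite (ge0_integral_scale k0 (f := fun x => \int[mu]_y f x y))//; last first.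
  by move=> x; exact: integral_ge0.
by rewrite muleA -EFinM -invfM expr2.
Qed.

Lemma leb3_scale (k : R) (f : R3 R -> \bar R) : (0 < k)%R ->
  measurable_fun setT f -> (forall x, 0 <= f x) ->
  \int[mu3]_x f (scale3 k x) = (k ^- 3)%:E * \int[mu3]_x f x.
Proof.
move=> k0 mf f0.
have mf' : measurable_fun setT (fun p : R3 R => f (p.1, p.2)).
  by apply: (measurableT_comp mf); mfun.
have mfx x : measurable_fun setT (fun z => f (x, z)).
  by apply: (measurableT_comp mf); apply: measurable_fun_pair.
have ms : measurable_fun setT (scale3 k) by exact: (measurable_scale3 (f := id)).
have -> : \int[mu3]_x f x = \int[mu2]_p \int[mu]_z f (p, z).
  by rewrite -(leb3E (f := fun p z => f (p, z)))//; apply: eq_integral => -[].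
have -> : \int[mu3]_x f (scale3 k x) =
    \int[mu2]_p \int[mu]_z f ((k * p.1, k * p.2), k * z)%R.
  rewrite -(leb3E (f := fun p z => f ((k * p.1, k * p.2), k * z)%R))//.
  exact: (measurableT_comp mf ms).
transitivity (\int[mu2]_p (k^-1%:E * \int[mu]_z f ((k * p.1, k * p.2), z)%R)).
  apply: eq_integral => p _.
  rewrite (ge0_integral_scale k0 (f := fun z => f ((k * p.1, k * p.2), z)%R))//.
  exact: mfx.
have mF : measurable_fun setT (fun p : R2 => \int[mu]_z f (p, z)).
  exact: (mfun_int2 mu (f := fun p z => f (p, z))).
have m2 : measurable_fun setT (fun p : R2 => (k * p.1, k * p.2)%R : R2) by mfun.
rewrite ge0_integralZl_fin; last 3 first.
- by rewrite invr_ge0 ltW.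
- by exact: (measurableT_comp mF m2).
- by move=> x; exact: integral_ge0.
rewrite (leb2_scale k0 (f := fun x y => \int[mu]_z f ((x, y), z)))//; last 2 first.
- rewrite (_ : (fun p : R2 => _) = fun p : R2 => \int[mu]_z f (p, z))//.
  by apply/funext => -[].
- by move=> x y; exact: integral_ge0.
rewrite muleA -EFinM -invfM -exprS; congr (_ * _).
by apply: eq_integral => -[].
Qed.

Lemma leb3_shift (a : R3 R) (f : R3 R -> \bar R) :
  measurable_fun setT f -> (forall x, 0 <= f x) ->
  \int[mu3]_x f (shift3 a x) = \int[mu3]_x f x.
Proof.
move=> mf f0.
pose g (x y z : R) := f (x, y, z).
have g0 x y z : 0 <= g x y z by exact: f0.
have mg : measurable_fun setT (fun p : R3 R => g p.1.1 p.1.2 p.2).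
  by apply: (measurableT_comp mf); mfun.
pose h (x y z : R) := g (x + a.1.1)%R (y + a.1.2)%R (z + a.2)%R.
have mh : measurable_fun setT (fun p : R3 R => h p.1.1 p.1.2 p.2).
  by apply: (measurableT_comp mf); mfun.
transitivity (\int[mu3]_p h p.1.1 p.1.2 p.2); first by apply: eq_integral.
transitivity (\int[mu3]_p g p.1.1 p.1.2 p.2); last first.
  by apply: eq_integral => -[[]].
rewrite [RHS](leb3E123 mg); last by move=> *; exact: f0.
rewrite [LHS](leb3E123 mh); last by move=> *; exact: f0.
have mx : measurable_fun setT (fun x => \int[mu]_y \int[mu]_z g x y z).
  apply: mfun_int2; last by move=> x y; apply: integral_ge0 => z _; exact: g0.
  apply: (mfun_int2 mu (f := fun (p : R2) z => g p.1 p.2 z)) mg _.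
  by move=> p z; exact: g0.
rewrite -[RHS](ge0_integral_shift a.1.1); [|exact: mx|]; last first.
  by move=> x; apply: integral_ge0 => y _; apply: integral_ge0 => z _; exact: g0.
apply: eq_integral => x _.
have my : measurable_fun setT (fun y => \int[mu]_z g (x + a.1.1)%R y z).
  apply: mfun_int2; last by move=> y z; exact: g0.
  by apply: (measurableT_comp mf); mfun.
rewrite -[RHS](ge0_integral_shift a.1.2); [|exact: my|]; last first.
  by move=> y; apply: integral_ge0 => z _; exact: g0.
apply: eq_integral => y _.
have mz : measurable_fun setT (g (x + a.1.1) (y + a.1.2))%R.
  by apply: (measurableT_comp mf); mfun.
by rewrite -[RHS](ge0_integral_shift a.2); [|exact: mz|move=> z; exact: g0].
Qed.

Lemma leb3_rotation12 (c s : R) (f : R -> R -> R -> \bar R) :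
  (c ^+ 2 + s ^+ 2 = 1)%R -> s != 0%R ->
  measurable_fun setT (fun p : R3 R => f p.1.1 p.1.2 p.2) ->
  (forall x y z, 0 <= f x y z) ->
  \int[mu3]_p f (c * p.1.1 - s * p.1.2)%R (s * p.1.1 + c * p.1.2)%R p.2 =
  \int[mu3]_p f p.1.1 p.1.2 p.2.
Proof.
move=> cs s0 mf f0.
have mr : measurable_fun setT (fun p : R3 R =>
    (c * p.1.1 - s * p.1.2, s * p.1.1 + c * p.1.2, p.2)%R : R3 R) by mfun.
rewrite /leb3 (fubini_tonelli2 (fun p : R3 R =>
  f (c * p.1.1 - s * p.1.2)%R (s * p.1.1 + c * p.1.2)%R p.2))//; last first.
  exact: (measurableT_comp mf mr).
rewrite (fubini_tonelli2 (fun p : R3 R => f p.1.1 p.1.2 p.2))//.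
apply: eq_integral => z _.
apply: (leb2_rotation (f := fun x y => f x y z) cs) => //.
apply: (measurableT_comp mf (g := fun p : R2 => (p, z))).
by apply: measurable_fun_pair.
Qed.

Lemma leb3_rotation23 (c s : R) (f : R -> R -> R -> \bar R) :
  (c ^+ 2 + s ^+ 2 = 1)%R -> s != 0%R ->
  measurable_fun setT (fun p : R3 R => f p.1.1 p.1.2 p.2) ->
  (forall x y z, 0 <= f x y z) ->
  \int[mu3]_p f p.1.1 (c * p.1.2 - s * p.2)%R (s * p.1.2 + c * p.2)%R =
  \int[mu3]_p f p.1.1 p.1.2 p.2.
Proof.
move=> cs s0 mf f0.
have mr : measurable_fun setT (fun p : R3 R =>
    (p.1.1, c * p.1.2 - s * p.2, s * p.1.2 + c * p.2)%R : R3 R) by mfun.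
pose g x y z := f x (c * y - s * z)%R (s * y + c * z)%R.
have mg : measurable_fun setT (fun p : R3 R => g p.1.1 p.1.2 p.2).
  exact: (measurableT_comp mf mr).
transitivity (\int[mu3]_p g p.1.1 p.1.2 p.2); first exact: eq_integral.
rewrite [RHS](leb3E123 mf)// [LHS](leb3E123 mg); last by move=> *; exact: f0.
apply: eq_integral => x _.
have mx : measurable_fun setT (fun p : R2 => f x p.1 p.2).
  apply: (measurableT_comp mf (g := fun p : R2 => ((x, p.1), p.2))).
  by mfun.
have m2 : measurable_fun setT (fun p : R2 =>
    (c * p.1 - s * p.2, s * p.1 + c * p.2)%R : R2) by mfun.
have mgx : measurable_fun setT (fun p : R2 => g x p.1 p.2).
  exact: (measurableT_comp mx m2).
rewrite -[RHS](leb2E mx)// -[LHS](leb2E mgx); last by move=> *; exact: f0.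
exact: (leb2_rotation (f := f x) cs).
Qed.

(** Rotating the first two coordinates, then the last two, turns the direction
    of [x] into that of the third axis. *)
Lemma leb3_radial_dot (H : R -> R -> \bar R) (x : R3 R) : x.1.1 != 0%R :> R ->
  measurable_fun setT (fun p : R2 => H p.1 p.2) -> (forall s t, 0 <= H s t) ->
  \int[mu3]_y H (nsq y) (dot3 x y) = \int[mu3]_y H (nsq y) (norm3 x * y.2)%R.
Proof.
case: x => -[x1 x2] x3 /= x10 mH H0.
pose q := (x1 ^+ 2 + x2 ^+ 2)%R.
have q0 : (0 < q)%R by rewrite ltr_pwDl ?sqr_ge0// exprn_even_gt0.
pose p := Num.sqrt q.
have p0 : (0 < p)%R by rewrite sqrtr_gt0.
have pp : (p ^+ 2 = q)%R by rewrite sqr_sqrtr// ltW.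
pose n := (q + x3 ^+ 2)%R.
have n0 : (0 < n)%R by rewrite ltr_pwDl ?sqr_ge0.
pose r := Num.sqrt n.
have r0 : (0 < r)%R by rewrite sqrtr_gt0.
have rr : (r ^+ 2 = n)%R by rewrite sqr_sqrtr// ltW.
have -> : norm3 (x1, x2, x3) = r by rewrite /norm3 /dot3/= /r /n /q -!expr2.
have pN0 : p != 0%R by rewrite gt_eqF.
have rN0 : r != 0%R by rewrite gt_eqF.
pose f1 (y1 y2 y3 : R) := H (y1 * y1 + y2 * y2 + y3 * y3)%R
   (x1 * y1 + x2 * y2 + x3 * y3)%R.
pose f2 (y1 y2 y3 : R) := H (y1 * y1 + y2 * y2 + y3 * y3)%R (p * y2 + x3 * y3)%R.
have mf1 : measurable_fun setT (fun y : R3 R => f1 y.1.1 y.1.2 y.2).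
  rewrite /f1; apply: (measurableT_comp mH (g := fun y : R3 R =>
   ((y.1.1 * y.1.1 + y.1.2 * y.1.2 + y.2 * y.2)%R, (x1 * y.1.1 + x2 * y.1.2 + x3 * y.2)%R))).
  by mfun.
have mf2 : measurable_fun setT (fun y : R3 R => f2 y.1.1 y.1.2 y.2).
  rewrite /f2; apply: (measurableT_comp mH (g := fun y : R3 R =>
   ((y.1.1 * y.1.1 + y.1.2 * y.1.2 + y.2 * y.2)%R, (p * y.1.2 + x3 * y.2)%R))).
  by mfun.
rewrite [LHS](_ : _ = \int[mu3]_y f1 y.1.1 y.1.2 y.2)//.
rewrite -(leb3_rotation12 (c := (x2 / p)%R) (s := (- x1 / p)%R))//; last 3 first.
- rewrite !expr_div_n sqrrN -mulrDl pp addrC -/q mulfV//.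
  by rewrite gt_eqF.
- by rewrite mulf_neq0 ?oppr_eq0 ?invr_eq0.
- by move=> *; exact: H0.
transitivity (\int[mu3]_y f2 y.1.1 y.1.2 y.2).
  apply: eq_integral => -[[y1 y2] y3] _ /=; rewrite /f1 /f2; congr H.
    transitivity (((x1 ^+ 2 + x2 ^+ 2) / p ^+ 2) * (y1 * y1 + y2 * y2) + y3 * y3)%R.
      by field.
    by rewrite pp -/q mulfV ?gt_eqF// mul1r.
  transitivity ((x1 ^+ 2 + x2 ^+ 2) / p * y2 + x3 * y3)%R; first by field.
  by rewrite -/q -pp expr2 mulfK.
rewrite -(leb3_rotation23 (c := (x3 / r)%R) (s := (- p / r)%R))//; last 3 first.
- rewrite !expr_div_n sqrrN -mulrDl rr pp addrC -/n mulfV//.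
  by rewrite gt_eqF.
- by rewrite mulf_neq0 ?oppr_eq0 ?invr_eq0.
- by move=> *; exact: H0.
apply: eq_integral => -[[y1 y2] y3] _ /=; rewrite /f2 /nsq /dot3/=; congr H.
  transitivity (y1 * y1 + ((p ^+ 2 + x3 ^+ 2) / r ^+ 2) * (y2 * y2 + y3 * y3))%R.
    by field.
  by rewrite pp rr -/n mulfV ?gt_eqF// mul1r addrA.
transitivity ((p ^+ 2 + x3 ^+ 2) / r * y3)%R; first by field.
by rewrite pp -/n -rr expr2 mulfK.
Qed.

End affine_space.

(** * Polar coordinates *)
Section polar.
Context {R : realType}.
Notation mu := (@lebesgue_measure R).
Notation mu2 := (@leb2 R).
Notation R2 := (measurableTypeR R * measurableTypeR R)%type.
Local Open Scope ereal_scope.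

Let q (p : R2) : R := ((p.1 : R) * p.1 + (p.2 : R) * p.2)%R.

Let mq : measurable_fun setT q. Proof. by rewrite /q; mfun. Qed.

Let q_ge0 p : (0 <= q p)%R.
Proof. by rewrite /q addr_ge0// -expr2 sqr_ge0. Qed.

Let point_setX : [set ((0, 0) : R2)%R] = [set 0%R] `*` [set 0%R].
Proof. by apply/seteqP; split => [_ -> //|[x y] [/= -> ->]]. Qed.

Let measurable_point : measurable [set ((0, 0) : R2)%R].
Proof. by rewrite point_setX; exact: measurableX. Qed.

Let leb2_point_eq0 : mu2 [set (0, 0)%R] = 0.
Proof.
rewrite point_setX /leb2 product_measure1E//=.
by rewrite lebesgue_measure_set1 mul0e.
Qed.

(** Any annulus would do: what matters is that [1 / q] has a finite, nonzero
    integral against it. *)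
Let phi (s : R) := (1 <= s)%R && (s < 4)%R.

Let h (t : R) : \bar R := if (0 < t)%R && phi t^-1 then (t^-1)%:E else 0.

Let mphi d (T : measurableType d) (f : T -> R) :
  measurable_fun setT f -> measurable_fun setT (fun x => phi (f x)).
Proof. by move=> mf; rewrite /phi; mfun. Qed.

Let mh : measurable_fun setT h.
Proof.
rewrite /h; apply: measurable_fun_ifT; [|by mfun..].
by apply: measurable_and; [by mfun|apply: mphi; mfun].
Qed.

Let h_ge0 t : 0 <= h t.
Proof.
by rewrite /h; case: ifPn => // /andP[t0 _]; rewrite lee_fin invr_ge0 ltW.
Qed.

Let K := \int[mu]_t h t.

Let Kfin : K < +oo.
Proof.
apply: (@le_lt_trans _ _ (\int[mu]_t (4 * \1_`[0%R, 1%R] t)%:E)).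
  apply: ge0_le_integral => //; first by apply/measurable_EFinP/measurable_funM.
  move=> t _; rewrite /h; case: ifPn => [/andP[t0 /andP[t1 t4]]|_].
    have t1' : (t <= 1)%R by rewrite -(invrK t) invf_le1// (lt_le_trans _ t1).
    by rewrite lee_fin indicE mem_set ?mulr1 ?ltW//= in_itv/= ltW.
  by rewrite lee_fin mulr_ge0.
under eq_integral do rewrite EFinM.
rewrite ge0_integralZl_fin//; last first.
  by apply/measurable_EFinP.
by rewrite integral_indic//= setIT lebesgue_measure_itv/= lte_fin ltr01 -EFinB -EFinM ltry.
Qed.

Let Kgt0 : 0 < K.
Proof.
have q4 : (4^-1 < 1 :> R)%R by rewrite invf_lt1 ?ltr1n.
apply: (@lt_le_trans _ _ (\int[mu]_t (\1_`](4^-1)%R, 1%R] t)%:E)).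
  rewrite integral_indic//= setIT lebesgue_measure_itv/= lte_fin q4.
  by rewrite -EFinB lte_fin subr_gt0.
apply: ge0_le_integral => //; first by apply/measurable_EFinP.
move=> t _; rewrite indicE; case: (boolP (_ \in _)) => [|_]; last exact: h_ge0.
rewrite inE/= in_itv/= => /andP[t4 t1].
have t0 : (0 < t)%R by rewrite (lt_trans _ t4).
have t1' : (1 <= t^-1)%R by rewrite -invr1 lef_pV2 ?posrE.
have t4' : (t^-1 < 4)%R by rewrite -[ltRHS]invrK ltf_pV2 ?posrE.
by rewrite /h t0/= /phi t1' t4' lee_fin.
Qed.

Let KE (s : R) : (0 < s)%R ->
  \int[mu]_t (if (0 < t)%R && phi (s / t) then (t^-1)%:E else 0) = K.
Proof.
move=> s0; have := ge0_integral_scale (f := h) (k := s^-1%R).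
rewrite invr_gt0 => /(_ s0 mh h_ge0); rewrite invrK => H.
have s1 : s^-1%:E * s%:E = 1 by rewrite -EFinM mulVf ?gt_eqF.
rewrite -[RHS]mul1e -s1 -muleA -/K -H -ge0_integralZl_fin; last 3 first.
- by rewrite invr_ge0 ltW.
- by apply: (measurableT_comp mh); mfun.
- by move=> t; exact: h_ge0.
apply: eq_integral => t _; rewrite /h pmulr_rgt0 ?invr_gt0// invfM invrK.
by case: ifPn; rewrite ?mule0// -EFinM mulrA mulVf ?gt_eqF// mul1r.
Qed.

Let A := \int[mu2]_p (if phi (q p) then (q p)^-1%:E else 0).

Let Afin : A < +oo.
Proof.
pose B : set R2 := [set` `[- (2 : R), 2]%R] `*` [set` `[- (2 : R), 2]%R].
have mB : measurable B by exact: measurableX.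
apply: (@le_lt_trans _ _ (\int[mu2]_p (\1_B p)%:E)).
  apply: ge0_le_integral => //.
  - by move=> p _; case: ifPn => // _; rewrite lee_fin invr_ge0 q_ge0.
  - apply: measurable_fun_ifT; [exact: mphi|by mfun|by mfun].
  - by apply/measurable_EFinP/measurable_indic.
  move=> p _; case: ifPn => [/andP[q1 q4]|_]; last by rewrite lee_fin.
  have q0 : (0 < q p)%R by rewrite (lt_le_trans _ q1).
  suff Bp : B p by rewrite indicE mem_set// lee_fin invf_le1.
  have h2 : (Num.sqrt (2 ^+ 2) = 2 :> R)%R by rewrite sqrtr_sqr ger0_norm.
  have q1' : ((p.1 : R) ^+ 2 <= 2 ^+ 2)%R.
    have := sqr_ge0 (p.2 : R); move: q4; rewrite /q; nra.
  have q2' : ((p.2 : R) ^+ 2 <= 2 ^+ 2)%R.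
    have := sqr_ge0 (p.1 : R); move: q4; rewrite /q; nra.
  by split; rewrite /= in_itv/= -ler_norml -sqrtr_sqr -h2 ler_sqrt.
rewrite integral_indic// setIT; change (leb2 B < +oo).
rewrite /leb2 product_measure1E//= !lebesgue_measure_itv/= lte_fin.
by case: ifP => _; rewrite ?mule0// -EFinB -EFinM ltry.
Qed.

Let A_ge0 : 0 <= A.
Proof.
by apply: integral_ge0 => p _; case: ifPn => // _; rewrite lee_fin invr_ge0 q_ge0.
Qed.

(** Integrating [G (t q)] over [t > 0] and over the annulus [1 <= q < 4] in
    the two possible orders, and undoing the dilation each time, separates the
    variables: no Jacobian is involved, only the homogeneity of the measure. *)
Let annulus (G : R -> \bar R) : measurable_fun setT G -> (forall t, 0 <= G t) ->
  K * \int[mu2]_p G (q p) = A * \int[mu]_t (if (0 < t)%R then G t else 0).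
Proof.
move=> mG G0; set J := \int[mu]_t _.
have mJ : measurable_fun setT (fun t : R => if (0 < t)%R then G t else 0) by mfun.
have J0 : forall t, 0 <= (if (0 < t)%R then G t else 0).
  by move=> t; case: ifP.
have mGq : measurable_fun setT (fun p => G (q p)) by exact: (measurableT_comp mG mq).
pose F (p : R2) (t : R) : \bar R :=
  if (0 < t)%R && phi (q p / t) then (t^-1)%:E * G (q p) else 0.
have F0 p t : 0 <= F p t.
  rewrite /F; case: ifPn => // /andP[t0 _].
  by rewrite mule_ge0// lee_fin invr_ge0 ltW.
have mF : measurable_fun setT (fun z : R2 * measurableTypeR R => F z.1 z.2).
  apply: measurable_fun_ifT; last by mfun.
    apply: measurable_and; first by mfun.
    by apply: mphi; mfun; apply: (measurableT_comp mq); mfun.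
  by apply: emeasurable_funM; mfun; apply: (measurableT_comp mGq); mfun.
pose H (p : R2) (t : R) : \bar R :=
  if (0 < t)%R && phi (q p) then G (t * q p)%R else 0.
have H0 p t : 0 <= H p t by rewrite /H; case: ifPn.
have mH : measurable_fun setT (fun z : R2 * measurableTypeR R => H z.1 z.2).
  apply: measurable_fun_ifT; last by mfun.
    apply: measurable_and; first by mfun.
    by apply: mphi; mfun; apply: (measurableT_comp mq); mfun.
  by mfun; apply: (measurableT_comp mq); mfun.
transitivity (\int[mu2]_p \int[mu]_t F p t).
  have K0 : 0 <= K by exact: ltW.
  rewrite -ge0_integralZl//.
  apply: ge0_ae_eq_integral => //.
  - by apply: emeasurable_funM.
  - exact: (mfun_int2 mu (f := F)).
  - by move=> p _; rewrite mule_ge0.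
  - by move=> p _; exact: integral_ge0.
  exists [set (0, 0)%R]; split; [exact: measurable_point|exact: leb2_point_eq0|].
  move=> [x y] /= /not_implyP[_]; apply: contra_notP => xy.
  have qp : (0 < q (x, y))%R.
    rewrite lt0r q_ge0 andbT /q/= -!expr2 paddr_eq0 ?sqr_ge0// !sqrf_eq0.
    by apply/negP => /andP[/eqP x0 /eqP y0]; apply: xy; rewrite x0 y0.
  rewrite muleC -(KE qp) -ge0_integralZl//; last 2 first.
  - apply: measurable_fun_ifT; [|by mfun..].
    by apply: measurable_and; [by mfun|apply: mphi; mfun].
  - by move=> t _; case: ifPn => // /andP[t0 _]; rewrite lee_fin invr_ge0 ltW.
  by apply: eq_integral => t _; rewrite /F; case: ifPn; rewrite ?mule0// muleC.
rewrite (tonelli_swap mu2 mu mF F0).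
transitivity (\int[mu]_t \int[mu2]_p H p t).
  apply: eq_integral => t _; have [t0|t0] := ltP 0%R t; last first.
    by rewrite /F /H ltNge t0.
  pose k := Num.sqrt t.
  have k0 : (0 < k)%R by rewrite sqrtr_gt0.
  have kk : (k ^+ 2 = t)%R by rewrite sqr_sqrtr// ltW.
  pose g (x y : R) := if phi (q (x, y) / t) then G (q (x, y)) else 0.
  have mg : measurable_fun setT (fun p : R2 => g p.1 p.2).
    apply: measurable_fun_ifT; last by mfun.
      by apply: mphi; mfun; apply: (measurableT_comp mq); mfun.
    by apply: (measurableT_comp mGq); mfun.
  have g0 x y : 0 <= g x y by rewrite /g; case: ifPn.
  transitivity (\int[mu2]_p g (k * p.1)%R (k * p.2)%R); last first.
    apply: eq_integral => p _; rewrite /g /H t0/=.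
    have -> : (q (k * p.1, k * p.2) = t * q p)%R by rewrite -kk /q/=; ring.
    by rewrite mulrAC mulfV ?mul1r// gt_eqF.
  rewrite (leb2_scale k0 mg g0) kk -ge0_integralZl_fin//; last by rewrite invr_ge0 ltW.
  apply: eq_integral => -[x y] _; rewrite /F /g t0/=.
  by case: ifPn; rewrite ?mule0.
rewrite -(tonelli_swap mu2 mu mH H0).
have mA : measurable_fun setT (fun p => if phi (q p) then (q p)^-1%:E else 0).
  by apply: measurable_fun_ifT; [exact: mphi|by mfun|by mfun].
rewrite -ge0_integralZr//; last 2 first.
- by move=> p _; case: ifPn => // _; rewrite lee_fin invr_ge0 q_ge0.
- exact: integral_ge0.
apply: eq_integral => p _; case: ifPn => [/[dup] pq /andP[q1 q4]|/negbTE pq].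
  have q0 : (0 < q p)%R by rewrite (lt_le_trans _ q1).
  rewrite /J -(ge0_integral_scale q0 mJ J0).
  by apply: eq_integral => t _; rewrite /H pq andbT pmulr_rgt0// [(t * _)%R]mulrC.
by rewrite mul0e; apply: integral0_eq => t _; rewrite /H pq andbF.
Qed.

(** The constant is [pi], but only its finiteness matters below. *)
Lemma leb2_polar : exists2 c : R, (0 <= c)%R &
  forall G : R -> \bar R, measurable_fun setT G -> (forall t, 0 <= G t) ->
  \int[mu2]_p G (p.1 * p.1 + p.2 * p.2)%R =
  c%:E * \int[mu]_t (if (0 < t)%R then G t else 0).
Proof.
have Kf : K \is a fin_num by rewrite ge0_fin_numE// ltW.
have Af : A \is a fin_num by rewrite ge0_fin_numE.
have k0 : (0 < fine K)%R by apply: fine_gt0; rewrite Kgt0 Kfin.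
exists (fine A / fine K)%R.
  by rewrite divr_ge0 ?fine_ge0// ltW.
move=> G mG G0; have := annulus mG G0; rewrite -(fineK Kf) -{1}(fineK Af) => e.
rewrite EFinM [(fine A)%:E * _]muleC -muleA -e muleA -EFinM mulVf ?gt_eqF//.
by rewrite mul1e.
Qed.

End polar.

(** * Newton's theorem *)
Section newton.
Context {R : realType}.
Notation mu := (@lebesgue_measure R).
Notation mu2 := (@leb2 R).
Notation mu3 := (@leb3 R).
Notation R2 := (measurableTypeR R * measurableTypeR R)%type.
Local Open Scope ereal_scope.

Lemma is_derive_affine (a b z : R) :
  is_derive z (1%R : R) (fun t => (b + a * t)%R) a.
Proof.
have -> : (fun t => (b + a * t)%R) = (cst b + a \*: id)%R by [].
by apply: is_derive_eq; rewrite add0r; exact: mulr1.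
Qed.

Lemma integral_is_derive (f F : R -> R) (a b : R) : (a < b)%R ->
  (forall z, (a <= z <= b)%R -> is_derive z (1%R : R) F (f z)) ->
  (forall z, (a <= z <= b)%R -> {for z, continuous f}) ->
  \int[mu]_(z in `[a, b]) (f z)%:E = (F b)%:E - (F a)%:E.
Proof.
move=> ab dF cf.
have cF z : (a <= z <= b)%R -> {for z, continuous F}.
  move=> zab; apply: differentiable_continuous; apply/derivable1_diffP.
  by case: (dF z zab).
apply: continuous_FTC2 => //.
- apply: continuous_in_subspaceT => z; rewrite inE/= in_itv/= => zab.
  exact: cf.
- split.
  + move=> z; rewrite in_itv/= => /andP[az zb].
    by have := dF z; rewrite !ltW// => /(_ isT)[].
  + by apply: cvg_at_right_filter; apply: cF; rewrite lexx ltW.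
  + by apply: cvg_at_left_filter; apply: cF; rewrite lexx ltW.
- move=> z; rewrite in_itv/= => /andP[az zb].
  have := dF z; rewrite !ltW// => /(_ isT)[_ dFz].
  by rewrite derive1E.
Qed.

(** Primitive of [1 / sqrt (r^2 - 2 r z + s)]; the value does not involve the
    smaller of [r] and [sqrt s] because the endpoints give perfect squares. *)
Lemma integral_inv_dist (r s : R) : (0 < r)%R -> (0 < s)%R -> s != (r ^+ 2)%R ->
  \int[mu]_z (if (z ^+ 2 < s)%R
              then ((Num.sqrt (r ^+ 2 - 2 * (r * z) + s))^-1)%:E else 0) =
  \int[mu]_z (if (z ^+ 2 < s)%R
              then ((Num.max r (Num.sqrt s))^-1)%:E else 0).
Proof.
move=> r0 s0 sr.
pose g := Num.sqrt s.
have g0 : (0 < g)%R by rewrite sqrtr_gt0.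
have gg : (g ^+ 2 = s)%R by rewrite sqr_sqrtr// ltW.
have gr : g != r by apply: contra sr => /eqP <-; rewrite gg.
have itvE (f : R -> R) : measurable_fun setT f -> \int[mu]_z (if (z ^+ 2 < s)%R
    then (f z)%:E else 0) = \int[mu]_(z in `[(- g)%R, g]) (f z)%:E.
  move=> mf; rewrite integral_itv_bndoo; last first.
    by apply/measurable_EFinP; exact: measurable_funTS.
  rewrite [RHS]integral_mkcond; apply: eq_integral => z _; rewrite patchE.
  have -> : (z \in `](- g)%R, g[%classic) = (z ^+ 2 < s)%R.
    apply/idP/idP; rewrite inE/= in_itv/= -ltr_norml.
      by rewrite -gg -(real_normK (num_real z)) ltr_pXn2r ?nnegrE// ltW.
    by rewrite -gg -(real_normK (num_real z)) ltr_pXn2r ?nnegrE// ltW.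
  by case: ifP.
rewrite itvE; last by mfun.
rewrite (itvE (cst _))//.
have pos z : (- g <= z <= g)%R -> (0 < r ^+ 2 - 2 * (r * z) + s)%R.
  move=> /andP[z1 z2]; have : (0 < (g - r) ^+ 2)%R.
    by rewrite exprn_even_gt0// subr_eq0.
  have : (0 <= r * (g - z))%R by apply: mulr_ge0; [exact: ltW|rewrite subr_ge0].
  by rewrite -gg; nra.
have afE z : (r ^+ 2 - 2 * (r * z) + s = (r ^+ 2 + s) + (- (2 * r)) * z)%R by ring.
have cg : continuous (fun z => r ^+ 2 - 2 * (r * z) + s)%R.
  rewrite (_ : (fun z => _) = fun z => (r ^+ 2 + s) + (- (2 * r)) * z)%R; last first.
    by apply/funext => z; exact: afE.
  move=> z; apply: differentiable_continuous; apply/derivable1_diffP.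
  by case: (is_derive_affine (- (2 * r)) (r ^+ 2 + s) z).
pose F z := (- r^-1 * Num.sqrt (r ^+ 2 - 2 * (r * z) + s))%R.
transitivity ((F g)%:E - (F (- g)%R)%:E).
  apply: integral_is_derive.
  - by rewrite gtrN.
  - move=> z /pos zp.
    have -> : F =
       ((- r^-1) \*: (Num.sqrt \o (fun z => (r ^+ 2 + s) + (- (2 * r)) * z)))%R.
      by apply/funext => t /=; rewrite -afE.
    have zp' : (0 < (r ^+ 2 + s) + (- (2 * r)) * z)%R by rewrite -afE.
    have D := @is_derive1_comp _ Num.sqrt
      (fun t => (r ^+ 2 + s) + (- (2 * r)) * t)%R z _ _ (is_derive1_sqrt zp')
      (is_derive_affine (- (2 * r)) (r ^+ 2 + s) z).
    apply: (is_derive_eq (is_deriveZ _ D)).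
    rewrite -afE /GRing.scale/=.
    have : (Num.sqrt (r ^+ 2 - 2 * (r * z) + s) != 0)%R by rewrite gt_eqF// sqrtr_gt0.
    by move=> ?; field; apply/andP; split => //; rewrite gt_eqF.
  - move=> z /pos zp.
    apply: cvgV; first by rewrite gt_eqF// sqrtr_gt0.
    have : {for z, continuous (Num.sqrt \o (fun z => r ^+ 2 - 2 * (r * z) + s)%R)}.
      by apply: continuous_comp; [exact: cg|exact: sqrt_continuous].
    by [].
rewrite /F.
have -> : (r ^+ 2 - 2 * (r * g) + s = (r - g) ^+ 2)%R by rewrite -gg; ring.
have -> : (r ^+ 2 - 2 * (r * - g) + s = (r + g) ^+ 2)%R by rewrite -gg; ring.
rewrite !sqrtr_sqr (ger0_norm (ltW (addr_gt0 r0 g0))).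
rewrite [RHS](_ : _ = \int[mu]_(z in `[(- g)%R, g]) cst ((Num.max r g)^-1)%:E z)//.
rewrite integral_cst//= lebesgue_measure_itv/= lte_fin gtrN// -!EFinB -EFinM.
congr EFin; have [rg|gr'] := leP r g.
  by rewrite ler0_norm ?subr_le0//; field; rewrite !gt_eqF.
by rewrite gtr0_norm ?subr_gt0//; field; rewrite gt_eqF.
Qed.

(** Archimedes: on a sphere, each coordinate is uniformly distributed. *)
Lemma leb3_archimedes : exists2 c : R, (0 <= c)%R &
  forall H : R -> R -> \bar R,
  measurable_fun setT (fun p : R2 => H p.1 p.2) -> (forall s z, 0 <= H s z) ->
  \int[mu3]_y H (nsq y) y.2 =
  c%:E * \int[mu]_s \int[mu]_z (if (z ^+ 2 < s)%R then H s z else 0).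
Proof.
have [c c0 cP] := leb2_polar (R := R); exists c => // H mH H0.
pose F (s z : R) := if (z ^+ 2 < s)%R then H s z else 0.
have F0 s z : 0 <= F s z by rewrite /F; case: ifP.
have mF : measurable_fun setT (fun p : R2 => F p.1 p.2).
  by apply: measurable_fun_ifT; [mfun|exact: mH|mfun].
rewrite (tonelli_swap mu mu mF F0).
have mF' : measurable_fun setT (fun p : R2 => F p.2 p.1).
  apply: (measurableT_comp mF (g := fun p : R2 => (p.2, p.1))).
  by mfun.
rewrite -ge0_integralZl_fin//; last 2 first.
- exact: (mfun_int2 mu (f := fun z s => F s z)).
- by move=> z; exact: integral_ge0.
have mN : measurable_fun setT (fun y : R3 R => H (nsq y) y.2).
  apply: (measurableT_comp mH (g := fun y : R3 R => (nsq y, y.2))).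
  by apply: measurable_fun_pair => //; exact: (measurable_nsq (f := id)).
rewrite /leb3 (fubini_tonelli2 (fun y : R3 R => H (nsq y) y.2))//.
apply: eq_integral => z _; rewrite /fubini_G.
have mHz : measurable_fun setT (fun t : R => H (t + z ^+ 2)%R z).
  apply: (measurableT_comp mH (g := fun t : R => ((t + z ^+ 2)%R, z) : R2)).
  by mfun.
transitivity (\int[mu2]_p H (p.1 * p.1 + p.2 * p.2 + z ^+ 2)%R z).
  by apply: eq_integral => -[x y] _; rewrite /nsq /dot3/= expr2.
rewrite (cP (fun t => H (t + z ^+ 2)%R z) mHz)//; congr (_ * _).
have mFz : measurable_fun setT (fun s => F s z).
  apply: (measurableT_comp mF (g := fun t : R => (t, z) : R2)).
  by mfun.
rewrite -[RHS](ge0_integral_shift (z ^+ 2) mFz)//.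
by apply: eq_integral => t _; rewrite /F ltrDr.
Qed.

Lemma leb3_radial : exists2 c : R, (0 <= c)%R &
  forall G : R -> \bar R, measurable_fun setT G -> (forall s, 0 <= G s) ->
  \int[mu3]_y G (nsq y) =
  c%:E * \int[mu]_s \int[mu]_z (if (z ^+ 2 < s)%R then G s else 0).
Proof.
have [c c0 cP] := leb3_archimedes; exists c => // G mG G0.
by rewrite (cP (fun s _ => G s))//; mfun.
Qed.

Lemma norm3B (x y : R3 R) : norm3 ((x : R * R * R) - y)%R =
  Num.sqrt (nsq x - 2 * dot3 x y + nsq y).
Proof. by rewrite /norm3; congr Num.sqrt; rewrite /nsq /dot3/=; ring. Qed.

(** Newton's theorem: a radial charge acts on [x] as if the part of it inside
    the sphere through [x] were at the centre, and the part outside at its own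
    distance from the centre. *)
Lemma newton (G : R -> \bar R) (x : R3 R) : x.1.1 != 0%R :> R ->
  measurable_fun setT G -> (forall s, 0 <= G s) ->
  \int[mu3]_y (G (nsq y) * ((norm3 ((x : R * R * R) - y)%R)^-1)%:E) =
  \int[mu3]_y (G (nsq y) * ((Num.max (norm3 x) (norm3 y))^-1)%:E).
Proof.
move=> x0 mG G0; have [c c0 cP] := leb3_archimedes.
pose r := norm3 x.
have r0 : (0 < r)%R.
  rewrite /r norm3E sqrtr_gt0 /nsq /dot3 -!expr2 !ltr_pwDl ?sqr_ge0//.
  by rewrite exprn_even_gt0.
have rr : (r ^+ 2 = nsq x)%R by rewrite norm3_sqr.
pose H1 (s d : R) := G s * ((Num.sqrt (r ^+ 2 - 2 * d + s))^-1)%:E.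
have mH1 : measurable_fun setT (fun p : R2 => H1 p.1 p.2).
  by apply: emeasurable_funM; mfun.
have H10 s d : 0 <= H1 s d by rewrite mule_ge0// lee_fin invr_ge0 sqrtr_ge0.
transitivity (\int[mu3]_y H1 (nsq y) (dot3 x y)).
  by apply: eq_integral => y _; rewrite norm3B /H1 rr.
rewrite leb3_radial_dot// -/r.
pose H2 (s z : R) := H1 s (r * z)%R.
have mH2 : measurable_fun setT (fun p : R2 => H2 p.1 p.2).
  by apply: emeasurable_funM; mfun.
pose H3 (s z : R) := G s * ((Num.max r (Num.sqrt s))^-1)%:E.
have mH3 : measurable_fun setT (fun p : R2 => H3 p.1 p.2).
  by apply: emeasurable_funM; mfun.
have H30 s z : 0 <= H3 s z.
  by rewrite mule_ge0// lee_fin invr_ge0 le_max (ltW r0).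
transitivity (\int[mu3]_y H3 (nsq y) y.2); last by apply: eq_integral.
have H20 s z : 0 <= H2 s z by exact: H10.
apply: (etrans (cP H2 mH2 H20)); apply: (etrans _ (esym (cP H3 mH3 H30))).
apply: (congr1 (mule c%:E)).
have mI (H : R -> R -> \bar R) : measurable_fun setT (fun p : R2 => H p.1 p.2) ->
    (forall s z, 0 <= H s z) -> measurable_fun setT
    (fun s => \int[mu]_z (if (z ^+ 2 < s)%R then H s z else 0)).
  move=> mH H0.
  apply: (mfun_int2 mu (f := fun s z => if (z ^+ 2 < s)%R then H s z else 0)).
    by apply: measurable_fun_ifT; [mfun|exact: mH|mfun].
  by move=> s z; case: ifP.
apply: ge0_ae_eq_integral => //.
- by apply: mI => // s z; exact: H10.
- exact: mI.
- by move=> s _; apply: integral_ge0 => z _; case: ifP => // _; exact: H10.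
- by move=> s _; apply: integral_ge0 => z _; case: ifP.
(* the primitive is singular on the sphere through [x] only *)
exists [set (r ^+ 2)%R]; split => //; first exact: lebesgue_measure_set1.
move=> s /= /not_implyP[_]; apply: contra_notP => /eqP sr.
have [s0|s0] := ltP 0%R s; last first.
  have s2 z : (z ^+ 2 < s)%R = false.
    by apply/negbTE; rewrite -leNgt (le_trans s0)// sqr_ge0.
  by apply: eq_integral => z _; rewrite s2.
have E (f : R -> R) : measurable_fun setT f -> (forall z, 0 <= f z)%R ->
    \int[mu]_z (if (z ^+ 2 < s)%R then G s * (f z)%:E else 0) =
    G s * \int[mu]_z (if (z ^+ 2 < s)%R then (f z)%:E else 0).
  move=> mf f0; rewrite -ge0_integralZl//; last 2 first.
  - by mfun.
  - by move=> z _; case: ifP => // _; rewrite lee_fin.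
  by apply: eq_integral => z _; case: ifP => // _; rewrite mule0.
rewrite /H2 /H1 (E (fun z => ((Num.sqrt (r ^+ 2 - 2 * (r * z) + s))^-1)%R)); last 2 first.
- by mfun.
- by move=> z; rewrite invr_ge0 sqrtr_ge0.
rewrite /H3 (E (cst _))//; last by move=> z; rewrite invr_ge0 le_max (ltW r0).
by rewrite integral_inv_dist.
Qed.

End newton.

(** * Null sets and dominated convergence *)

Section integral_tools.
Context d (T : measurableType d) (R : realType) (m : {measure set T -> \bar R}).
Local Open Scope ereal_scope.

Lemma ge0_integral_eq0_ae (f : T -> \bar R) : measurable_fun setT f ->
  (forall x, 0 <= f x) -> \int[m]_x f x = 0 -> {ae m, forall x, f x = 0}.
Proof.
move=> mf f0 i0.
have /(ae_eq_integral_abs _ measurableT mf) : \int[m]_x `|f x| = 0.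
  by rewrite -i0; apply: eq_integral => x _; rewrite gee0_abs.
by apply: filterS => x /= /(_ I).
Qed.

Lemma le_integral_EFin (f g : T -> R) :
  (forall x, 0 <= f x)%R -> measurable_fun setT f -> measurable_fun setT g ->
  (forall x, f x <= g x)%R -> \int[m]_x (f x)%:E <= \int[m]_x (g x)%:E.
Proof.
move=> f0 mf mg fg; apply: ge0_le_integral => //.
- by move=> x _; rewrite lee_fin.
- by mfun.
- by mfun.
- by move=> x _; rewrite lee_fin.
Qed.

Lemma cvg_integral0 (f : nat -> T -> R) (g : T -> R) :
  (forall n, measurable_fun setT (f n)) -> measurable_fun setT g ->
  (forall n x, 0 <= f n x <= g x)%R -> \int[m]_x (g x)%:E < +oo ->
  (forall x, f ^~ x @ \oo --> 0%R) ->
  \int[m]_x (f n x)%:E @[n --> \oo] --> 0.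
Proof.
move=> mf mg fg gfin f0.
have g0 x : (0 <= g x)%R by have /andP[f1] := fg 0%N x; exact: le_trans.
have [] := @dominated_convergence _ _ _ m setT measurableT
  (fun n x => (f n x)%:E) (cst 0) (fun x => (g x)%:E).
- by move=> n; mfun.
- exact: measurable_cst.
- by apply: aeW => x _; apply: cvg_EFin; [exact: nearW|exact: f0].
- apply/integrableP; split; first by mfun.
  by under eq_integral do rewrite gee0_abs ?lee_fin//.
- by apply: aeW => x n _; have /andP[f1 f2] := fg n x; rewrite gee0_abs lee_fin.
- by move=> _ _; rewrite integral0.
Qed.

End integral_tools.

Lemma cvge0_lt (R : realType) (u : nat -> \bar R) (e : R) : (0 < e)%R ->
  (u n @[n --> \oo] --> 0)%E -> \forall n \near \oo, (u n < e%:E)%E.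
Proof.
move=> e0 /(_ [set y | (y < e%:E)%E]); apply.
by apply: open_ereal_lt'; rewrite lte_fin.
Qed.

(** * Radial functions *)
Section profile.
Context {R : realType}.
Notation mu := (@lebesgue_measure R).
Notation mu3 := (@leb3 R).
Notation R2 := (measurableTypeR R * measurableTypeR R)%type.
Local Open Scope ereal_scope.

(** A property that holds almost everywhere holds somewhere off the origin,
    since a cube of positive measure avoids the origin. *)
Lemma leb3_not_ae_nsq_le0 (P : set (R3 R)) :
  {ae mu3, forall x, P x} -> exists2 x, P x & (0 < nsq x)%R.
Proof.
move=> [N [mN N0 PN]].
pose I : set (measurableTypeR R) := [set` `[1%R, 2%R]].
pose B : set (R3 R) := I `*` I `*` I.
have mI : measurable I by exact: measurable_itv.
have mB : measurable B by apply: measurableX => //; exact: measurableX.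
have B1 : mu3 B = 1.
  have I1 : mu I = 1.
    by rewrite lebesgue_measure_itv/= lte_fin ltr1n -EFinB; congr EFin; ring.
  have I2 : leb2 (I `*` I) = 1.
    rewrite /leb2 product_measure1E//.
    exact: (etrans (congr2 mule I1 I1) (mule1 _)).
  rewrite /leb3 product_measure1E//; last exact: measurableX.
  exact: (etrans (congr2 mule I2 I1) (mule1 _)).
have : exists2 x, B x & ~ N x.
  apply: contrapT => /forall2NP BN.
  have : mu3 B <= mu3 N.
    apply: le_measure; rewrite ?inE// => x Bx.
    by have [//|/contrapT] := BN x.
  by rewrite B1 N0 lee_fin ler10.
move=> [x [[/= x1 x2] x3] Nx]; exists x; first by apply: contrapT => /PN.
rewrite /nsq /dot3 -!expr2 ltr_pwDr ?addr_ge0 ?sqr_ge0//.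
move: x3; rewrite /I/= in_itv/= => /andP[x3 _].
by rewrite exprn_even_gt0//= gt_eqF// (lt_le_trans _ x3).
Qed.

(** In polar coordinates, a null set of radii gives a null set in space. The
    value [1] at nonpositive radii makes the origin exceptional too. *)
Lemma leb3_radial_ae (G : R -> \bar R) : measurable_fun setT G ->
  (forall s, 0 <= G s) -> \int[mu]_s (if (0 < s)%R then G s else 0) = 0 ->
  {ae mu3, forall x, (0 < nsq x)%R /\ G (nsq x) = 0}.
Proof.
move=> mG G0 iG; have [c c0 cP] := leb3_radial (R := R).
pose F s := if (0 < s)%R then G s else 1.
have mF : measurable_fun setT F by mfun.
have F0 s : 0 <= F s by rewrite /F; case: ifP.
have mFn : measurable_fun setT (fun x : R3 R => F (nsq x)).
  by apply: (measurableT_comp mF); exact: (measurable_nsq (f := id)).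
have : {ae mu3, forall x, F (nsq x) = 0}.
  apply: ge0_integral_eq0_ae => //.
  rewrite cP//.
  pose H s z := if (z ^+ 2 < s)%R then F s else 0.
  have mH : measurable_fun setT (fun p : R2 => H p.1 p.2).
    by apply: measurable_fun_ifT; [mfun|mfun|mfun].
  have H0 s z : 0 <= H s z by rewrite /H; case: ifP.
  have mG' : measurable_fun setT (fun s : R => if (0 < s)%R then G s else 0) by mfun.
  rewrite (tonelli_swap mu mu mH H0) integral0_eq ?mule0// => z _.
  apply/eqP; rewrite eq_le integral_ge0// andbT -iG.
  apply: ge0_le_integral => //.
  - exact: (measurableT_comp mH (pair2_measurable z)).
  - move=> s _; rewrite /H; case: ifPn => [zs|_]; last by case: ifP.
    by rewrite /F (le_lt_trans _ zs)// sqr_ge0.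
apply: filterS => x; rewrite /F; case: ifPn => // _ /eqP.
by rewrite onee_eq0.
Qed.

(** By Fubini, [u] agrees with its radial description along almost every ray;
    one such ray provides a measurable profile, and polar coordinates show that
    the exceptional radii are negligible in space. *)
Lemma radial_profile (u : R3 R -> R[i]) : cmeasurable u -> radial u ->
  exists p q : R -> R, [/\ measurable_fun setT p, measurable_fun setT q &
    {ae mu3, forall x, (0 < nsq x)%R /\ u x = (p (nsq x) +i* q (nsq x))%C}].
Proof.
move=> [mre mim] [f [N [mN N0 fN]]].
have mIN : measurable_fun setT (\1_N : R3 R -> R) by exact: measurable_indic.
pose h (x : R3 R) (t : R) : \bar R :=
  if (0 < t)%R then (\1_N (scale3 (Num.sqrt t) x) : R)%:E else 0.
have h0 x t : 0 <= h x t by rewrite /h; case: ifP => // _; rewrite lee_fin.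
have mh : measurable_fun setT (fun z : R3 R * measurableTypeR R => h z.1 z.2).
  apply: measurable_fun_ifT; [by mfun| |by mfun].
  apply: mfun_EFin; apply: (measurableT_comp mIN).
  by apply: measurable_scale3; mfun.
have ih : \int[mu3]_x \int[mu]_t h x t = 0.
  rewrite (tonelli_swap mu3 mu mh h0); apply: integral0_eq => t _.
  have [t0|t0] := ltP 0%R t; last first.
    by apply: integral0_eq => x _; rewrite /h ltNge t0.
  under eq_integral do rewrite /h t0.
  have t1 : (0 < Num.sqrt t)%R by rewrite sqrtr_gt0.
  have mIN' : measurable_fun setT (fun x : R3 R => (\1_N x : R)%:E) by mfun.
  rewrite (leb3_scale t1 mIN'); last by move=> x; rewrite lee_fin.
  have -> : \int[mu3]_x (\1_N x : R)%:E = 0.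
    by rewrite integral_indic// setIT; exact: N0.
  by rewrite mule0.
have [x0 hx0 n0] : exists2 x, \int[mu]_t h x t = 0 & (0 < nsq x)%R.
  apply: leb3_not_ae_nsq_le0; apply: ge0_integral_eq0_ae ih.
    exact: mfun_int2.
  by move=> x; exact: integral_ge0.
pose g (s : R) := scale3 (Num.sqrt ((nsq x0)^-1 * s)) x0.
have mg : measurable_fun setT g.
  by apply: measurable_scale3; mfun.
have ng s : (0 < s)%R -> nsq (g s) = s.
  move=> s0; rewrite nsq_scale sqr_sqrtr; last by rewrite mulr_ge0 ?invr_ge0 ?ltW.
  by rewrite mulrAC mulVf ?mul1r// gt_eqF.
exists (fun s => complex.Re (u (g s))), (fun s => complex.Im (u (g s))); split.
- exact: (measurableT_comp mre mg).
- exact: (measurableT_comp mim mg).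
pose G s : \bar R := (\1_N (g s) : R)%:E.
have mG : measurable_fun setT G by apply: mfun_EFin; exact: (measurableT_comp mIN mg).
have : {ae mu3, forall x, (0 < nsq x)%R /\ G (nsq x) = 0}.
  apply: leb3_radial_ae => //; first by move=> s; rewrite lee_fin.
  have n0' : (0 < (nsq x0)^-1)%R by rewrite invr_gt0.
  have mhx : measurable_fun setT (h x0).
    exact: (measurableT_comp mh (pair1_measurable x0)).
  have := ge0_integral_scale n0' mhx (h0 x0); rewrite hx0 mule0 => h0'.
  rewrite -[RHS]h0'.
  by apply: eq_integral => s _; rewrite /h pmulr_rgt0.
have : {ae mu3, forall x, ~ N x}.
  by exists N; split; [exact: mN|exact: N0|move=> x /= H; exact: contrapT].
apply: filterS2 => x Nx [x_gt0 Gx]; split => //.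
have fu y : ~ N y -> u y = f (norm3 y) by move=> Ny; apply: contrapT => /fN.
have Ngx : ~ N (g (nsq x)).
  move=> Ngx; move: Gx; rewrite /G indicE mem_set// => /eqP.
  by rewrite onee_eq0.
rewrite [LHS](_ : _ = u (g (nsq x))).
  by case: (u _).
by rewrite !fu// !norm3E ng.
Qed.

End profile.

(** * Approximation of radial functions *)

Section density.
Context {R : realType}.
Notation mu := (@lebesgue_measure R).
Notation mu3 := (@leb3 R).
Notation R2 := (measurableTypeR R * measurableTypeR R)%type.
Local Open Scope ereal_scope.

Let clip (M t : R) : R := Num.max (- M)%R (Num.min M t).

Let clip_le (M t : R) : (0 <= M)%R -> (`|clip M t| <= M)%R.
Proof.
move=> M0; rewrite /clip ler_norml; apply/andP; split.
  by rewrite le_max lexx.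
by rewrite ge_max ge_min lexx/= andbT (le_trans _ M0)// oppr_le0.
Qed.

Let clip_near (M s t : R) : (`|s| <= M)%R -> (`|s - clip M t| <= `|s - t|)%R.
Proof.
rewrite ler_norml => /andP[s1 s2]; have MM := le_trans s1 s2.
rewrite /clip; have [Mt|tM] := leP M t.
  by rewrite max_r// !ler0_norm; lra.
have [//|tM'] := leP (- M)%R t.
by rewrite !ger0_norm; lra.
Qed.

Let cutoff (M s : R) : R := (Num.max 0 (Num.min 1 (M + 1 - s)))%R.

Let cutoff01 (M s : R) : (0 <= cutoff M s <= 1)%R.
Proof. by rewrite /cutoff le_max lexx/= ge_max ler01 ge_min lexx. Qed.

Let cutoff1 (M s : R) : (s <= M)%R -> cutoff M s = 1%R.
Proof.
move=> sM; rewrite /cutoff min_l; last by lra.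
by rewrite max_r.
Qed.

Let cutoff0 (M s : R) : (M + 1 <= s)%R -> cutoff M s = 0%R.
Proof.
move=> sM; rewrite /cutoff max_l// ge_min; apply/orP; right; lra.
Qed.

Let continuous_clip (M : R) (g : R -> R) : continuous g ->
  continuous (fun s => clip M (g s)).
Proof.
move=> cg s; apply: (@continuous_max R R (cst (- M)%R) (fun s => Num.min M (g s))).
  exact: cvg_cst.
apply: (@continuous_min R R (cst M) g); first exact: cvg_cst.
exact: cg.
Qed.

Let continuous_cutoff (M : R) : continuous (cutoff M).
Proof.
move=> s; apply: (@continuous_max R R (cst 0%R) (fun s => Num.min 1 (M + 1 - s))%R).
  exact: cvg_cst.
apply: (@continuous_min R R (cst 1%R) (fun s => M + 1 - s)%R); first exact: cvg_cst.
by apply: cvgB; [exact: cvg_cst|exact: cvg_id].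
Qed.

Lemma truncation_density (phi : R -> R) (e : R) : measurable_fun setT phi ->
  \int[mu3]_x ((phi (nsq x) ^+ 2)%R)%:E < +oo -> (0 < e)%R ->
  exists M : nat, \int[mu3]_x (((phi (nsq x) -
    (if (`|phi (nsq x)| <= M%:R) && (nsq x <= M%:R) then phi (nsq x) else 0)) ^+ 2)%R)%:E
    < e%:E.
Proof.
move=> mphi fin e0.
have mn : measurable_fun setT (@nsq R) by exact: (measurable_nsq (f := id)).
have mpn : measurable_fun setT (fun x : R3 R => phi (nsq x)).
  exact: (measurableT_comp mphi mn).
have mc (M : R) : measurable_fun setT (fun x : R3 R =>
    if (`|phi (nsq x)| <= M)%R && (nsq x <= M)%R then phi (nsq x) else 0%R).
  apply: measurable_fun_ifT; [|exact: mpn|by mfun].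
  by apply: measurable_and; mfun.
pose f (M : nat) (x : R3 R) : R := ((phi (nsq x) -
  (if (`|phi (nsq x)| <= M%:R) && (nsq x <= M%:R) then phi (nsq x) else 0)) ^+ 2)%R.
have mf M : measurable_fun setT (f M).
  by apply: measurable_funX; apply: measurable_funB => //; exact: mc.
have fle M x : (0 <= f M x <= phi (nsq x) ^+ 2)%R.
  rewrite sqr_ge0/= /f; case: ifPn => _; last by rewrite subr0.
  by rewrite subrr expr0n/= sqr_ge0.
have f0 x : f ^~ x @ \oo --> 0%R.
  apply: cvg_near_cst; near=> M.
  rewrite /f (_ : _ && _ = true) ?subrr ?expr0n//.
  by apply/andP; split; near: M; exact: nbhs_infty_ger.
have cvg0 := cvg_integral0 mf (measurable_funX 2 mpn) fle fin f0.
have [M _ H] := cvge0_lt e0 cvg0.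
by exists M; exact: (H M (leqnn M)).
Unshelve. all: by end_near. Qed.

(** The truncated profile is approximated in [L1] of a bounded interval of
    squared radii. Clipping the approximation to the bound of the profile keeps
    the error bounded, so that its square is controlled by the error in [L1]. *)
Lemma radial_density (phi : R -> R) (e : R) : measurable_fun setT phi ->
  \int[mu3]_x ((phi (nsq x) ^+ 2)%R)%:E < +oo -> (0 < e)%R ->
  exists h : R -> R, exists B S : R, [/\ continuous h, (0 <= S)%R,
    (forall s, `|h s| <= B)%R, (forall s, S < s -> h s = 0)%R &
    \int[mu3]_x (((phi (nsq x) - h (nsq x)) ^+ 2)%R)%:E < e%:E].
Proof.
move=> mphi fin e0.
have mn : measurable_fun setT (@nsq R) by exact: (measurable_nsq (f := id)).
(* two errors, each with the factor two that bounds the square of a sum *)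
have e4 : (0 < e / 4)%R by rewrite divr_gt0.
have [n nP] := truncation_density mphi fin e4.
pose M : R := n%:R.
have M0 : (0 <= M)%R by rewrite /M.
pose psi (s : R) : R := if (`|phi s| <= M)%R && (s <= M)%R then phi s else 0%R.
have mpsi : measurable_fun setT psi.
  apply: measurable_fun_ifT; [|exact: mphi|by mfun].
  by apply: measurable_and; mfun.
have psiM s : (`|psi s| <= M)%R.
  by rewrite /psi; case: ifPn => [/andP[]//|_]; rewrite normr0.
pose E : set (measurableTypeR R) := [set` `[0%R, (M + 1)%R]].
have mE : measurable E by exact: measurable_itv.
have Efin : mu E < +oo.
  rewrite lebesgue_measure_itv/=.
  by case: ifP => _; rewrite ?ltry// -EFinB ltry.
have psi_int : mu.-integrable E (EFin \o psi).
  apply: measurable_bounded_integrable => //.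
    exact: measurable_funTS.
  exists M; split; first by rewrite num_real.
  by move=> x Mx s _ /=; rewrite (le_trans (psiM s))// ltW.
have [g_ [cg_ intg cvg_g]] := approximation_continuous_integrable mE Efin psi_int.
have [c c0 cP] := leb3_radial (R := R).
pose C := (c * (2 * (M + 1) * (2 * M)) + 1)%R.
have C0 : (0 < C)%R by rewrite ltr_pwDr// !mulr_ge0// addr_ge0.
have e4C : (0 < e / 4 / C)%R by rewrite !divr_gt0.
have [k _ /(_ k (leqnn k)) gk] := cvge0_lt e4C cvg_g.
have cg := cg_ k; move: gk; set g := g_ k => gk.
pose h s := (cutoff M s * clip M (g s))%R.
have ch : continuous h.
  by move=> s; apply: cvgM; [exact: continuous_cutoff|exact: continuous_clip].
exists h, M, (M + 1)%R; split => //.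
- by rewrite addr_ge0.
- move=> s; rewrite normrM -[leRHS]mul1r ler_pM//; last exact: clip_le.
  by have /andP[? ?] := cutoff01 M s; rewrite ger0_norm.
- by move=> s Ms; rewrite /h cutoff0 ?mul0r// ltW.
have mh : measurable_fun setT h by exact: continuous_measurable_fun.
have mg : measurable_fun setT g by exact: continuous_measurable_fun.
have hM s : (`|psi s - h s| <= 2 * M)%R.
  rewrite (le_trans (ler_normB _ _))// [leRHS](_ : _ = M + M)%R; last by ring.
  apply: lerD => //; rewrite /h normrM -[leRHS]mul1r ler_pM//; last exact: clip_le.
  by have /andP[? ?] := cutoff01 M s; rewrite ger0_norm.
have hg s : (`|psi s - h s| <= `|psi s - g s|)%R.
  have [sM|Ms] := leP s M.
    by rewrite /h cutoff1// mul1r clip_near.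
  have -> : psi s = 0%R by rewrite /psi [(s <= M)%R]leNgt Ms andbF.
  rewrite !sub0r !normrN /h normrM.
  apply: (@le_trans _ _ (`|clip M (g s)|)%R).
    by rewrite ler_piMl//; have /andP[? ?] := cutoff01 M s; rewrite ger0_norm.
  by have := @clip_near M 0%R (g s); rewrite normr0 !sub0r !normrN; apply.
pose D (s : R) : \bar R := (((psi s - h s) ^+ 2)%R)%:E.
have mD : measurable_fun setT D by rewrite /D; mfun.
have D0 s : 0 <= D s by rewrite lee_fin sqr_ge0.
have psih : \int[mu3]_x D (nsq x) <= (e / 4)%:E.
  rewrite cP//.
  pose k1 s := (2 * M * `|psi s - g s|)%R.
  have mk1 : measurable_fun setT (fun s => (k1 s)%:E).
    by rewrite /k1; mfun.
  pose F (s z : R) : \bar R := if (z ^+ 2 < s)%R then D s else 0.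
  have mF : measurable_fun setT (fun p : R2 => F p.1 p.2).
    by apply: measurable_fun_ifT; mfun.
  have F0 s z : 0 <= F s z by rewrite /F; case: ifP.
  have int_k1 : \int[mu]_(s in E) (k1 s)%:E <= (2 * M * (e / 4 / C))%:E.
    rewrite /k1; under eq_integral do rewrite EFinM.
    rewrite ge0_integralZl; [|exact: mE|by apply: measurable_funTS; mfun
      |by move=> s _; rewrite lee_fin|by rewrite lee_fin mulr_ge0].
    rewrite [leRHS]EFinM; apply: lee_wpmul2l; last exact: ltW.
    by rewrite lee_fin mulr_ge0.
  have step : \int[mu]_s \int[mu]_z F s z <=
      \int[mu]_s ((2 * (M + 1))%:E * ((fun s => (k1 s)%:E) \_ E) s).
    apply: ge0_le_integral => //.
    - by move=> s _; exact: integral_ge0.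
    - exact: mfun_int2.
    - apply: emeasurable_funM => //.
      by apply/(measurable_restrictT _ mE); exact: measurable_funTS.
    move=> s _; rewrite patchE; case: ifPn => sE; last first.
      rewrite mule0 integral0_eq// => z _; rewrite /F; case: ifPn => // zs.
      rewrite /D; suff -> : (psi s - h s = 0)%R by rewrite expr0n.
      have s0 : (0 <= s)%R by rewrite ltW// (le_lt_trans _ zs)// sqr_ge0.
      have Ms : (M + 1 < s)%R.
        rewrite ltNge; apply/negP => sM; move/negP: sE; apply.
        by rewrite inE /E/= in_itv/= s0.
      rewrite /h cutoff0 ?ltW// mul0r subr0 /psi.
      by rewrite [(s <= M)%R]leNgt (lt_trans _ Ms) ?ltrDl// andbF.
    pose I : set (measurableTypeR R) := [set` `[- (M + 1), M + 1]%R].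
    have mI : measurable I by exact: measurable_itv.
    have M1 : (0 < M + 1)%R by rewrite ltr_wpDl.
    have muI : mu I = (2 * (M + 1))%:E.
      rewrite lebesgue_measure_itv/= lte_fin gtrN// -EFinB; congr EFin; ring.
    rewrite -[X in X * _]muI muleC -integral_cst//=.
    rewrite [leRHS]integral_mkcond.
    apply: ge0_le_integral => //.
    - exact: (measurableT_comp mF (pair1_measurable s)).
    - by apply/(measurable_restrictT _ mI); exact: measurable_cst.
    move=> z _; rewrite patchE; case: ifPn => zI; last first.
      rewrite /F; case: ifPn => // zs; exfalso; move/negP: zI; apply.
      move: sE; rewrite inE /E/= in_itv/= => /andP[s0 sM].
      rewrite inE /I/= in_itv/= -ler_norml.
      rewrite -(@ler_pXn2r _ 2) ?nnegrE ?(ltW M1)// real_normK ?num_real//.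
      rewrite (le_trans (ltW zs))// (le_trans sM)// expr2.
      by rewrite -[leLHS]mulr1 ler_pM2l// lerDr.
    rewrite /F; case: ifPn => _; last by rewrite lee_fin !mulr_ge0.
    rewrite lee_fin -real_normK ?num_real// expr2 /k1.
    by rewrite ler_pM.
  apply: (@le_trans _ _ (c%:E * ((2 * (M + 1))%:E * (2 * M * (e / 4 / C))%:E))).
    apply: lee_wpmul2l; first by rewrite lee_fin.
    apply: (le_trans step).
    rewrite ge0_integralZl_fin; last 3 first.
    - by rewrite mulr_ge0// addr_ge0.
    - by apply/(measurable_restrictT _ mE); exact: measurable_funTS.
    - by apply: erestrict_ge0 => s _; rewrite lee_fin !mulr_ge0.
    rewrite -integral_mkcond; apply: lee_wpmul2l => //.
    by rewrite lee_fin mulr_ge0// addr_ge0.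
  rewrite -!EFinM lee_fin.
  rewrite [leLHS](_ : _ = (C - 1) / C * (e / 4))%R; last first.
    have -> : (C - 1 = c * (2 * (M + 1) * (2 * M)))%R by rewrite /C addrK.
    by move: C0; clearbody C; move=> C0; field; rewrite gt_eqF.
  rewrite ler_piMl//; first exact: ltW.
  by rewrite ler_pdivrMr// mul1r gerBl.
apply: (@le_lt_trans _ _ (\int[mu3]_x ((2 * (phi (nsq x) - psi (nsq x)) ^+ 2 +
    2 * (psi (nsq x) - h (nsq x)) ^+ 2)%R)%:E)).
  apply: le_integral_EFin.
  - by move=> x; exact: sqr_ge0.
  - by apply: (measurableT_comp (f := fun s => ((phi s - h s) ^+ 2)%R)) => //; mfun.
  - by apply: (measurableT_comp (f := fun s => (2 * (phi s - psi s) ^+ 2 +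
      2 * (psi s - h s) ^+ 2)%R)) => //; mfun.
  move=> x; set a := phi _; set b := psi _; set d := h _.
  have : (0 <= ((a - b) - (b - d)) ^+ 2)%R by exact: sqr_ge0.
  nra.
under eq_integral do rewrite EFinD !EFinM.
have m1 : measurable_fun setT (fun x : R3 R => (((phi (nsq x) - psi (nsq x)) ^+ 2)%R)%:E).
  by apply: (measurableT_comp (f := fun s => (((phi s - psi s) ^+ 2)%R)%:E)) => //; mfun.
have m2 : measurable_fun setT (fun x : R3 R => (((psi (nsq x) - h (nsq x)) ^+ 2)%R)%:E).
  by apply: (measurableT_comp (f := fun s => (((psi s - h s) ^+ 2)%R)%:E)) => //; mfun.
rewrite ge0_integralD//; last 4 first.
- by move=> x _; rewrite mule_ge0// lee_fin sqr_ge0.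
- exact: emeasurable_funM.
- by move=> x _; rewrite mule_ge0// lee_fin sqr_ge0.
- exact: emeasurable_funM.
rewrite !ge0_integralZl_fin//; last 2 first.
- by move=> x; rewrite lee_fin sqr_ge0.
- by move=> x; rewrite lee_fin sqr_ge0.
move: psih; rewrite /D; set I2 := \int[mu3]_x _ => I2le.
have I2_ge0 : 0 <= I2 by apply: integral_ge0 => x _; rewrite lee_fin sqr_ge0.
move: nP; rewrite -/(psi _); set I1 := \int[mu3]_x _ => I1lt.
have I1_ge0 : 0 <= I1 by apply: integral_ge0 => x _; rewrite lee_fin sqr_ge0.
have f1 : I1 \is a fin_num by rewrite ge0_fin_numE// (lt_le_trans I1lt) ?leey.
have f2 : I2 \is a fin_num by rewrite ge0_fin_numE// (le_lt_trans I2le) ?ltry.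
change (2%:E * I1 + 2%:E * I2 < e%:E).
move: I1lt I2le; rewrite -(fineK f1) -(fineK f2) -!EFinM -EFinD !lte_fin lee_fin.
by lra.
Qed.

End density.

(** * The Poisson kernel and its Fourier transform *)
Section poisson_kernel.
Context {R : realType}.
Notation mu := (@lebesgue_measure R).

Definition exp1 (e t : R) : R := expR (- (e * `|t|)).
Definition pois1 (e z : R) : R := 2 * e / (e ^+ 2 + z ^+ 2).

Lemma exp1_ge0 e t : 0 <= exp1 e t. Proof. exact: expR_ge0. Qed.

Lemma pois1_ge0 e z : 0 < e -> 0 <= pois1 e z.
Proof.
by move=> e0; rewrite /pois1 divr_ge0// ?mulr_ge0 ?(ltW e0)// addr_ge0 ?sqr_ge0.
Qed.

Lemma pois1_le e z : 0 < e -> pois1 e z <= 2 / e.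
Proof.
move=> e0; have d0 : 0 < e ^+ 2 + z ^+ 2 by rewrite ltr_pwDl ?sqr_ge0// exprn_gt0.
rewrite /pois1 ler_pdivrMr// mulrAC ler_pdivlMr// -mulrA ler_pM2l// -expr2.
by rewrite lerDl sqr_ge0.
Qed.

Lemma measurable_exp1 d (T : measurableType d) (e : R) (f : T -> R) :
  measurable_fun setT f -> measurable_fun setT (fun x => exp1 e (f x)).
Proof. by move=> mf; rewrite /exp1; mfun. Qed.

Lemma measurable_pois1 d (T : measurableType d) (e : R) (f : T -> R) :
  measurable_fun setT f -> measurable_fun setT (fun x => pois1 e (f x)).
Proof. by move=> mf; rewrite /pois1; mfun. Qed.

Local Open Scope ereal_scope.

(** The primitive is explicit: exponentials times trigonometric functions are
    closed under integration. *)
Let half (e a b A z : R) : (0 < e)%R -> (0 <= b <= a)%R ->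
  \int[mu]_(t in `[0%R, +oo[) (expR (- (e * t)) * (a + b * cos (A + t * z)))%:E =
  (a / e + b * (e * cos A - z * sin A) / (e ^+ 2 + z ^+ 2))%:E.
Proof.
move=> e0 /andP[b0 ba].
have a0 : (0 <= a)%R by exact: le_trans ba.
have d0 : (0 < e ^+ 2 + z ^+ 2)%R by rewrite ltr_pwDl ?sqr_ge0// exprn_gt0.
pose k := (e ^+ 2 + z ^+ 2)^-1%R.
pose E (t : R) := expR (- (e * t))%R.
pose F (t : R) := (E t * (- (a / e) + b * k * (z * sin (A + t * z) - e * cos (A + t * z))))%R.
pose f (t : R) := (E t * (a + b * cos (A + t * z)))%R.
have dE t : is_derive t (1%R : R) E (- e * E t)%R.
  have -> : E = expR \o (fun t => 0 + (- e) * t)%R.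
    by apply/funext => s; rewrite /E/= add0r mulNr.
  have D := @is_derive1_comp _ expR (fun t => 0 + (- e) * t)%R t _ _
    (is_derive_expR _) (is_derive_affine (- e) 0%R t).
  by apply: (is_derive_eq D) => /=; rewrite mulrC.
have afE : (fun t => A + t * z)%R = (fun t => A + z * t)%R :> (R -> R).
  by apply/funext => t; rewrite [(t * z)%R]mulrC.
have dA t : is_derive t (1%R : R) (fun t => A + t * z)%R z.
  by rewrite afE; exact: is_derive_affine.
have dsin t : is_derive t (1%R : R) (fun t => sin (A + t * z))%R (cos (A + t * z) * z)%R.
  exact: (@is_derive1_comp _ sin (fun t => A + t * z)%R t _ _ (is_derive_sin _) (dA t)).
have dcos t : is_derive t (1%R : R) (fun t => cos (A + t * z))%R (- sin (A + t * z) * z)%R.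
  exact: (@is_derive1_comp _ cos (fun t => A + t * z)%R t _ _ (is_derive_cos _) (dA t)).
have dF t : is_derive t (1%R : R) F (f t).
  have -> : F = (E * (cst (- (a / e))%R + (b * k)%R \*:
      (z \*: (fun t => sin (A + t * z)) - e \*: (fun t => cos (A + t * z)))))%R.
    by apply/funext => s.
  apply: is_derive_eq; rewrite /f /GRing.scale/=.
  have -> : ((cst (- (a / e)) + (b * k) \*: (z \*: (fun t => sin (A + t * z)) -
     e \*: (fun t => cos (A + t * z)))) t = - (a / e) +
     b * k * (z * sin (A + t * z) - e * cos (A + t * z)))%R by [].
  rewrite add0r.
  transitivity (E t * (a + b * ((e ^+ 2 + z ^+ 2) * k) * cos (A + t * z)))%R.
    by field; rewrite gt_eqF.
  by rewrite /k mulfV ?gt_eqF// mulr1.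
have cdiff (g : R -> R) (g' : R -> R) : (forall t, is_derive t (1%R : R) g (g' t)) -> continuous g.
  move=> dg t; apply: differentiable_continuous; apply/derivable1_diffP.
  by case: (dg t).
have cF : continuous F by exact: (cdiff _ f).
have cf : continuous f.
  move=> t; apply: cvgM; first exact: (cdiff _ _ dE).
  apply: cvgD; first exact: cvg_cst.
  by apply: cvgM; [exact: cvg_cst|exact: (cdiff _ _ dcos)].
have Foo : F x @[x --> +oo%R] --> (0 : R)%R.
  pose B := (`|a / e| + `|b * k| * (`|z| + `|e|))%R.
  have B0 : (0 <= B)%R by rewrite addr_ge0// mulr_ge0// addr_ge0.
  have FB t : (`|F t| <= B * E t)%R.
    rewrite /F normrM ger0_norm ?expR_ge0// mulrC ler_wpM2r ?expR_ge0//.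
    rewrite (le_trans (ler_normD _ _))// normrN lerD2l normrM ler_wpM2l//.
    rewrite (le_trans (ler_normB _ _))// !normrM lerD//.
      by rewrite ler_piMr// ler_norml sin_geN1 sin_le1.
    by rewrite ler_piMr// ler_norml cos_geN1 cos_le1.
  have E0 : (B * E x)%R @[x --> +oo%R] --> (0 : R)%R.
    rewrite -[X in _ --> X](mulr0 B); apply: cvgM; first exact: cvg_cst.
    apply: (cvg_comp (fun t => e * t)%R (fun t => expR (- t))); last exact: cvgr_expR.
    by apply: gt0_cvgMry => //; exact: cvg_id.
  apply/cvgr0Pnorm_lt => d d0'.
  move/cvgr0Pnorm_lt : E0 => /(_ d d0'); apply: filterS => t; apply: le_lt_trans.
  by rewrite [leRHS]ger0_norm// mulr_ge0// expR_ge0.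
transitivity ((0%R)%:E - (F 0%R)%:E); last first.
  rewrite -EFinB; congr EFin; rewrite /F /E mulr0 oppr0 expR0 mul0r addr0 mul1r /k.
  by field; rewrite !gt_eqF.
apply: (@ge0_continuous_FTC2y _ f F 0%R 0%R).
- move=> t _; rewrite mulr_ge0 ?expR_ge0//.
  have : (- 1 <= cos (A + t * z))%R by exact: cos_geN1.
  nra.
- exact: continuous_subspaceT.
- exact: Foo.
- by move=> t _; case: (dF t).
- by apply: cvg_at_right_filter; exact: cF.
- by move=> t _; rewrite derive1E; case: (dF t).
Qed.

(** The Fourier transform of [exp1 e] is [pois1 e]. With the constant [a] added,
    the integrand is nonnegative, so that coordinates can be integrated one
    after the other by Tonelli's theorem. *)
Lemma integral_exp1_cos (e a b A z : R) : (0 < e)%R -> (0 <= b <= a)%R ->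
  \int[mu]_t (exp1 e t * (a + b * cos (A + t * z)))%:E =
  (2 / e * a + pois1 e z * b * cos A)%:E.
Proof.
move=> e0 /[dup] ba /andP[b0 ab].
have a0 : (0 <= a)%R by exact: le_trans ab.
pose f (t : R) : \bar R := (exp1 e t * (a + b * cos (A + t * z)))%:E.
have mf : measurable_fun setT f.
  by rewrite /f; apply: mfun_EFin; apply: measurable_funM; [exact: measurable_exp1|mfun].
have f0 t : 0 <= f t.
  rewrite lee_fin mulr_ge0 ?exp1_ge0//.
  have : (- 1 <= cos (A + t * z))%R by exact: cos_geN1.
  nra.
have -> : [set: measurableTypeR R] = [set` `]-oo, 0%R[] `|` [set` `[0%R, +oo[].
  by rewrite -setCitvl setUv.
rewrite ge0_integral_setU; [|exact: measurable_itv|exact: measurable_itv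
  |exact: measurable_funTS|by move=> t _; exact: f0
  |by apply/disj_setPRL; rewrite setCitvl].
rewrite integral_itv_bndo_bndc; last exact: measurable_funTS.
pose g (t : R) : \bar R := f (- t)%R.
have mg : measurable_fun setT g by apply: (measurableT_comp mf); mfun.
have -> : \int[mu]_(t in `]-oo, 0%R]) f t = \int[mu]_(t in `[0%R, +oo[) g t.
  rewrite (ge0_integration_by_substitution0 mg); last by move=> t; exact: f0.
  by apply: eq_integral => t _; rewrite /g opprK.
have H1 : \int[mu]_(t in `[0%R, +oo[) g t =
    (a / e + b * (e * cos A - (- z) * sin A) / (e ^+ 2 + (- z) ^+ 2))%:E.
  rewrite -half//; apply: eq_integral => t; rewrite inE/= in_itv/= andbT => t0.
  by rewrite /g /f /exp1 normrN ger0_norm// mulrN mulNr.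
have H2 : \int[mu]_(t in `[0%R, +oo[) f t =
    (a / e + b * (e * cos A - z * sin A) / (e ^+ 2 + z ^+ 2))%:E.
  rewrite -half//; apply: eq_integral => t; rewrite inE/= in_itv/= andbT => t0.
  by rewrite /f /exp1 ger0_norm.
have d0 : (0 < e ^+ 2 + z ^+ 2)%R by rewrite ltr_pwDl ?sqr_ge0// exprn_gt0.
rewrite H1 H2 -EFinD; congr EFin; rewrite /pois1 sqrrN.
by field; rewrite !gt_eqF.
Qed.

End poisson_kernel.

Section poisson_kernel3.
Context {R : realType}.
Notation mu := (@lebesgue_measure R).
Notation mu3 := (@leb3 R).

(** A product over the coordinates rather than a function of the norm: the
    transform of such a product is the product of the transforms. *)
Definition exp3 (e : R) (x : R3 R) : R := exp1 e x.1.1 * exp1 e x.1.2 * exp1 e x.2.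
Definition pois3 (e : R) (z : R3 R) : R :=
  pois1 e z.1.1 * pois1 e z.1.2 * pois1 e z.2.
Definition sub3 (x y : R3 R) : R3 R := (x.1.1 - y.1.1, x.1.2 - y.1.2, x.2 - y.2).

Lemma exp3_ge0 e x : 0 <= exp3 e x.
Proof. by do 2?apply: mulr_ge0; exact: exp1_ge0. Qed.

Lemma exp3_le1 e x : 0 < e -> exp3 e x <= 1.
Proof.
move=> e0; have h t : exp1 e t <= 1.
  by rewrite /exp1 -expR0 ler_expR oppr_le0 mulr_ge0// ltW.
by do 2?apply: mulr_ile1; do ?exact: h; do ?exact: exp1_ge0;
  apply: mulr_ge0; exact: exp1_ge0.
Qed.

Lemma pois3_ge0 e z : 0 < e -> 0 <= pois3 e z.
Proof. by move=> e0; apply: mulr_ge0; [apply: mulr_ge0|]; exact: pois1_ge0. Qed.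

Lemma pois3_le e z : 0 < e -> pois3 e z <= (2 / e) ^+ 3.
Proof.
move=> e0; rewrite /pois3 3!exprS expr0 mulr1 mulrA.
apply: ler_pM; [|exact: pois1_ge0| |exact: pois1_le].
  by apply: mulr_ge0; exact: pois1_ge0.
by apply: ler_pM; do ?exact: pois1_ge0; exact: pois1_le.
Qed.

Lemma measurable_exp3 d (T : measurableType d) (e : R) (f : T -> R3 R) :
  measurable_fun setT f -> measurable_fun setT (fun x => exp3 e (f x)).
Proof.
move=> mf; rewrite /exp3.
by apply: measurable_funM; [apply: measurable_funM|]; apply: measurable_exp1; mfun.
Qed.

Lemma measurable_pois3 d (T : measurableType d) (e : R) (f : T -> R3 R) :
  measurable_fun setT f -> measurable_fun setT (fun x => pois3 e (f x)).
Proof.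
move=> mf; rewrite /pois3.
by apply: measurable_funM; [apply: measurable_funM|]; apply: measurable_pois1; mfun.
Qed.

Lemma measurable_sub3 d (T : measurableType d) (f g : T -> R3 R) :
  measurable_fun setT f -> measurable_fun setT g ->
  measurable_fun setT (fun x => sub3 (f x) (g x)).
Proof. by move=> mf mg; rewrite /sub3; mfun. Qed.

Ltac pos0 := repeat first
  [ done | apply: exp1_ge0 | apply: pois1_ge0 | apply: mulr_ge0 ].

Local Open Scope ereal_scope.

Lemma integral_exp3_cos (e a b A : R) (z : R3 R) : (0 < e)%R -> (0 <= b <= a)%R ->
  \int[mu3]_x (exp3 e x * (a + b * cos (A + dot3 x z)))%:E =
  ((2 / e) ^+ 3 * a + pois3 e z * b * cos A)%:E.
Proof.
move=> e0 /[dup] ba /andP[b0 ab].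
have ge t (a' b' B : R) : (0 <= b' <= a')%R -> (0 <= a' + b' * cos (B + t))%R.
  by move=> /andP[]; have := cos_geN1 (B + t); nra.
have inv (a' b' : R) (y : R) : (0 <= b' <= a')%R ->
    (0 <= pois1 e y * b' <= 2 / e * a')%R.
  move=> /andP[b'0 ba']; apply/andP; split; first by pos0.
  by apply: ler_pM => //; [exact: pois1_ge0|exact: pois1_le].
pose f (x1 x2 x3 : R) : \bar R := (exp1 e x1 * exp1 e x2 * exp1 e x3 *
  (a + b * cos (A + (x1 * z.1.1 + x2 * z.1.2 + x3 * z.2))))%:E.
have mf : measurable_fun setT (fun p : R3 R => f p.1.1 p.1.2 p.2).
  rewrite /f; apply: mfun_EFin; apply: measurable_funM; last by mfun.
  by apply: measurable_funM; [apply: measurable_funM|]; apply: measurable_exp1; mfun.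
have f0 x y t : 0 <= f x y t.
  rewrite lee_fin; apply: mulr_ge0; [by pos0|exact: ge].
transitivity (\int[mu3]_p f p.1.1 p.1.2 p.2); first exact: eq_integral.
rewrite (leb3E123 mf f0).
have EZ (k : R) (g : R -> R) : (0 <= k)%R -> measurable_fun setT g -> (forall t, 0 <= g t)%R ->
    \int[mu]_t (k * g t)%:E = k%:E * \int[mu]_t (g t)%:E.
  move=> k0 mg g0; under eq_integral do rewrite EFinM.
  rewrite ge0_integralZl_fin//; first by mfun.
have mc (a' b' B y : R) : measurable_fun setT
    (fun t => exp1 e t * (a' + b' * cos (B + t * y)))%R.
  by apply: measurable_funM; [exact: measurable_exp1|mfun].
pose b3 := (pois1 e z.2 * b)%R; pose a3 := (2 / e * a)%R.
pose b2 := (pois1 e z.1.2 * b3)%R; pose a2 := (2 / e * a3)%R.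
have ba3 : (0 <= b3 <= a3)%R by exact: inv.
have ba2 : (0 <= b2 <= a2)%R by exact: inv.
transitivity (\int[mu]_x \int[mu]_y (exp1 e x * exp1 e y *
    (a3 + b3 * cos (A + (x * z.1.1 + y * z.1.2))))%:E).
  apply: eq_integral => x _; apply: eq_integral => y _.
  transitivity ((exp1 e x * exp1 e y)%:E * \int[mu]_t
      (exp1 e t * (a + b * cos (A + (x * z.1.1 + y * z.1.2) + t * z.2)))%:E).
    rewrite -EZ//; last 2 first.
    - by pos0.
    - by move=> t; apply: mulr_ge0; [exact: exp1_ge0|exact: ge].
    by apply: eq_integral => t _; rewrite /f addrA mulrA.
  by rewrite integral_exp1_cos// -EFinM.
transitivity (\int[mu]_x (exp1 e x * (a2 + b2 * cos (A + x * z.1.1)))%:E).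
  apply: eq_integral => x _.
  transitivity ((exp1 e x)%:E * \int[mu]_t
      (exp1 e t * (a3 + b3 * cos (A + x * z.1.1 + t * z.1.2)))%:E).
    rewrite -EZ//; last 2 first.
    - exact: exp1_ge0.
    - by move=> t; apply: mulr_ge0; [exact: exp1_ge0|exact: ge].
    by apply: eq_integral => t _; rewrite addrA mulrA.
  by rewrite integral_exp1_cos// -EFinM.
rewrite integral_exp1_cos//; congr EFin; rewrite /pois3 /a2 /b2 /a3 /b3; ring.
Qed.

(** A linear combination of a cosine and a sine is a shifted cosine. *)
Lemma polar_angle (P Q r : R) : (0 <= r)%R -> (P ^+ 2 + Q ^+ 2 = r ^+ 2)%R ->
  exists A, P = (r * cos A)%R /\ Q = (- (r * sin A))%R.
Proof.
rewrite le_eqVlt => /predU1P[<-|r0] PQ.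
  have P0 := sqr_ge0 P; have Q0 := sqr_ge0 Q.
  exists 0%R; rewrite !mul0r oppr0; move: PQ; rewrite expr0n/= => PQ.
  have P2 : (P ^+ 2 = 0)%R by lra.
  have Q2 : (Q ^+ 2 = 0)%R by lra.
  by split; apply/eqP; rewrite -(sqrf_eq0) ?P2 ?Q2.
have r2 : (0 < r ^+ 2)%R by rewrite exprn_gt0.
have c2 : ((P / r) ^+ 2 = 1 - (Q / r) ^+ 2)%R.
  rewrite !expr_div_n; apply: (mulIf (lt0r_neq0 r2)).
  by rewrite mulrBl !mulfVK ?gt_eqF// mul1r -PQ addrK.
have Pr : (-1 <= P / r <= 1)%R.
  rewrite -ler_norml -(@ler_pXn2r _ 2) ?nnegrE// expr1n real_normK ?num_real// c2.
  by rewrite gerBl sqr_ge0.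
have s2 : (sin (acos (P / r)) = `|Q / r|)%R.
  by rewrite sin_acos// c2 opprB addrC subrK sqrtr_sqr.
have [Q0|Q0] := leP 0%R Q.
  exists (- acos (P / r))%R; rewrite cosN sinN acosK// s2 ger0_norm ?divr_ge0 ?(ltW r0)//.
  by rewrite mulrN opprK; split; field; rewrite gt_eqF.
exists (acos (P / r))%R; rewrite acosK// s2 ltr0_norm; last first.
  by rewrite pmulr_llt0// invr_gt0.
by rewrite mulrN opprK; split; field; rewrite gt_eqF.
Qed.

Lemma integral_exp3_lin (e n P Q : R) (z : R3 R) : (0 < e)%R -> (0 <= n)%R ->
  (P ^+ 2 + Q ^+ 2 = n ^+ 2)%R ->
  \int[mu3]_x (exp3 e x * (n + (P * cos (dot3 x z) + Q * sin (dot3 x z))))%:E =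
  ((2 / e) ^+ 3 * n + pois3 e z * P)%:E.
Proof.
move=> e0 n0 PQ; have [A [PE QE]] := polar_angle n0 PQ.
rewrite [in RHS]PE mulrA -integral_exp3_cos//; last by rewrite n0 lexx.
apply: eq_integral => x _; congr (EFin (_ * (_ + _)))%R.
by rewrite cosD PE QE; ring.
Qed.

Lemma integral_pois1 (e : R) : (0 < e)%R ->
  \int[mu]_t (pois1 e t)%:E = (2 * pi)%:E.
Proof.
move=> e0.
pose f (t : R) : \bar R := (2 * (oneDsqr t)^-1)%:E.
have mV : measurable_fun setT (fun t : R => (oneDsqr t)^-1)%R.
  by rewrite /oneDsqr; mfun.
have mf : measurable_fun setT f.
  by apply: mfun_EFin; exact: measurable_funM.
have f0 t : 0 <= f t by rewrite lee_fin mulr_ge0// invr_ge0.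
transitivity (\int[mu]_t f t).
  have e1 : (0 < e^-1)%R by rewrite invr_gt0.
  have := ge0_integral_scale e1 mf f0; rewrite invrK => H.
  transitivity (\int[mu]_t (e^-1%:E * f (e^-1 * t)%R)).
    apply: eq_integral => t _; rewrite /f -EFinM; congr EFin; rewrite /pois1 /oneDsqr.
    have d0 : (0 < e ^+ 2 + t ^+ 2)%R by rewrite ltr_pwDl ?sqr_ge0// exprn_gt0.
    have -> : (1 + (e^-1 * t) ^+ 2 = (e ^+ 2 + t ^+ 2) / e ^+ 2)%R.
      by field; rewrite gt_eqF.
    by field; rewrite !gt_eqF.
  rewrite ge0_integralZl_fin; last 3 first.
  - exact: ltW.
  - by apply: (measurableT_comp mf); mfun.
  - by move=> t; exact: f0.
  by rewrite H muleA -EFinM mulVf ?gt_eqF// mul1e.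
rewrite /f; under eq_integral do rewrite EFinM.
rewrite ge0_integralZl_fin; [|by []|by apply: mfun_EFin|by move=> t; rewrite lee_fin invr_ge0].
rewrite (@ge0_symfun_integralT _ (fun t => (oneDsqr t)^-1)%R).
- have -> : [set x : R | (0 <= x)%R] = `[0%R, +oo[%classic by rewrite -set_itvcy.
  by rewrite integral0y_oneDsqr -!EFinM; congr EFin; field.
- by move=> t; rewrite invr_ge0.
- exact: continuous_oneDsqrV.
- by move=> t; rewrite /oneDsqr /= sqrrN.
Qed.

Lemma integral_pois3 (e : R) : (0 < e)%R ->
  \int[mu3]_z (pois3 e z)%:E = ((2 * pi) ^+ 3)%:E.
Proof.
move=> e0.
pose f (x y z : R) : \bar R := (pois1 e x * pois1 e y * pois1 e z)%:E.
have mf : measurable_fun setT (fun p : R3 R => f p.1.1 p.1.2 p.2).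
  rewrite /f; apply: mfun_EFin.
  by apply: measurable_funM; [apply: measurable_funM|]; apply: measurable_pois1; mfun.
have f0 x y z : 0 <= f x y z by rewrite lee_fin; pos0.
have EZ (k : R) : (0 <= k)%R -> \int[mu]_t (k * pois1 e t)%:E = (k * (2 * pi))%:E.
  move=> k0; under eq_integral do rewrite EFinM.
  rewrite ge0_integralZl_fin//; [|by apply: mfun_EFin; exact: measurable_pois1
    |by move=> t; rewrite lee_fin; exact: pois1_ge0].
  by rewrite integral_pois1// -EFinM.
have p0 : (0 <= 2 * pi :> R)%R by rewrite mulr_ge0 ?pi_ge0.
transitivity (\int[mu3]_p f p.1.1 p.1.2 p.2); first exact: eq_integral.
rewrite (leb3E123 mf f0).
transitivity (\int[mu]_x \int[mu]_y ((2 * pi * pois1 e x) * pois1 e y)%:E).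
  apply: eq_integral => x _; apply: eq_integral => y _.
  rewrite EZ; last by pos0.
  by congr EFin; ring.
transitivity (\int[mu]_x ((2 * pi) ^+ 2 * pois1 e x)%:E).
  apply: eq_integral => x _; rewrite EZ; last by pos0.
  by congr EFin; ring.
by rewrite EZ ?exprn_ge0//; congr EFin; ring.
Qed.

Lemma integral_pois3_sub (e : R) (x : R3 R) : (0 < e)%R ->
  \int[mu3]_y (pois3 e (sub3 x y))%:E = ((2 * pi) ^+ 3)%:E.
Proof.
move=> e0; rewrite -(integral_pois3 e0).
have mp : measurable_fun setT (fun z : R3 R => (pois3 e z)%:E).
  by apply: mfun_EFin; apply: measurable_pois3.
rewrite -(leb3_shift (- x.1.1, - x.1.2, - x.2)%R mp); last first.
  by move=> z; rewrite lee_fin pois3_ge0.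
apply: eq_integral => y _; congr EFin; rewrite /pois3 /=.
have p1E a b : pois1 e (a - b) = pois1 e (b + - a)%R.
  by rewrite /pois1; congr (_ / (_ + _))%R; rewrite -sqrrN opprB.
by rewrite (p1E x.1.1 y.1.1) (p1E x.1.2 y.1.2) (p1E x.2 y.2).
Qed.

Lemma pois3_subC (e : R) (x y : R3 R) : pois3 e (sub3 x y) = pois3 e (sub3 y x).
Proof.
have p1E a b : pois1 e (a - b) = pois1 e (b - a)%R.
  by rewrite /pois1; congr (_ / (_ + _))%R; rewrite -sqrrN opprB.
by rewrite /pois3/= (p1E x.1.1) (p1E x.1.2) (p1E x.2).
Qed.

Lemma pois3_scale (e : R) (z : R3 R) : (0 < e)%R ->
  pois3 e (scale3 e z) = (e ^- 3 * pois3 1 z)%R.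
Proof.
move=> e0; rewrite /pois3/=.
have p1 t : pois1 e (e * t)%R = (e^-1 * pois1 1 t)%R.
  have d0 : (0 < 1 + t ^+ 2)%R by rewrite ltr_pwDl ?sqr_ge0.
  rewrite /pois1 [(e ^+ 2 + _)%R](_ : _ = e ^+ 2 * (1 + t ^+ 2))%R; last by ring.
  by rewrite expr1n; field; rewrite !gt_eqF.
by rewrite !p1; field; rewrite gt_eqF.
Qed.

End poisson_kernel3.

(** * The Poisson-regularised Plancherel identity *)
Section iterated_integrals.
Context d1 d2 (T1 : measurableType d1) (T2 : measurableType d2) (R : realType).
Variable m1 : {sigma_finite_measure set T1 -> \bar R}.
Variable m2 : {sigma_finite_measure set T2 -> \bar R}.
Local Open Scope ereal_scope.

Lemma measurable_param_integral (f : T1 -> T2 -> R) :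
  measurable_fun setT (fun z : T1 * T2 => f z.1 z.2) ->
  measurable_fun setT (fun x => \int[m2]_y f x y)%R.
Proof.
move=> mf; pose F (z : T1 * T2) := (f z.1 z.2)%:E.
have mF : measurable_fun setT F by rewrite /F; mfun.
have mpos : measurable_fun setT (fun x => \int[m2]_y F^\+ (x, y)).
  apply: (measurable_fun_fubini_tonelli_F F^\+); first exact: measurable_funepos.
  by move=> z; exact: funepos_ge0.
have mneg : measurable_fun setT (fun x => \int[m2]_y F^\- (x, y)).
  apply: (measurable_fun_fubini_tonelli_F F^\-); first exact: measurable_funeneg.
  by move=> z; exact: funeneg_ge0.
rewrite /Rintegral.
rewrite (_ : (fun x => _) =
    fine \o (fun x => \int[m2]_y F^\+ (x, y) - \int[m2]_y F^\- (x, y))).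
  by apply: measurableT_comp => //; exact: emeasurable_funB.
apply/funext => x /=; rewrite integralE; congr (fine (_ - _)).
  by apply: eq_integral => y _; rewrite !funeposE.
by apply: eq_integral => y _; rewrite !funenegE.
Qed.

Lemma ge0_integral2D (f g : T1 -> T2 -> \bar R) :
  measurable_fun setT (fun z : T1 * T2 => f z.1 z.2) -> (forall x y, 0 <= f x y) ->
  measurable_fun setT (fun z : T1 * T2 => g z.1 z.2) -> (forall x y, 0 <= g x y) ->
  \int[m1]_x \int[m2]_y (f x y + g x y) =
  \int[m1]_x \int[m2]_y f x y + \int[m1]_x \int[m2]_y g x y.
Proof.
move=> mf f0 mg g0; rewrite -ge0_integralD//; last 4 first.
- by move=> x _; exact: integral_ge0.
- exact: mfun_int2.
- by move=> x _; exact: integral_ge0.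
- exact: mfun_int2.
apply: eq_integral => x _; rewrite ge0_integralD//.
- exact: (measurableT_comp mf (pair1_measurable x)).
- exact: (measurableT_comp mg (pair1_measurable x)).
Qed.

End iterated_integrals.

Section plancherel.
Context {R : realType}.
Notation mu3 := (@leb3 R).
Variables (a b n : R3 R -> R).
Hypothesis ma : measurable_fun setT a.
Hypothesis mb : measurable_fun setT b.
Hypothesis n_ge0 : forall x, 0 <= n x.
Hypothesis nE : forall x, n x ^+ 2 = a x ^+ 2 + b x ^+ 2.
Hypothesis mn : measurable_fun setT n.
Hypothesis n_int : (\int[mu3]_x (n x)%:E < +oo)%E.

Let alpha (xi x : R3 R) : R := a x * cos (dot3 xi x) + b x * sin (dot3 xi x).
Let beta (xi x : R3 R) : R := b x * cos (dot3 xi x) - a x * sin (dot3 xi x).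

(** Real and imaginary parts of the integral of [(a + i b) exp (- i xi x)]. *)
Definition ft_re (xi : R3 R) : R := \int[mu3]_x alpha xi x.
Definition ft_im (xi : R3 R) : R := \int[mu3]_x beta xi x.
Definition ft_sq (xi : R3 R) : R := ft_re xi ^+ 2 + ft_im xi ^+ 2.

Let mdot : measurable_fun setT (fun z : R3 R * R3 R => dot3 z.1 z.2).
Proof. by apply: measurable_dot3; mfun. Qed.

Let mdot1 (xi : R3 R) : measurable_fun setT (fun x => dot3 xi x).
Proof. by apply: measurable_dot3; mfun. Qed.

Let malpha : measurable_fun setT (fun z : R3 R * R3 R => alpha z.1 z.2).
Proof. by rewrite /alpha; mfun. Qed.

Let mbeta : measurable_fun setT (fun z : R3 R * R3 R => beta z.1 z.2).
Proof. by rewrite /beta; mfun. Qed.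

Let malpha1 xi : measurable_fun setT (alpha xi).
Proof. by have := mdot1 xi => ?; rewrite /alpha; mfun. Qed.

Let mbeta1 xi : measurable_fun setT (beta xi).
Proof. by have := mdot1 xi => ?; rewrite /beta; mfun. Qed.

Let ab_sq xi x : alpha xi x ^+ 2 + beta xi x ^+ 2 = n x ^+ 2.
Proof.
rewrite nE /alpha /beta; have := cos2Dsin2 (dot3 xi x).
set c := cos _; set s := sin _ => cs.
transitivity ((a x ^+ 2 + b x ^+ 2) * (c ^+ 2 + s ^+ 2)); first by ring.
by rewrite cs mulr1.
Qed.

Let alpha_le xi x : `|alpha xi x| <= n x.
Proof.
rewrite -(@ler_pXn2r _ 2) ?nnegrE// real_normK ?num_real// -(ab_sq xi).
by rewrite lerDl sqr_ge0.
Qed.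

Let beta_le xi x : `|beta xi x| <= n x.
Proof.
rewrite -(@ler_pXn2r _ 2) ?nnegrE// real_normK ?num_real// -(ab_sq xi).
by rewrite lerDr sqr_ge0.
Qed.

Let nint : mu3.-integrable setT (EFin \o n).
Proof.
apply/integrableP; split; first by mfun.
by under eq_integral do rewrite /= ger0_norm//.
Qed.

Let alpha_int xi : mu3.-integrable setT (EFin \o alpha xi).
Proof.
apply: le_integrable nint => //; first by have := malpha1 xi => ?; mfun.
by move=> x _ /=; rewrite lee_fin [leRHS]ger0_norm.
Qed.

Let beta_int xi : mu3.-integrable setT (EFin \o beta xi).
Proof.
apply: le_integrable nint => //; first by have := mbeta1 xi => ?; mfun.
by move=> x _ /=; rewrite lee_fin [leRHS]ger0_norm.
Qed.

Let N1 : R := \int[mu3]_x n x.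

Let lin3 (f g h : R3 R -> R) (c1 c2 c3 : R) :
  mu3.-integrable setT (EFin \o f) -> mu3.-integrable setT (EFin \o g) ->
  mu3.-integrable setT (EFin \o h) ->
  (\int[mu3]_x (c1 * f x + (c2 * g x + c3 * h x))%:E =
  (c1 * (\int[mu3]_x f x) + (c2 * (\int[mu3]_x g x) + c3 * (\int[mu3]_x h x)))%:E)%E.
Proof.
move=> fi gi hi.
have zi (c : R) (k : R3 R -> R) : mu3.-integrable setT (EFin \o k) ->
    mu3.-integrable setT (fun x => (c * k x)%:E).
  by move=> ki; under eq_fun do rewrite EFinM; exact: integrableZl.
have ghi : mu3.-integrable setT (fun x => (c2 * g x + c3 * h x)%:E).
  by under eq_fun do rewrite EFinD; apply: integrableD => //; exact: zi.
have allint : mu3.-integrable setT (fun x => (c1 * f x + (c2 * g x + c3 * h x))%:E).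
  by under eq_fun do rewrite EFinD; apply: integrableD => //; exact: zi.
rewrite -(fineK (integrable_fin_num measurableT allint)); congr EFin.
rewrite -/(Rintegral _ _ _) RintegralD//; last exact: zi.
rewrite RintegralD//; [|exact: zi|exact: zi].
by rewrite !RintegralZl.
Qed.

Let phi xi x y : R := n x * n y + (alpha xi x * alpha xi y + beta xi x * beta xi y).

Let phi_ge0 xi x y : 0 <= phi xi x y.
Proof.
rewrite /phi; have := ab_sq xi x; have := ab_sq xi y.
have := n_ge0 x; have := n_ge0 y.
move: (alpha xi x) (alpha xi y) (beta xi x) (beta xi y) (n x) (n y).
move=> p p' q q' r r' r'0 r0 e' e.
have h : (p * p' + q * q') ^+ 2 <= (r * r') ^+ 2.
  have -> : (r * r') ^+ 2 = (p ^+ 2 + q ^+ 2) * (p' ^+ 2 + q' ^+ 2).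
    by rewrite e e'; ring.
  have := sqr_ge0 (p * q' - q * p'); nra.
have rr : 0 <= r * r' by rewrite mulr_ge0.
have : `|p * p' + q * q'| <= r * r'.
  by rewrite -(@ler_pXn2r _ 2) ?nnegrE// real_normK ?num_real.
rewrite ler_norml => /andP[]; lra.
Qed.

Let integral_phi xi :
  (\int[mu3]_x \int[mu3]_y (phi xi x y)%:E = (N1 ^+ 2 + ft_sq xi)%:E)%E.
Proof.
transitivity (\int[mu3]_x (N1 * n x + (ft_re xi * alpha xi x + ft_im xi * beta xi x))%:E)%E.
  apply: eq_integral => x _; rewrite /phi lin3//.
  by congr EFin; rewrite /ft_re /ft_im /N1; ring.
by rewrite lin3//; congr EFin; rewrite /ft_sq /ft_re /ft_im /N1; ring.
Qed.

Let phiE xi x y : phi xi x y = n x * n y +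
  ((a x * a y + b x * b y) * cos (dot3 xi (sub3 x y)) +
   (b x * a y - a x * b y) * sin (dot3 xi (sub3 x y))).
Proof.
rewrite /phi /alpha /beta.
have -> : dot3 xi (sub3 x y) = dot3 xi x - dot3 xi y.
  by rewrite /dot3/=; ring.
by rewrite cosB sinB; ring.
Qed.

Let mphi_xxy : measurable_fun setT
  (fun z : (R3 R * R3 R) * R3 R => phi z.1.1 z.1.2 z.2).
Proof.
rewrite /phi; apply: measurable_funD; first by mfun.
by apply: measurable_funD; apply: measurable_funM;
  first [apply: (measurableT_comp malpha (g := fun z => (z.1.1, z.1.2)))
        |apply: (measurableT_comp mbeta (g := fun z => (z.1.1, z.1.2)))
        |apply: (measurableT_comp malpha (g := fun z => (z.1.1, z.2)))
        |apply: (measurableT_comp mbeta (g := fun z => (z.1.1, z.2)))]; mfun.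
Qed.

Variable e : R.
Hypothesis e0 : 0 < e.
Let C : R := (2 / e) ^+ 3.
Let M : R := (2 * pi) ^+ 3.

Let C0 : 0 <= C. Proof. by rewrite /C exprn_ge0// divr_ge0// ltW. Qed.
Let M0 : 0 <= M. Proof. by rewrite /M exprn_ge0// mulr_ge0// pi_ge0. Qed.

Local Open Scope ereal_scope.

Lemma ft_sq_ge0 xi : (0 <= ft_sq xi)%R.
Proof. by rewrite addr_ge0 ?sqr_ge0. Qed.

Ltac nng := repeat first [ done | apply: sqr_ge0 | apply: pois3_ge0
  | apply: exp3_ge0 | apply: ft_sq_ge0 | apply: mulr_ge0 ].

Lemma measurable_ft : measurable_fun setT ft_re /\ measurable_fun setT ft_im.
Proof.
split; exact: (measurable_param_integral mu3).
Qed.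

Lemma measurable_ft_sq : measurable_fun setT ft_sq.
Proof. by have [mr mi] := measurable_ft; rewrite /ft_sq; mfun. Qed.

(** Both sides of the identity come from integrating the nonnegative function
    [exp3 e xi * phi xi x y] in two orders: adding the constant [n x * n y] to
    the oscillating integrand keeps every integrand nonnegative, so that
    Tonelli applies and no integrability has to be checked. *)
Lemma poisson_identity :
  \int[mu3]_x \int[mu3]_y
    (2^-1 * ((a x - a y) ^+ 2 + (b x - b y) ^+ 2) * pois3 e (sub3 x y))%:E +
  \int[mu3]_xi (exp3 e xi * ft_sq xi)%:E = M%:E * \int[mu3]_x (n x ^+ 2)%:E.
Proof.
have mft := measurable_ft_sq.
have mexp : measurable_fun setT (fun xi : R3 R => exp3 e xi) by exact: measurable_exp3.
have mpois : measurable_fun setT (fun z : R3 R * R3 R => pois3 e (sub3 z.1 z.2)).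
  by apply: measurable_pois3; apply: measurable_sub3; mfun.
have mpois1 x : measurable_fun setT (fun y : R3 R => pois3 e (sub3 x y)).
  by apply: measurable_pois3; apply: measurable_sub3; mfun.
pose D x y := (2^-1 * ((a x - a y) ^+ 2 + (b x - b y) ^+ 2) * pois3 e (sub3 x y))%R.
have D0 x y : (0 <= D x y)%R.
  by rewrite mulr_ge0 ?pois3_ge0// mulr_ge0// addr_ge0 ?sqr_ge0.
have mD : measurable_fun setT (fun z : R3 R * R3 R => (D z.1 z.2)%:E).
  by rewrite /D; apply: mfun_EFin; apply: measurable_funM => //; mfun.
pose P x y := (C * (n x * n y) + pois3 e (sub3 x y) * (a x * a y + b x * b y))%R.
have PE x y : \int[mu3]_xi (exp3 e xi * phi xi x y)%:E = (P x y)%:E.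
  under eq_integral do rewrite phiE.
  rewrite integral_exp3_lin// ?mulr_ge0//.
  by rewrite exprMn !nE; ring.
have P0 x y : (0 <= P x y)%R.
  rewrite -lee_fin -PE; apply: integral_ge0 => xi _.
  by rewrite lee_fin mulr_ge0 ?exp3_ge0.
have mP : measurable_fun setT (fun z : R3 R * R3 R => (P z.1 z.2)%:E).
  rewrite /P; apply: mfun_EFin; apply: measurable_funD; first by mfun.
  by apply: measurable_funM => //; mfun.
pose I2 := \int[mu3]_x (n x ^+ 2)%:E.
have I2_ge0 : 0 <= I2 by apply: integral_ge0 => x _; rewrite lee_fin sqr_ge0.
have order : \int[mu3]_x \int[mu3]_y (P x y)%:E =
    \int[mu3]_xi ((exp3 e xi)%:E * (N1 ^+ 2 + ft_sq xi)%:E).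
  transitivity (\int[mu3]_x \int[mu3]_xi \int[mu3]_y (exp3 e xi * phi xi x y)%:E).
    apply: eq_integral => x _.
    transitivity (\int[mu3]_y \int[mu3]_xi (exp3 e xi * phi xi x y)%:E).
      by apply: eq_integral => y _; rewrite PE.
    apply: (tonelli_swap mu3 mu3 (f := fun y xi => (exp3 e xi * phi xi x y)%:E)).
      apply: mfun_EFin; apply: measurable_funM; first by apply: measurable_exp3; mfun.
      by apply: (measurableT_comp mphi_xxy (g := fun z => ((z.2, x), z.1))); mfun.
    by move=> y xi; rewrite lee_fin mulr_ge0 ?exp3_ge0.
  rewrite (tonelli_swap mu3 mu3
    (f := fun x xi => \int[mu3]_y (exp3 e xi * phi xi x y)%:E)).
  - apply: eq_integral => xi _; rewrite -integral_phi -ge0_integralZl_fin ?exp3_ge0//.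
    + apply: eq_integral => x _; rewrite -ge0_integralZl_fin ?exp3_ge0//.
      * apply: mfun_EFin.
        by apply: (measurableT_comp mphi_xxy (g := fun z => ((xi, x), z))); mfun.
      * by move=> y; rewrite lee_fin.
    + apply: (mfun_int2 mu3 (f := fun x y => (phi xi x y)%:E)).
        apply: mfun_EFin.
        by apply: (measurableT_comp mphi_xxy (g := fun z => ((xi, z.1), z.2))); mfun.
      by move=> x y; rewrite lee_fin.
    + by move=> x; apply: integral_ge0 => y _; rewrite lee_fin.
  - apply: (mfun_int2 mu3 (f := fun z y => (exp3 e z.2 * phi z.2 z.1 y)%:E)).
      apply: mfun_EFin; apply: measurable_funM; first by apply: measurable_exp3; mfun.
      by apply: (measurableT_comp mphi_xxy (g := fun z => ((z.1.2, z.1.1), z.2))); mfun.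
    by move=> z y; rewrite lee_fin mulr_ge0 ?exp3_ge0.
  - move=> x xi; apply: integral_ge0 => y _.
    by rewrite lee_fin mulr_ge0 ?exp3_ge0.
have sum : \int[mu3]_x \int[mu3]_y (D x y)%:E + \int[mu3]_x \int[mu3]_y (P x y)%:E =
    (C * N1 ^+ 2)%:E + M%:E * I2.
  rewrite -(ge0_integral2D mu3 mu3 mD _ mP); [|by move=> x y; rewrite lee_fin..].
  pose E1 x y := (C * (n x * n y))%:E.
  pose E2 x y := (2^-1 * n x ^+ 2 * pois3 e (sub3 x y))%:E.
  pose E3 x y := (2^-1 * n y ^+ 2 * pois3 e (sub3 x y))%:E.
  have E10 x y : 0 <= E1 x y by rewrite lee_fin; nng.
  have E20 x y : 0 <= E2 x y by rewrite lee_fin; nng.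
  have E30 x y : 0 <= E3 x y by rewrite lee_fin; nng.
  have mE1 : measurable_fun setT (fun z : R3 R * R3 R => E1 z.1 z.2) by rewrite /E1; mfun.
  have mE2 : measurable_fun setT (fun z : R3 R * R3 R => E2 z.1 z.2).
    by rewrite /E2; apply: mfun_EFin; apply: measurable_funM => //; mfun.
  have mE3 : measurable_fun setT (fun z : R3 R * R3 R => E3 z.1 z.2).
    by rewrite /E3; apply: mfun_EFin; apply: measurable_funM => //; mfun.
  transitivity (\int[mu3]_x \int[mu3]_y (E1 x y + (E2 x y + E3 x y))).
    apply: eq_integral => x _; apply: eq_integral => y _.
    rewrite /D /P /E1 /E2 /E3 -!EFinD; congr EFin; rewrite !nE.
    by field.
  rewrite (ge0_integral2D mu3 mu3 mE1 E10); last 2 first.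
  - exact: emeasurable_funD.
  - by move=> x y; rewrite adde_ge0.
  rewrite (ge0_integral2D mu3 mu3 mE2 E20 mE3 E30).
  have half_int (f : R3 R -> R3 R -> \bar R) :
      (forall x, \int[mu3]_y f x y = (2^-1 * M)%:E * (n x ^+ 2)%:E) ->
      \int[mu3]_x \int[mu3]_y f x y = (2^-1 * M)%:E * I2.
    move=> fE; rewrite /I2 -ge0_integralZl_fin; last 3 first.
    - by nng.
    - by mfun.
    - by move=> x; rewrite lee_fin sqr_ge0.
    by apply: eq_integral => x _; rewrite fE.
  have inner (c : R) (f : R3 R -> R) : (0 <= c)%R -> measurable_fun setT f ->
      (forall y, 0 <= f y)%R -> \int[mu3]_y (c * f y)%:E = c%:E * \int[mu3]_y (f y)%:E.
    move=> c0 mf f0; under eq_integral do rewrite EFinM.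
    by rewrite ge0_integralZl_fin//; mfun.
  have i2 : \int[mu3]_x \int[mu3]_y E2 x y = (2^-1 * M)%:E * I2.
    apply: half_int => x; rewrite /E2 inner//; last 2 first.
    - by nng.
    - by move=> y; exact: pois3_ge0.
    by rewrite integral_pois3_sub// -!EFinM; congr EFin; rewrite /M; ring.
  have i3 : \int[mu3]_x \int[mu3]_y E3 x y = (2^-1 * M)%:E * I2.
    rewrite (tonelli_swap mu3 mu3 mE3 E30); apply: half_int => y; rewrite /E3.
    transitivity (\int[mu3]_x (2^-1 * n y ^+ 2 * pois3 e (sub3 y x))%:E).
      by apply: eq_integral => x _; rewrite pois3_subC.
    rewrite inner//; last 2 first.
    - by nng.
    - by move=> x; exact: pois3_ge0.
    by rewrite integral_pois3_sub// -!EFinM; congr EFin; rewrite /M; ring.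
  have N1E : \int[mu3]_x (n x)%:E = N1%:E.
    by rewrite /N1 /Rintegral fineK// integrable_fin_num.
  have N10 : (0 <= N1)%R by apply: Rintegral_ge0 => x _.
  have i1 : \int[mu3]_x \int[mu3]_y E1 x y = (C * N1 ^+ 2)%:E.
    transitivity (\int[mu3]_x (C * N1 * n x)%:E).
      apply: eq_integral => x _; rewrite /E1.
      transitivity (\int[mu3]_y (C * n x * n y)%:E).
        by apply: eq_integral => y _; rewrite mulrA.
      rewrite inner//; last by nng.
      by rewrite N1E -EFinM; congr EFin; ring.
    rewrite inner//; last by nng.
    by rewrite N1E -EFinM; congr EFin; ring.
  have hM : (0 <= 2^-1 * M)%R by nng.
  rewrite i1 i2 i3 -ge0_muleDl ?lee_fin// -EFinD.
  by congr (_ + _%:E * _); field.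
have expN1 : \int[mu3]_xi ((exp3 e xi)%:E * (N1 ^+ 2 + ft_sq xi)%:E) =
    (C * N1 ^+ 2)%:E + \int[mu3]_xi (exp3 e xi * ft_sq xi)%:E.
  have -> : (C * N1 ^+ 2)%:E = \int[mu3]_xi (exp3 e xi * N1 ^+ 2)%:E.
    have N12 : ((0 : R) <= 0 <= N1 ^+ 2)%R by apply/andP; split; [exact: lexx|exact: sqr_ge0].
    have := @integral_exp3_cos R e (N1 ^+ 2) 0%R 0%R (0%R, 0%R, 0%R) e0 N12.
    rewrite mulr0 mul0r addr0 => <-.
    by apply: eq_integral => xi _; rewrite mul0r addr0.
  rewrite -ge0_integralD//; last 4 first.
  - by move=> xi _; rewrite lee_fin; nng.
  - by apply: mfun_EFin; apply: measurable_funM => //.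
  - by move=> xi _; rewrite lee_fin; nng.
  - by apply: mfun_EFin; apply: measurable_funM.
  by apply: eq_integral => xi _; rewrite -EFinM -EFinD mulrDr.
move: sum; rewrite order expN1 addeCA => sum.
have cancel (x y : \bar R) (r : R) : r%:E + x = r%:E + y -> x = y.
  by move=> /(congr1 (fun t => t - r%:E)); rewrite ![r%:E + _]addeC !addeK.
exact: cancel sum.
Qed.

End plancherel.

(** * Bessel's inequality and the modulus of continuity *)

Section bessel.
Context {R : realType}.
Notation mu3 := (@leb3 R).
Local Open Scope ereal_scope.

Definition eps (k : nat) : R := k.+1%:R^-1.

Lemma eps_gt0 k : (0 < eps k)%R. Proof. by rewrite invr_gt0. Qed.

Lemma eps_le1 k : (eps k <= 1)%R.
Proof. by rewrite invf_le1// ler1n. Qed.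

Lemma eps_cvg0 : eps @ \oo --> (0 : R)%R.
Proof. exact: cvg_harmonic. Qed.

Lemma le_exp1 (e e' t : R) : (e' <= e)%R -> (exp1 e t <= exp1 e' t)%R.
Proof. by move=> ee; rewrite /exp1 ler_expR lerN2 ler_wpM2r. Qed.

Lemma le_exp3 (e e' : R) x : (e' <= e)%R -> (exp3 e x <= exp3 e' x)%R.
Proof.
move=> ee; apply: ler_pM; [|exact: exp1_ge0| |exact: le_exp1].
  by apply: mulr_ge0; exact: exp1_ge0.
by apply: ler_pM; do ?exact: exp1_ge0; exact: le_exp1.
Qed.

Lemma exp1_cvg (t : R) : exp1 (eps k) t @[k --> \oo] --> (1 : R)%R.
Proof.
rewrite -expR0 /exp1.
have c : continuous (fun e : R => expR (- (e * `|t|)))%R.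
  move=> e; apply: (@continuous_comp _ _ _ (fun e : R => (- (e * `|t|))%R) expR); last first.
    exact: continuous_expR.
  by apply: cvgN; apply: cvgM; [exact: cvg_id|exact: cvg_cst].
have := c 0%R; rewrite /continuous_at mul0r oppr0 => c0.
exact: (cvg_comp eps (fun e : R => expR (- (e * `|t|)))%R eps_cvg0 c0).
Qed.

Lemma exp3_cvg x : exp3 (eps k) x @[k --> \oo] --> (1 : R)%R.
Proof.
have -> : (1 = 1 * 1 * 1 :> R)%R by rewrite !mulr1.
by apply: cvgM; [apply: cvgM|]; exact: exp1_cvg.
Qed.

(** The weight of the Sobolev space of order one half bounds the first-order
    error of the damping factor, which is where that regularity enters. *)
Lemma one_sub_exp3 (e : R) x : (0 < e)%R ->
  (1 - exp3 e x <= e * (3 * Num.sqrt (1 + norm3 x ^+ 2)))%R.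
Proof.
move=> e0.
have h (t : R) : (`|t| <= Num.sqrt (1 + norm3 x ^+ 2))%R -> (1 - exp1 e t <=
    e * Num.sqrt (1 + norm3 x ^+ 2))%R.
  move=> tx; have := expR_ge1Dx (- (e * `|t|))%R; rewrite -/(exp1 e t) => h.
  have : (e * `|t| <= e * Num.sqrt (1 + norm3 x ^+ 2))%R by rewrite ler_wpM2l// ltW.
  by lra.
have sq (t : R) : (t ^+ 2 <= nsq x)%R -> (`|t| <= Num.sqrt (1 + norm3 x ^+ 2))%R.
  move=> tx; rewrite -sqrtr_sqr ler_sqrt; last by rewrite addr_ge0// sqr_ge0.
  by rewrite norm3_sqr (le_trans tx)// lerDr.
have [h1 h2 h3] : [/\ (x.1.1 ^+ 2 <= nsq x)%R, (x.1.2 ^+ 2 <= nsq x)%R &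
    (x.2 ^+ 2 <= nsq x)%R].
  rewrite /nsq /dot3 -!expr2; split.
  - by rewrite -addrA lerDl addr_ge0 ?sqr_ge0.
  - by rewrite -addrA addrCA lerDl addr_ge0 ?sqr_ge0.
  - by rewrite lerDr addr_ge0 ?sqr_ge0.
have := h _ (sq _ h1); have := h _ (sq _ h2); have := h _ (sq _ h3).
rewrite /exp3.
have p1 t : (0 <= exp1 e t <= 1)%R.
  by rewrite exp1_ge0/= /exp1 -expR0 ler_expR oppr_le0 mulr_ge0// ltW.
have := p1 x.1.1; have := p1 x.1.2; have := p1 x.2.
move: (exp1 e x.1.1) (exp1 e x.1.2) (exp1 e x.2) (Num.sqrt _) => p q r s.
move=> /andP[r0 r1] /andP[q0 q1] /andP[p0 p1'] hr hq hp.
have pq : (1 - p * q <= (1 - p) + (1 - q))%R.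
  have : (0 <= (1 - p) * (1 - q))%R by rewrite mulr_ge0 ?subr_ge0.
  lra.
have pqr : (1 - p * q * r <= (1 - p * q) + (1 - r))%R.
  have : (0 <= (1 - p * q) * (1 - r))%R.
    by rewrite mulr_ge0 ?subr_ge0// mulr_ile1.
  lra.
lra.
Qed.

(** Monotone convergence in the regularised Plancherel identity, whose first
    term is nonnegative. *)
Lemma bessel (a b n : R3 R -> R) : measurable_fun setT a -> measurable_fun setT b ->
  (forall x, 0 <= n x)%R -> (forall x, n x ^+ 2 = a x ^+ 2 + b x ^+ 2)%R ->
  measurable_fun setT n -> \int[mu3]_x (n x)%:E < +oo ->
  \int[mu3]_xi (ft_sq a b xi)%:E <= ((2 * pi) ^+ 3)%:E * \int[mu3]_x (n x ^+ 2)%:E.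
Proof.
move=> ma mb n0 nE mn n1.
have mft := measurable_ft_sq ma mb.
have mexp (k : nat) : measurable_fun setT (fun xi => (exp3 (eps k) xi * ft_sq a b xi)%:E).
  by apply: mfun_EFin; apply: measurable_funM => //; exact: measurable_exp3.
have cvg := @cvg_monotone_convergence _ _ _ mu3 setT measurableT
  (fun k xi => (exp3 (eps k) xi * ft_sq a b xi)%:E) mexp.
have {}cvg : \int[mu3]_xi (exp3 (eps k) xi * ft_sq a b xi)%:E @[k --> \oo] -->
    \int[mu3]_xi (ft_sq a b xi)%:E.
  have -> : \int[mu3]_xi (ft_sq a b xi)%:E =
      \int[mu3]_xi limn (fun k => (exp3 (eps k) xi * ft_sq a b xi)%:E).
    apply: eq_integral => xi _; apply/esym/cvg_lim => //.
    apply: cvg_EFin; first exact: nearW.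
    rewrite -[X in _ --> X]mul1r; apply: cvgM; [exact: exp3_cvg|exact: cvg_cst].
  apply: cvg.
  - by move=> k xi _; rewrite lee_fin mulr_ge0 ?exp3_ge0 ?ft_sq_ge0.
  - move=> xi _ k l kl; rewrite lee_fin ler_wpM2r ?ft_sq_ge0//.
    by apply: le_exp3; rewrite lef_pV2 ?posrE// ler_nat.
apply: (cvge_le _ cvg); apply: nearW => k.
rewrite -(poisson_identity ma mb n0 nE mn n1 (eps_gt0 k)) leeDr//.
apply: integral_ge0 => x _; apply: integral_ge0 => y _.
by rewrite lee_fin mulr_ge0 ?pois3_ge0 ?eps_gt0// mulr_ge0// addr_ge0 ?sqr_ge0.
Qed.

End bessel.

Section energy.
Context {R : realType}.
Notation mu3 := (@leb3 R).
Local Open Scope ereal_scope.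

(** The mean square increment of [a] at scale [e], weighted by the Poisson
    kernel. *)
Definition energy (e : R) (a : R3 R -> R) : \bar R :=
  \int[mu3]_x \int[mu3]_y (2^-1 * (a x - a y) ^+ 2 * pois3 e (sub3 x y))%:E.

Let M : R := ((2 * pi) ^+ 3)%R.

Lemma measurable_energy (e : R) (a : R3 R -> R) : measurable_fun setT a ->
  measurable_fun setT (fun z : R3 R * R3 R =>
    (2^-1 * (a z.1 - a z.2) ^+ 2 * pois3 e (sub3 z.1 z.2))%:E).
Proof.
move=> ma; apply: mfun_EFin; apply: measurable_funM; first by mfun.
by apply: measurable_pois3; apply: measurable_sub3; mfun.
Qed.

Lemma energy_pt_ge0 (e : R) (a : R3 R -> R) x y : (0 < e)%R ->
  (0 <= 2^-1 * (a x - a y) ^+ 2 * pois3 e (sub3 x y))%R.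
Proof. by move=> e0; rewrite mulr_ge0 ?pois3_ge0// mulr_ge0// sqr_ge0. Qed.

Lemma energy_ge0 e a : (0 < e)%R -> 0 <= energy e a.
Proof.
move=> e0; apply: integral_ge0 => x _; apply: integral_ge0 => y _.
by rewrite lee_fin energy_pt_ge0.
Qed.

(** The square of an increment is at most twice the sum of the squares, and the
    mass of the kernel does not depend on the scale. *)
Lemma energy_le (e : R) (a : R3 R -> R) : (0 < e)%R -> measurable_fun setT a ->
  energy e a <= (2 * M)%:E * \int[mu3]_x (a x ^+ 2)%:E.
Proof.
move=> e0 ma.
have M0 : (0 <= M)%R by rewrite /M exprn_ge0// mulr_ge0// pi_ge0.
pose f x y := (a x ^+ 2 * pois3 e (sub3 x y))%:E.
have f0 x y : 0 <= f x y by rewrite lee_fin mulr_ge0 ?sqr_ge0 ?pois3_ge0.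
have mf : measurable_fun setT (fun z : R3 R * R3 R => f z.1 z.2).
  apply: mfun_EFin; apply: measurable_funM; first by mfun.
  by apply: measurable_pois3; apply: measurable_sub3; mfun.
pose g x y := (a y ^+ 2 * pois3 e (sub3 x y))%:E.
have g0 x y : 0 <= g x y by rewrite lee_fin mulr_ge0 ?sqr_ge0 ?pois3_ge0.
have mg : measurable_fun setT (fun z : R3 R * R3 R => g z.1 z.2).
  apply: mfun_EFin; apply: measurable_funM; first by mfun.
  by apply: measurable_pois3; apply: measurable_sub3; mfun.
have mp x : measurable_fun setT (fun y => (pois3 e (sub3 x y))%:E).
  by apply: mfun_EFin; apply: measurable_pois3; apply: measurable_sub3; mfun.
have inner x : \int[mu3]_y f x y = M%:E * (a x ^+ 2)%:E.
  rewrite /f; under eq_integral do rewrite EFinM.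
  rewrite ge0_integralZl_fin ?sqr_ge0//; last by move=> y; rewrite lee_fin pois3_ge0.
  by rewrite integral_pois3_sub// muleC.
have int_f : \int[mu3]_x \int[mu3]_y f x y = M%:E * \int[mu3]_x (a x ^+ 2)%:E.
  rewrite -ge0_integralZl_fin//; last 2 first.
  - by mfun.
  - by move=> x; rewrite lee_fin sqr_ge0.
  by apply: eq_integral => x _; rewrite inner.
have int_g : \int[mu3]_x \int[mu3]_y g x y = M%:E * \int[mu3]_x (a x ^+ 2)%:E.
  rewrite (tonelli_swap mu3 mu3 mg g0) -int_f; apply: eq_integral => y _.
  by apply: eq_integral => x _; rewrite /f /g pois3_subC.
apply: (@le_trans _ _ (\int[mu3]_x \int[mu3]_y (f x y + g x y))).
  apply: ge0_le_integral => //.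
  - by move=> x _; apply: integral_ge0 => y _; rewrite lee_fin energy_pt_ge0.
  - apply: (mfun_int2 mu3 (f := fun x y => (2^-1 * (a x - a y) ^+ 2 * pois3 e (sub3 x y))%:E)).
      exact: measurable_energy.
    by move=> x y; rewrite lee_fin energy_pt_ge0.
  - apply: (mfun_int2 mu3 (f := fun x y => f x y + g x y)).
      exact: emeasurable_funD.
    by move=> x y; rewrite adde_ge0.
  move=> x _; apply: ge0_le_integral => //.
  - by move=> y _; rewrite lee_fin energy_pt_ge0.
  - exact: (measurableT_comp (measurable_energy e ma) (pair1_measurable x)).
  - apply: emeasurable_funD.
      exact: (measurableT_comp mf (pair1_measurable x)).
    exact: (measurableT_comp mg (pair1_measurable x)).
  move=> y _; rewrite /f /g -EFinD lee_fin -mulrDl ler_wpM2r ?pois3_ge0//.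
  have : (0 <= (a x + a y) ^+ 2)%R by exact: sqr_ge0.
  nra.
rewrite (ge0_integral2D mu3 mu3 mf f0 mg g0) int_f int_g.
by rewrite -ge0_muleDl ?lee_fin// -EFinD; rewrite [(2 * M)%R](_ : _ = M + M)%R//; ring.
Qed.

Lemma energyD (e : R) (a b : R3 R -> R) : (0 < e)%R ->
  measurable_fun setT a -> measurable_fun setT b ->
  energy e (fun x => a x + b x)%R <= 2%:E * energy e a + 2%:E * energy e b.
Proof.
move=> e0 ma mb.
pose f x y := (2 * (2^-1 * (a x - a y) ^+ 2 * pois3 e (sub3 x y)))%:E.
pose g x y := (2 * (2^-1 * (b x - b y) ^+ 2 * pois3 e (sub3 x y)))%:E.
have f0 x y : 0 <= f x y by rewrite lee_fin mulr_ge0// energy_pt_ge0.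
have g0 x y : 0 <= g x y by rewrite lee_fin mulr_ge0// energy_pt_ge0.
have mf : measurable_fun setT (fun z : R3 R * R3 R => f z.1 z.2).
  apply: mfun_EFin; apply: measurable_funM => //.
  by apply/measurable_EFinP; exact: measurable_energy.
have mg : measurable_fun setT (fun z : R3 R * R3 R => g z.1 z.2).
  apply: mfun_EFin; apply: measurable_funM => //.
  by apply/measurable_EFinP; exact: measurable_energy.
have Z (c : R3 R -> R) : measurable_fun setT c -> 2%:E * energy e c =
    \int[mu3]_x \int[mu3]_y (2 * (2^-1 * (c x - c y) ^+ 2 * pois3 e (sub3 x y)))%:E.
  move=> mc; rewrite -ge0_integralZl_fin//; last 2 first.
  - apply: (mfun_int2 mu3 (f := fun x y => (2^-1 * (c x - c y) ^+ 2 * pois3 e (sub3 x y))%:E)).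
      exact: measurable_energy.
    by move=> x y; rewrite lee_fin energy_pt_ge0.
  - by move=> x; apply: integral_ge0 => y _; rewrite lee_fin energy_pt_ge0.
  apply: eq_integral => x _; rewrite -ge0_integralZl_fin//.
  - exact: (measurableT_comp (measurable_energy e mc) (pair1_measurable x)).
  - by move=> y; rewrite lee_fin energy_pt_ge0.
rewrite !Z// -(ge0_integral2D mu3 mu3 mf f0 mg g0).
have mab : measurable_fun setT (fun x => a x + b x)%R by mfun.
apply: ge0_le_integral => //.
- by move=> x _; apply: integral_ge0 => y _; rewrite lee_fin; exact: (energy_pt_ge0 (fun x => a x + b x)%R).
- apply: (mfun_int2 mu3 (f := fun x y => (2^-1 * ((a x + b x) - (a y + b y)) ^+ 2 * pois3 e (sub3 x y))%:E)).
    exact: (measurable_energy e mab).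
  by move=> x y; rewrite lee_fin; exact: (energy_pt_ge0 (fun x => a x + b x)%R).
- apply: (mfun_int2 mu3 (f := fun x y => f x y + g x y)).
    exact: emeasurable_funD.
  by move=> x y; rewrite adde_ge0.
move=> x _; apply: ge0_le_integral => //.
- by move=> y _; rewrite lee_fin; exact: (energy_pt_ge0 (fun x => a x + b x)%R).
- exact: (measurableT_comp (measurable_energy e mab) (pair1_measurable x)).
- apply: emeasurable_funD.
    exact: (measurableT_comp mf (pair1_measurable x)).
  exact: (measurableT_comp mg (pair1_measurable x)).
move=> y _; rewrite -EFinD lee_fin /=.
have := pois3_ge0 (sub3 x y) e0; move: (pois3 e (sub3 x y)) => K K0.
move: (a x) (a y) (b x) (b y) => p p' q q'.
have := mulr_ge0 K0 (sqr_ge0 ((p - p') - (q - q'))).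
lra.
Qed.

End energy.

(** * The modulus of continuity at small scales *)

Section energy_small.
Context {R : realType}.
Notation mu3 := (@leb3 R).
Local Open Scope ereal_scope.

Let mnsq : measurable_fun setT (@nsq R).
Proof. exact: (measurable_nsq (f := id)). Qed.

Definition inball (S : R) (x : R3 R) : R := if (nsq x <= S)%R then 1%R else 0%R.

Lemma measurable_inball d (T : measurableType d) (S : R) (f : T -> R3 R) :
  measurable_fun setT f -> measurable_fun setT (fun t => inball S (f t)).
Proof.
move=> mf; rewrite /inball; apply: measurable_fun_ifT; [|by mfun|by mfun].
by apply: measurable_fun_ler; [exact: measurable_nsq|mfun].
Qed.

Lemma inball_ge0 S x : (0 <= inball S x)%R.
Proof. by rewrite /inball; case: ifP. Qed.

Lemma inball_fin (S : R) : \int[mu3]_x (inball S x)%:E < +oo.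
Proof.
pose c := (`|S| + 1)%R.
have c0 : (0 < c)%R by rewrite ltr_wpDl.
pose I : set (measurableTypeR R) := [set` `[(- c)%R, c]].
have mI : measurable I by exact: measurable_itv.
pose Q : set (R3 R) := I `*` I `*` I.
have mQ : measurable Q by apply: measurableX => //; exact: measurableX.
have Icoord (t : R) : (t ^+ 2 <= S)%R -> I t.
  move=> tS; rewrite /I/= in_itv/= -ler_norml.
  rewrite -(@ler_pXn2r _ 2) ?nnegrE ?(ltW c0)// real_normK ?num_real//.
  rewrite (le_trans tS)// (le_trans (ler_norm S))// /c.
  by have := normr_ge0 S; nra.
apply: (@le_lt_trans _ _ (\int[mu3]_x (\1_Q x)%:E)).
  apply: ge0_le_integral => //.
  - by move=> x _; rewrite lee_fin inball_ge0.
  - by apply: mfun_EFin; apply: measurable_inball; mfun.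
  - by apply/measurable_EFinP/measurable_indic.
  move=> x _; rewrite lee_fin /inball; case: ifPn => // xS.
  suff Qx : Q x by rewrite indicE mem_set.
  have sq := sqr_ge0; move: xS; rewrite /nsq /dot3 -!expr2 => xS.
  split; [split|]; apply: Icoord.
  - have := sq _ (x.1.2 : R); have := sq _ (x.2 : R); lra.
  - have := sq _ (x.1.1 : R); have := sq _ (x.2 : R); lra.
  - have := sq _ (x.1.2 : R); have := sq _ (x.1.1 : R); lra.
rewrite integral_indic// setIT; change (leb3 Q < +oo).
have If : (lebesgue_measure I < +oo)%E.
  by rewrite lebesgue_measure_itv/=; case: ifP => _; rewrite ?ltry// -EFinB ltry.
have I2 : leb2 (I `*` I) < +oo.
  by rewrite /leb2 product_measure1E//; apply: lte_mul_pinfty => //; rewrite ge0_fin_numE.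
rewrite /leb3 product_measure1E//; last exact: measurableX.
apply: lte_mul_pinfty => //.
by rewrite ge0_fin_numE.
Qed.

Lemma nsq_shift3_le (x z : R3 R) : (nsq x <= 2 * nsq (shift3 z x) + 2 * nsq z)%R.
Proof.
rewrite /nsq /dot3/=; move: (x.1.1 : R) (x.1.2 : R) (x.2 : R) (z.1.1 : R) (z.1.2 : R) (z.2 : R).
move=> a b c p q r.
have := sqr_ge0 (a + 2 * p); have := sqr_ge0 (b + 2 * q); have := sqr_ge0 (c + 2 * r).
nra.
Qed.

Lemma cvg_shift3_scale3 (h : R -> R) (x z : R3 R) : continuous h ->
  h (nsq (shift3 (scale3 (eps k) z) x)) @[k --> \oo] --> h (nsq x).
Proof.
move=> ch.
have cn : continuous (fun e : R => h (nsq (shift3 (scale3 e z) x))).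
  move=> e; apply: (@continuous_comp _ _ _ (fun e : R => nsq (shift3 (scale3 e z) x)) h).
    have c (p q : R) : {for e, continuous (fun e : R => p + e * q)%R}.
      by apply: cvgD; [exact: cvg_cst|apply: cvgM; [exact: cvg_id|exact: cvg_cst]].
    by rewrite /nsq /dot3; apply: cvgD; [apply: cvgD|]; apply: cvgM; exact: c.
  exact: ch.
have sx (v : R3 R) : shift3 (scale3 0 z) v = v.
  by case: v => -[p q] t; rewrite /shift3 /scale3/= !mul0r !addr0.
have := cn 0%R; rewrite /continuous_at sx => c0.
exact: (cvg_comp eps (fun e : R => h (nsq (shift3 (scale3 e z) x))) eps_cvg0 c0).
Qed.

Section compact.
Variables (h : R -> R) (B S : R).
Hypothesis ch : continuous h.
Hypothesis hB : forall s, (`|h s| <= B)%R.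
Hypothesis hS : forall s, (S < s)%R -> h s = 0%R.

Let mh : measurable_fun setT h. Proof. exact: continuous_measurable_fun. Qed.
Let mhn : measurable_fun setT (fun x : R3 R => h (nsq x)).
Proof. by apply: (measurableT_comp mh); exact: (measurable_nsq (f := id)). Qed.

Let B0 : (0 <= B)%R. Proof. exact: le_trans (normr_ge0 _) (hB 0%R). Qed.

Lemma compact_sq_le x : (h (nsq x) ^+ 2 <= B ^+ 2 * inball S x)%R.
Proof.
rewrite /inball; case: (leP (nsq x) S) => xS.
  by rewrite mulr1 -real_normK ?num_real// ler_pXn2r ?nnegrE.
by rewrite hS// expr0n/= mulr0.
Qed.

Lemma compact_sq_fin : \int[mu3]_x ((h (nsq x)) ^+ 2)%:E < +oo.
Proof.
apply: (@le_lt_trans _ _ (\int[mu3]_x (B ^+ 2 * inball S x)%:E)).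
  apply: le_integral_EFin.
  - by move=> x; exact: sqr_ge0.
  - by mfun.
  - by apply: measurable_funM => //; apply: measurable_inball; mfun.
  - exact: compact_sq_le.
under eq_integral do rewrite EFinM.
rewrite ge0_integralZl_fin; last 3 first.
- exact: sqr_ge0.
- by apply: mfun_EFin; apply: measurable_inball; mfun.
- by move=> x; rewrite lee_fin inball_ge0.
by rewrite lte_mul_pinfty// ?lee_fin ?sqr_ge0//; exact: inball_fin.
Qed.

Let H2 : R := fine (\int[mu3]_x ((h (nsq x)) ^+ 2)%:E).

Let H2E : \int[mu3]_x ((h (nsq x)) ^+ 2)%:E = H2%:E.
Proof.
rewrite /H2 fineK// ge0_fin_numE ?compact_sq_fin//.
by apply: integral_ge0 => x _; rewrite lee_fin sqr_ge0.
Qed.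

Let msh (e : R) (z : R3 R) : measurable_fun setT
  (fun x : R3 R => h (nsq (shift3 (scale3 e z) x))).
Proof.
apply: (measurableT_comp mh); apply: measurable_nsq.
by apply: measurable_shift3 => //; apply: measurable_scale3; mfun.
Qed.

Let G (k : nat) (z : R3 R) : \bar R :=
  \int[mu3]_x (2^-1 * (h (nsq x) - h (nsq (shift3 (scale3 (eps k) z) x))) ^+ 2)%:E.

Let G_ge0 k z : 0 <= G k z.
Proof. by apply: integral_ge0 => x _; rewrite lee_fin mulr_ge0// sqr_ge0. Qed.

Let G_le k z : G k z <= (2 * H2)%:E.
Proof.
apply: (@le_trans _ _ (\int[mu3]_x ((h (nsq x) ^+ 2)%:E +
    (h (nsq (shift3 (scale3 (eps k) z) x)) ^+ 2)%:E))).
  have m1 := msh (eps k) z.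
  apply: ge0_le_integral => //.
  - by move=> x _; rewrite lee_fin mulr_ge0// sqr_ge0.
  - by mfun.
  - by apply: emeasurable_funD; mfun.
  move=> x _; rewrite -EFinD lee_fin.
  move: (h (nsq x)) (h (nsq (shift3 _ _))) => p q; have := sqr_ge0 (p + q); nra.
have m1 := msh (eps k) z.
rewrite ge0_integralD//; [|by move=> x _; rewrite lee_fin sqr_ge0|by mfun
  |by move=> x _; rewrite lee_fin sqr_ge0|by mfun].
rewrite (leb3_shift (scale3 (eps k) z) (f := fun x => (h (nsq x) ^+ 2)%:E)); last 2 first.
- by mfun.
- by move=> x; rewrite lee_fin sqr_ge0.
by rewrite H2E -EFinD lee_fin mulr_natl mulr2n.
Qed.

Let G_cvg0 z : G k z @[k --> \oo] --> 0.
Proof.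
(* the shifted support lies in a ball that does not depend on the scale *)
pose g (x : R3 R) : R := (2 * B ^+ 2 * inball (2 * S + 2 * nsq z) x +
  2 * B ^+ 2 * inball S x)%R.
have mg : measurable_fun setT g.
  by apply: measurable_funD; apply: measurable_funM => //; apply: measurable_inball; mfun.
apply: (cvg_integral0 (g := g)) => //.
- by move=> k; have m1 := msh (eps k) z; mfun.
- move=> k x; apply/andP; split; first by rewrite mulr_ge0// sqr_ge0.
  have h1 := compact_sq_le x.
  have h2 : (h (nsq (shift3 (scale3 (eps k) z) x)) ^+ 2 <=
      B ^+ 2 * inball (2 * S + 2 * nsq z) x)%R.
    rewrite (le_trans (compact_sq_le _))// ler_wpM2l ?sqr_ge0//.
    rewrite /inball; case: ifPn => [k1|_]; last by case: ifP.
    rewrite ifT// (le_trans (nsq_shift3_le x (scale3 (eps k) z)))//.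
    apply: lerD; first by rewrite ler_pM2l.
    rewrite ler_pM2l// nsq_scale ler_piMl ?nsq_ge0//.
    by rewrite exprn_ile1 ?eps_le1// ltW ?eps_gt0.
  rewrite /g; move: h1 h2; move: (h (nsq x)) (h (nsq (shift3 _ _))) (inball S x) (inball (2 * S + _) x) => p q r s.
  have := sqr_ge0 (p + q); nra.
- have F (T : R) : \int[mu3]_x (2 * B ^+ 2 * inball T x)%:E < +oo.
    under eq_integral do rewrite EFinM.
    rewrite ge0_integralZl_fin; last 3 first.
    - by rewrite mulr_ge0// sqr_ge0.
    - by apply: mfun_EFin; apply: measurable_inball; mfun.
    - by move=> x; rewrite lee_fin inball_ge0.
    rewrite lte_mul_pinfty// ?lee_fin ?mulr_ge0 ?sqr_ge0//; exact: inball_fin.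
  have F0 T x : 0 <= (2 * B ^+ 2 * inball T x)%:E.
    by rewrite lee_fin !mulr_ge0 ?inball_ge0.
  have mF T : measurable_fun setT (fun x : R3 R => (2 * B ^+ 2 * inball T x)%:E).
    by apply: mfun_EFin; apply: measurable_funM => //; apply: measurable_inball; mfun.
  rewrite /g; under eq_integral do rewrite EFinD.
  rewrite ge0_integralD//; exact: lte_add_pinfty (F _) (F _).
- move=> x; rewrite [X in _ --> X](_ : _ = 2^-1 * (h (nsq x) - h (nsq x)) ^+ 2)%R; last first.
    by rewrite subrr expr0n/= mulr0.
  apply: cvgM; first exact: cvg_cst.
  rewrite expr2; under eq_fun do rewrite expr2.
  apply: cvgM; (apply: cvgB; [exact: cvg_cst|exact: cvg_shift3_scale3]).
Qed.

Let energyE (k : nat) : energy (eps k) (fun x => h (nsq x)) =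
  \int[mu3]_z (G k z * (pois3 1 z)%:E).
Proof.
pose f (x y : R3 R) : \bar R :=
  (2^-1 * (h (nsq x) - h (nsq y)) ^+ 2 * pois3 (eps k) (sub3 x y))%:E.
have f0 x y : 0 <= f x y.
  by rewrite lee_fin mulr_ge0 ?pois3_ge0 ?eps_gt0// mulr_ge0// sqr_ge0.
have mfx x : measurable_fun setT (f x).
  apply: mfun_EFin; apply: measurable_funM; first by mfun.
  by apply: measurable_pois3; apply: measurable_sub3; mfun.
pose F (x z : R3 R) : \bar R :=
  (2^-1 * (h (nsq x) - h (nsq (shift3 (scale3 (eps k) z) x))) ^+ 2 * pois3 1 z)%:E.
have F0 x z : 0 <= F x z.
  by rewrite lee_fin mulr_ge0 ?pois3_ge0// mulr_ge0// sqr_ge0.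
have mF : measurable_fun setT (fun p : R3 R * R3 R => F p.1 p.2).
  apply: mfun_EFin; apply: measurable_funM; last by apply: measurable_pois3; mfun.
  apply: measurable_funM => //; apply: measurable_funX; apply: measurable_funB.
    by apply: (measurableT_comp mhn); mfun.
  apply: (measurableT_comp mh); apply: measurable_nsq; apply: measurable_shift3; last by mfun.
  by apply: measurable_scale3; mfun.
have e0 := @eps_gt0 R k.
have step x : \int[mu3]_y f x y = \int[mu3]_z F x z.
  rewrite -(leb3_shift x (mfx x)); last by move=> y; exact: f0.
  have := leb3_scale (f := fun y => f x (shift3 x y)) e0.
  have mfs : measurable_fun setT (fun y => f x (shift3 x y)).
    by apply: (measurableT_comp (mfx x)); apply: measurable_shift3; mfun.
  move=> /(_ mfs (fun y => f0 x _)) H.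
  have e3 : (eps k ^+ 3)%:E * (eps k ^- 3)%:E = 1 :> \bar R.
    by rewrite -EFinM mulfV// expf_neq0// gt_eqF.
  rewrite -[LHS]mul1e -e3 -muleA -H -ge0_integralZl_fin; last 3 first.
  - by rewrite exprn_ge0// ltW.
  - by apply: (measurableT_comp mfs); apply: measurable_scale3; mfun.
  - by move=> y; exact: f0.
  apply: eq_integral => z _; rewrite /f /F -EFinM; congr EFin.
  have -> : shift3 x (scale3 (eps k) z) = shift3 (scale3 (eps k) z) x.
    by rewrite /shift3/= ![(_ + eps k * _)%R]addrC.
  have -> : pois3 (eps k) (sub3 x (shift3 (scale3 (eps k) z) x)) =
      (eps k ^- 3 * pois3 1 z)%R.
    rewrite pois3_subC -pois3_scale//; congr (pois3 _ _).
    by rewrite /sub3/= /scale3 ![(_ + eps k * _)%R]addrC !addrK.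
  by field; rewrite gt_eqF.
rewrite /energy; under eq_integral do rewrite step.
rewrite (tonelli_swap mu3 mu3 mF F0); apply: eq_integral => z _.
rewrite /G -ge0_integralZr//.
- by have m1 := msh (eps k) z; mfun.
- by move=> x _; rewrite lee_fin mulr_ge0// sqr_ge0.
- by rewrite lee_fin pois3_ge0.
Qed.

(** After the substitution [y = x + e z] the kernel no longer depends on the
    scale, and dominated convergence applies twice: in [x] for fixed [z], where
    the support is compact, then in [z]. *)
Lemma energy_cvg0 : energy (eps k) (fun x => h (nsq x)) @[k --> \oo] --> 0.
Proof.
have Gfin k z : G k z \is a fin_num.
  by rewrite ge0_fin_numE// (le_lt_trans (G_le k z))// ltry.
have mG k : measurable_fun setT (G k).
  apply: (mfun_int2 mu3 (f := fun z x =>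
    (2^-1 * (h (nsq x) - h (nsq (shift3 (scale3 (eps k) z) x))) ^+ 2)%:E)).
    apply: mfun_EFin; apply: measurable_funM => //.
    apply: measurable_funX; apply: measurable_funB.
      by apply: (measurableT_comp mhn); mfun.
    apply: (measurableT_comp mh); apply: measurable_nsq; apply: measurable_shift3; last by mfun.
    by apply: measurable_scale3; mfun.
  by move=> z x; rewrite lee_fin mulr_ge0// sqr_ge0.
have H20 : (0 <= H2)%R.
  by apply: fine_ge0; apply: integral_ge0 => x _; rewrite lee_fin sqr_ge0.
under eq_fun do rewrite energyE.
have -> : (fun k => \int[mu3]_z (G k z * (pois3 1 z)%:E)) =
    (fun k => \int[mu3]_z (fine (G k z) * pois3 1 z)%:E).
  by apply/funext => k; apply: eq_integral => z _; rewrite [RHS]EFinM fineK.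
have mp : measurable_fun setT (fun z : R3 R => pois3 1 z) by exact: measurable_pois3.
apply: (cvg_integral0 (g := fun z => (2 * H2) * pois3 1 z)%R).
- by move=> k; apply: measurable_funM => //; exact: measurableT_comp.
- exact: measurable_funM.
- move=> k z; apply/andP; split.
    by rewrite mulr_ge0 ?pois3_ge0// fine_ge0.
  by rewrite ler_wpM2r ?pois3_ge0// -lee_fin fineK.
- under eq_integral do rewrite EFinM.
  rewrite ge0_integralZl_fin; last 3 first.
  - by rewrite mulr_ge0.
  - by mfun.
  - by move=> z; rewrite lee_fin pois3_ge0.
  by rewrite integral_pois3// -EFinM ltry.
- move=> z; rewrite -[X in _ --> X](mul0r (pois3 1 z)); apply: cvgM; last exact: cvg_cst.
  by have /fine_cvg := G_cvg0 z.
Qed.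

End compact.
End energy_small.

(** * Plancherel's inequality for radial functions *)

Section radial_plancherel.
Context {R : realType}.
Notation mu3 := (@leb3 R).
Local Open Scope ereal_scope.

Let mnsq : measurable_fun setT (@nsq R).
Proof. exact: (measurable_nsq (f := id)). Qed.

Lemma ae_energy (e : R) (a b : R3 R -> R) : (0 < e)%R ->
  measurable_fun setT a -> measurable_fun setT b ->
  {ae mu3, forall x, a x = b x} -> energy e a = energy e b.
Proof.
move=> e0 ma mb ab; rewrite /energy.
have m1 := measurable_energy e ma; have m2 := measurable_energy e mb.
apply: ge0_ae_eq_integral => //.
- apply: (mfun_int2 mu3 (f := fun x y => (2^-1 * (a x - a y) ^+ 2 * pois3 e (sub3 x y))%:E)) => //.
  by move=> x y; rewrite lee_fin energy_pt_ge0.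
- apply: (mfun_int2 mu3 (f := fun x y => (2^-1 * (b x - b y) ^+ 2 * pois3 e (sub3 x y))%:E)) => //.
  by move=> x y; rewrite lee_fin energy_pt_ge0.
- by move=> x _; apply: integral_ge0 => y _; rewrite lee_fin energy_pt_ge0.
- by move=> x _; apply: integral_ge0 => y _; rewrite lee_fin energy_pt_ge0.
move: (ab); apply: filterS => x abx _; apply: ge0_ae_eq_integral => //.
- exact: (measurableT_comp m1 (pair1_measurable x)).
- exact: (measurableT_comp m2 (pair1_measurable x)).
- by move=> y _; rewrite lee_fin energy_pt_ge0.
- by move=> y _; rewrite lee_fin energy_pt_ge0.
by move: ab; apply: filterS => y aby _; rewrite abx aby.
Qed.


(** The energy is controlled by the norm of [L2] uniformly in the scale, so that
    it suffices to treat a dense set. *)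
Lemma radial_energy_small (phi : R -> R) (d : R) : measurable_fun setT phi ->
  \int[mu3]_x (phi (nsq x) ^+ 2)%:E < +oo -> (0 < d)%R ->
  \forall k \near \oo, energy (eps k) (fun x => phi (nsq x)) < d%:E.
Proof.
move=> mphi fin d0.
pose M : R := ((2 * pi) ^+ 3)%R.
have M0 : (0 < M)%R by rewrite /M exprn_gt0// mulr_gt0// pi_gt0.
have e0 : (0 < d / (8 * M))%R by rewrite divr_gt0// mulr_gt0.
have [h [B [S [ch S0 hB hS small]]]] := radial_density mphi fin e0.
have mh : measurable_fun setT h by exact: continuous_measurable_fun.
have d4 : (0 < d / 4)%R by rewrite divr_gt0.
have double_lt (x y : \bar R) : x < y -> 2%:E * x < 2%:E * y by rewrite lte_pmul2l.
have := cvge0_lt d4 (energy_cvg0 ch hB hS).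
apply: filterS => k hk.
have ek := @eps_gt0 R k.
have mfn : measurable_fun setT (fun x : R3 R => (phi (nsq x) - h (nsq x))%R) by mfun.
have mhn : measurable_fun setT (fun x : R3 R => h (nsq x)) by mfun.
rewrite (_ : (fun x => phi (nsq x)) =
    (fun x : R3 R => (phi (nsq x) - h (nsq x)) + h (nsq x))%R); last first.
  by apply/funext => x; rewrite subrK.
apply: (le_lt_trans (energyD ek mfn mhn)).
have e1 : energy (eps k) (fun x : R3 R => phi (nsq x) - h (nsq x))%R <= (d / 4)%:E.
  apply: (le_trans (energy_le ek mfn)).
  have -> : (d / 4)%:E = (2 * M)%:E * (d / (8 * M))%:E.
    rewrite -EFinM; congr EFin.
    by move: M0; clearbody M => M0; field; rewrite gt_eqF.
  apply: lee_wpmul2l; first by rewrite lee_fin mulr_ge0// ltW.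
  exact: ltW.
have -> : d%:E = 2%:E * (d / 4)%:E + 2%:E * (d / 4)%:E.
  by rewrite -!EFinM -EFinD; congr EFin; field.
apply: lee_ltD => //.
- by rewrite fin_numM// ge0_fin_numE ?energy_ge0// (le_lt_trans e1)// ltry.
- by apply: lee_wpmul2l.
- exact: double_lt hk.
Qed.

Section truncated.
Variables (a b n : R3 R -> R) (p q : R -> R).
Hypothesis ma : measurable_fun setT a.
Hypothesis mb : measurable_fun setT b.
Hypothesis mn : measurable_fun setT n.
Hypothesis mp : measurable_fun setT p.
Hypothesis mq : measurable_fun setT q.
Hypothesis n0 : (forall x, 0 <= n x)%R.
Hypothesis nE : (forall x, n x ^+ 2 = a x ^+ 2 + b x ^+ 2)%R.
Hypothesis n1 : \int[mu3]_x (n x)%:E < +oo.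
Hypothesis n2 : \int[mu3]_x (n x ^+ 2)%:E < +oo.
Hypothesis ap : {ae mu3, forall x, a x = p (nsq x)}.
Hypothesis bq : {ae mu3, forall x, b x = q (nsq x)}.

Let M : R := ((2 * pi) ^+ 3)%R.
Let M0 : (0 < M)%R. Proof. by rewrite /M exprn_gt0// mulr_gt0// pi_gt0. Qed.

Lemma energy2_identity (e : R) : (0 < e)%R ->
  energy e a + energy e b + \int[mu3]_xi (exp3 e xi * ft_sq a b xi)%:E =
  M%:E * \int[mu3]_x (n x ^+ 2)%:E.
Proof.
move=> e0; rewrite -(poisson_identity ma mb n0 nE mn n1 e0); congr (_ + _).
rewrite /energy -ge0_integral2D.
- apply: eq_integral => x _; apply: eq_integral => y _.
  by rewrite -EFinD -mulrDl -mulrDr.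
- exact: measurable_energy.
- by move=> x y; rewrite lee_fin energy_pt_ge0.
- exact: measurable_energy.
- by move=> x y; rewrite lee_fin energy_pt_ge0.
Qed.

Let ap2 : \int[mu3]_x (p (nsq x) ^+ 2)%:E < +oo.
Proof.
apply: le_lt_trans n2.
rewrite -(@ge0_ae_eq_integral _ _ _ mu3 setT (fun x => (a x ^+ 2)%:E)) //; last 5 first.
- by mfun.
- by mfun.
- by move=> x _; rewrite lee_fin sqr_ge0.
- by move=> x _; rewrite lee_fin sqr_ge0.
- by move: ap; apply: filterS => x -> _.
apply: le_integral_EFin.
- by move=> x; exact: sqr_ge0.
- by mfun.
- by mfun.
- by move=> x; rewrite nE lerDl sqr_ge0.
Qed.

Let bq2 : \int[mu3]_x (q (nsq x) ^+ 2)%:E < +oo.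
Proof.
apply: le_lt_trans n2.
rewrite -(@ge0_ae_eq_integral _ _ _ mu3 setT (fun x => (b x ^+ 2)%:E)) //; last 5 first.
- by mfun.
- by mfun.
- by move=> x _; rewrite lee_fin sqr_ge0.
- by move=> x _; rewrite lee_fin sqr_ge0.
- by move: bq; apply: filterS => x -> _.
apply: le_integral_EFin.
- by move=> x; exact: sqr_ge0.
- by mfun.
- by mfun.
- by move=> x; rewrite nE lerDr sqr_ge0.
Qed.

(** In the regularised Plancherel identity, the first term vanishes in the limit
    and the damping factor is at most one. *)
Lemma radial_plancherel_ge :
  M%:E * \int[mu3]_x (n x ^+ 2)%:E <= \int[mu3]_xi (ft_sq a b xi)%:E.
Proof.
have mft := measurable_ft_sq ma mb.
apply/lee_addgt0Pr => d d0.
have d2 : (0 < d / 2)%R by rewrite divr_gt0.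
have [k _ /(_ k (leqnn k)) [ha hb]] : \forall k \near \oo,
    energy (eps k) a < (d / 2)%:E /\ energy (eps k) b < (d / 2)%:E.
  have mpn : measurable_fun setT (fun x : R3 R => p (nsq x)) by mfun.
  have mqn : measurable_fun setT (fun x : R3 R => q (nsq x)) by mfun.
  apply: filterS2 (radial_energy_small mp ap2 d2) (radial_energy_small mq bq2 d2).
  move=> k h1 h2; have ea := ae_energy (eps_gt0 k) ma mpn ap.
  have eb := ae_energy (eps_gt0 k) mb mqn bq.
  by split; [exact: (etrans (congr1 (fun z => z < _) ea) h1)
    |exact: (etrans (congr1 (fun z => z < _) eb) h2)].
rewrite -(energy2_identity (eps_gt0 k)) addeC; apply: leeD.
  apply: le_integral_EFin => //.
  - by move=> x; rewrite mulr_ge0 ?exp3_ge0 ?ft_sq_ge0.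
  - by apply: measurable_funM => //; apply: measurable_exp3; mfun.
  - by move=> x; rewrite ler_piMl ?ft_sq_ge0// exp3_le1// eps_gt0.
have -> : d%:E = (d / 2)%:E + (d / 2)%:E by rewrite -EFinD; congr EFin; field.
exact: leeD (ltW ha) (ltW hb).
Qed.

(** The regularised Plancherel identity subtracted from the inequality above
    leaves the high frequencies only. *)
Lemma energy_le_frequencies (e : R) : (0 < e)%R ->
  energy e a + energy e b <=
  \int[mu3]_xi ((1 - exp3 e xi) * ft_sq a b xi)%:E.
Proof.
move=> e0.
have mft := measurable_ft_sq ma mb.
have mexp : measurable_fun setT (fun xi : R3 R => exp3 e xi).
  by apply: measurable_exp3; mfun.
have e3 x : (0 <= 1 - exp3 e x)%R by rewrite subr_ge0 exp3_le1.
have fin : \int[mu3]_xi (exp3 e xi * ft_sq a b xi)%:E \is a fin_num.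
  rewrite ge0_fin_numE; last first.
    by apply: integral_ge0 => x _; rewrite lee_fin mulr_ge0 ?exp3_ge0 ?ft_sq_ge0.
  apply: (@le_lt_trans _ _ (M%:E * \int[mu3]_x (n x ^+ 2)%:E)).
    by rewrite -(energy2_identity e0) leeDr// adde_ge0 ?energy_ge0.
  by rewrite lte_mul_pinfty// lee_fin ltW.
rewrite -(leeD2rE _ _ fin) (energy2_identity e0) (le_trans radial_plancherel_ge)//.
rewrite -ge0_integralD//.
- apply: ge0_le_integral => //.
  - by move=> x _; rewrite lee_fin ft_sq_ge0.
  - by mfun.
  - by apply: emeasurable_funD; mfun.
  - by move=> x _; rewrite -EFinD -mulrDl subrK mul1r.
- by move=> x _; rewrite lee_fin mulr_ge0 ?ft_sq_ge0.
- by mfun.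
- by move=> x _; rewrite lee_fin mulr_ge0 ?exp3_ge0 ?ft_sq_ge0.
- by mfun.
Qed.

End truncated.
End radial_plancherel.

(** * Truncated Fourier transforms *)

Section truncated_transform.
Context {R : realType}.
Local Open Scope ereal_scope.

Let M : R := ((2 * pi) ^+ 3)%R.
Let M0 : (0 < M)%R. Proof. by rewrite /M exprn_gt0// mulr_gt0// pi_gt0. Qed.

Definition trunc3 (r : R) (f : R3 R -> R) x : R := if (norm3 x <= r)%R then f x else 0%R.

Lemma measurable_norm : measurable_fun setT (@norm3 R).
Proof. by apply: measurable_norm3; mfun. Qed.

Lemma measurable_trunc3 r (f : R3 R -> R) : measurable_fun setT f ->
  measurable_fun setT (trunc3 r f).
Proof.
move=> mf; have mn := measurable_norm.
by rewrite /trunc3; apply: measurable_fun_ifT => //; mfun.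
Qed.

Definition fourier_cst : R := ((2 * pi) `^ (- (3 / 2)))%R.

Definition fourier_of (a b : R3 R -> R) (xi : R3 R) : R[i] :=
  (fourier_cst%:C%C * (ft_re a b xi +i* ft_im a b xi)%C)%R.

Lemma normcE2 (z : R[i]) : (normc z ^+ 2 = complex.Re z ^+ 2 + complex.Im z ^+ 2)%R.
Proof. by case: z => x y /=; rewrite sqr_sqrtr// addr_ge0 ?sqr_ge0. Qed.

Lemma normc_ge0 (z : R[i]) : (0 <= normc z)%R.
Proof. by case: z => x y /=; exact: sqrtr_ge0. Qed.

(** The normalization of the transform is the one that makes it an isometry:
    its square is the inverse of the mass of the Poisson kernel. *)
Lemma fourier_constant : (fourier_cst ^+ 2 = M^-1)%R.
Proof.
have p0 : (0 <= 2 * pi :> R)%R by rewrite mulr_ge0// pi_ge0.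
rewrite /fourier_cst powRN exprVn -powR_mulrn ?powR_ge0// -powRrM.
have -> : (3 / 2 * 2 = 3 :> R)%R by field.
by rewrite powR_mulrn.
Qed.

Lemma fourier_of_sq a b xi : (normc (fourier_of a b xi) ^+ 2 = M^-1 * ft_sq a b xi)%R.
Proof.
rewrite normcE2 /fourier_of -fourier_constant /ft_sq.
by move: fourier_cst (ft_re _ _ _) (ft_im _ _ _) => k x y /=; ring.
Qed.

Lemma fourier_truncE u n xi : fourier_trunc u n xi =
  fourier_of (trunc3 n%:R (fun x => complex.Re (u x)))
             (trunc3 n%:R (fun x => complex.Im (u x))) xi.
Proof.
rewrite /fourier_trunc /fourier_of /cintegral; congr (_ * _)%R.
congr (_ +i* _)%C; rewrite /ft_re /ft_im /Rintegral integral_mkcond;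
  congr fine; apply: eq_integral => x _; rewrite patchE /trunc3;
  case: ifPn => /=.
- by rewrite inE/= => ->; case: (u x) => p q /=; congr EFin; ring.
- by rewrite notin_setE/= => /negP/negbTE ->; rewrite !mul0r addr0.
- by rewrite inE/= => ->; case: (u x) => p q /=; congr EFin; ring.
- by rewrite notin_setE/= => /negP/negbTE ->; rewrite !mul0r subr0.
Qed.

End truncated_transform.

(** * Mass near the origin *)

Section mass_near_origin.
Context {R : realType}.
Notation mu3 := (@leb3 R).
Local Open Scope ereal_scope.

Let M : R := ((2 * pi) ^+ 3)%R.
Let M0 : (0 < M)%R. Proof. by rewrite /M exprn_gt0// mulr_gt0// pi_gt0. Qed.

Let mnsq : measurable_fun setT (@nsq R).
Proof. exact: (measurable_nsq (f := id)). Qed.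

Let minball S : measurable_fun setT (@inball R S).
Proof. by apply: measurable_inball; mfun. Qed.

Lemma ge0_integral2Zl (k : R) (f : R3 R -> R3 R -> \bar R) : (0 <= k)%R ->
  measurable_fun setT (fun z : R3 R * R3 R => f z.1 z.2) -> (forall x y, 0 <= f x y) ->
  \int[mu3]_x \int[mu3]_y (k%:E * f x y) = k%:E * \int[mu3]_x \int[mu3]_y f x y.
Proof.
move=> k0 mf f0; rewrite -ge0_integralZl_fin//.
- apply: eq_integral => x _; rewrite ge0_integralZl_fin//.
  exact: (measurableT_comp mf (pair1_measurable x)).
- exact: (mfun_int2 mu3).
- by move=> x; apply: integral_ge0.
Qed.

(** Comparing the value at [x] with an average of the values at distance [e]:
    a function whose modulus of continuity at scale [e] is small cannot
    concentrate its square on a ball of volume much less than [e ^+ 3]. *)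
Lemma ball_mass (a b n : R3 R -> R) (e S : R) : measurable_fun setT a ->
  measurable_fun setT b -> measurable_fun setT n ->
  (forall x, n x ^+ 2 = a x ^+ 2 + b x ^+ 2)%R -> (0 < e)%R ->
  M%:E * \int[mu3]_x (inball S x * n x ^+ 2)%:E <=
  4%:E * (energy e a + energy e b) +
  (2 * (2 / e) ^+ 3)%:E * (\int[mu3]_x (inball S x)%:E * \int[mu3]_x (n x ^+ 2)%:E).
Proof.
move=> ma mb mn nE e0.
have i0 x := inball_ge0 S x.
have c0 : (0 <= 2 * (2 / e) ^+ 3)%R by rewrite mulr_ge0// exprn_ge0// divr_ge0// ltW.
pose F x y := (inball S x * n x ^+ 2 * pois3 e (sub3 x y))%:E.
pose A (a : R3 R -> R) x y := (2^-1 * (a x - a y) ^+ 2 * pois3 e (sub3 x y))%:E.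
pose G x y := ((2 * (2 / e) ^+ 3) * (inball S x * n y ^+ 2))%:E.
have mA c : measurable_fun setT c ->
  measurable_fun setT (fun z : R3 R * R3 R => A c z.1 z.2) by exact: measurable_energy.
have A0 c x y : 0 <= A c x y by rewrite lee_fin energy_pt_ge0.
have mK : measurable_fun setT (fun z : R3 R * R3 R => pois3 e (sub3 z.1 z.2)).
  by apply: measurable_pois3; apply: measurable_sub3; mfun.
have mi : measurable_fun setT (fun z : R3 R * R3 R => inball S z.1) by mfun.
have mF : measurable_fun setT (fun z : R3 R * R3 R => F z.1 z.2).
  apply: mfun_EFin; apply: measurable_funM => //; mfun.
have mG : measurable_fun setT (fun z : R3 R * R3 R => G z.1 z.2).
  by rewrite /G; mfun.
have F0 x y : 0 <= F x y by rewrite lee_fin mulr_ge0 ?pois3_ge0// mulr_ge0// sqr_ge0.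
have G0 x y : 0 <= G x y by rewrite lee_fin mulr_ge0// mulr_ge0// sqr_ge0.
have mn2 : measurable_fun setT (fun x => (n x ^+ 2)%:E) by mfun.
have iF : \int[mu3]_x \int[mu3]_y F x y = M%:E * \int[mu3]_x (inball S x * n x ^+ 2)%:E.
  rewrite -ge0_integralZl_fin; last 3 first.
  - exact: ltW.
  - by mfun.
  - by move=> x; rewrite lee_fin mulr_ge0// sqr_ge0.
  apply: eq_integral => x _; rewrite /F; under eq_integral do rewrite EFinM.
  rewrite ge0_integralZl_fin; last 3 first.
  - by rewrite mulr_ge0// sqr_ge0.
  - by apply: mfun_EFin; apply: measurable_pois3; apply: measurable_sub3; mfun.
  - by move=> y; rewrite lee_fin pois3_ge0.
  by rewrite integral_pois3_sub// muleC.
have iG : \int[mu3]_x \int[mu3]_y G x y = (2 * (2 / e) ^+ 3)%:E *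
    (\int[mu3]_x (inball S x)%:E * \int[mu3]_x (n x ^+ 2)%:E).
  rewrite /G.
  under eq_integral => x _ do under eq_integral => y _ do rewrite EFinM.
  rewrite ge0_integral2Zl//.
  - apply: (congr1 (mule _)).
    under eq_integral => x _ do under eq_integral => y _ do rewrite EFinM.
    rewrite -ge0_integralZr//.
    + apply: eq_integral => x _; rewrite ge0_integralZl_fin// => y.
      by rewrite lee_fin sqr_ge0.
    + by mfun.
    + by move=> x _; rewrite lee_fin.
    + by apply: integral_ge0 => x _; rewrite lee_fin sqr_ge0.
  - by apply: mfun_EFin; mfun.
  - by move=> x y; rewrite lee_fin mulr_ge0// sqr_ge0.
rewrite -iF -iG.
have -> : 4%:E * (energy e a + energy e b) =
    \int[mu3]_x \int[mu3]_y (4%:E * (A a x y + A b x y)).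
  rewrite ge0_integral2Zl//.
  - by rewrite ge0_integral2D//; exact: mA.
  - by apply: emeasurable_funD; exact: mA.
  - by move=> x y; exact: adde_ge0.
rewrite -ge0_integral2D//; last 2 first.
- by apply: emeasurable_funM => //; apply: emeasurable_funD; exact: mA.
- by move=> x y; rewrite mule_ge0// adde_ge0.
have mR : measurable_fun setT (fun z : R3 R * R3 R =>
    4%:E * (A a z.1 z.2 + A b z.1 z.2) + G z.1 z.2).
  apply: emeasurable_funD => //; apply: emeasurable_funM => //.
  by apply: emeasurable_funD; exact: mA.
have R0 x y : 0 <= 4%:E * (A a x y + A b x y) + G x y.
  by rewrite adde_ge0// mule_ge0// adde_ge0.
apply: ge0_le_integral => //.
- by move=> x _; exact: integral_ge0.
- exact: (mfun_int2 mu3).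
- exact: (mfun_int2 mu3 mR).
move=> x _; apply: ge0_le_integral => //.
- exact: (measurableT_comp mF (pair1_measurable x)).
- exact: (measurableT_comp mR (pair1_measurable x)).
move=> y _; rewrite /F /A /G -[X in 4%:E * X]EFinD -[X in X + _]EFinM -EFinD lee_fin !nE.
(* the value at [x] is split as an increment plus the value at [y] *)
have := pois3_le (sub3 x y) e0; have := pois3_ge0 (sub3 x y) e0.
move: (pois3 _ _) ((2 / e) ^+ 3)%R => K C K0 KC.
have : (0 <= (a x - 2 * a y) ^+ 2 * K)%R by rewrite mulr_ge0// sqr_ge0.
have : (0 <= (b x - 2 * b y) ^+ 2 * K)%R by rewrite mulr_ge0// sqr_ge0.
have : (0 <= (a x - a y) ^+ 2 * K)%R by rewrite mulr_ge0// sqr_ge0.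
have : (0 <= (b x - b y) ^+ 2 * K)%R by rewrite mulr_ge0// sqr_ge0.
have : (0 <= (a y ^+ 2 + b y ^+ 2) * (C - K))%R.
  by rewrite mulr_ge0 ?subr_ge0// addr_ge0// sqr_ge0.
by rewrite /inball; case: ifP => _; nra.
Qed.

Lemma inball_scale (r : R) : (0 < r)%R ->
  \int[mu3]_x (inball (r ^+ 2) x)%:E = (r ^+ 3)%:E * \int[mu3]_x (inball 1 x)%:E.
Proof.
move=> r0; have ri0 : (0 < r^-1)%R by rewrite invr_gt0.
have := leb3_scale (f := fun x => (inball 1 x)%:E) ri0.
rewrite exprVn invrK => <-; last 2 first.
- by mfun.
- by move=> x; rewrite lee_fin inball_ge0.
apply: eq_integral => x _; congr EFin; rewrite /inball nsq_scale exprVn.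
by rewrite mulrC ler_pdivrMr ?exprn_gt0// mul1r.
Qed.

End mass_near_origin.

Section mass_decay.
Context {R : realType}.
Notation mu3 := (@leb3 R).
Local Open Scope ereal_scope.

Let M : R := ((2 * pi) ^+ 3)%R.
Let M0 : (0 < M)%R. Proof. by rewrite /M exprn_gt0// mulr_gt0// pi_gt0. Qed.

Let mnsq : measurable_fun setT (@nsq R).
Proof. exact: (measurable_nsq (f := id)). Qed.

Let minball S : measurable_fun setT (@inball R S).
Proof. by apply: measurable_inball; mfun. Qed.

Definition dens (u : R3 R -> R[i]) (x : R3 R) : R := (normc (u x) ^+ 2)%R.

Lemma densE u x : dens u x = (complex.Re (u x) ^+ 2 + complex.Im (u x) ^+ 2)%R.
Proof. exact: normcE2. Qed.

Lemma dens_ge0 u x : (0 <= dens u x)%R. Proof. exact: sqr_ge0. Qed.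

Lemma measurable_dens u : cmeasurable u -> measurable_fun setT (dens u).
Proof.
move=> [m1 m2]; rewrite (_ : dens u = fun x => (complex.Re (u x) ^+ 2 + complex.Im (u x) ^+ 2)%R).
  by mfun.
by apply/funext => x; rewrite densE.
Qed.

Lemma norm3_le_nsq (r : R) x : (0 <= r)%R -> (norm3 x <= r)%R = (nsq x <= r ^+ 2)%R.
Proof.
move=> r0; rewrite -norm3_sqr.
by rewrite ler_pXn2r ?nnegrE// norm3_ge0.
Qed.

Variables (u g : R3 R -> R[i]).
Hypothesis u2 : L2 u.
Hypothesis ug : is_fourier u g.
Hypothesis gfin : \int[mu3]_xi (Num.sqrt (1 + norm3 xi ^+ 2) * dens g xi)%:E < +oo.
Hypothesis ru : radial u.

Let a x : R := complex.Re (u x).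
Let b x : R := complex.Im (u x).
Let n x : R := normc (u x).

Let ma : measurable_fun setT a. Proof. by case: u2.1. Qed.
Let mb : measurable_fun setT b. Proof. by case: u2.1. Qed.
Lemma measurable_normc : measurable_fun setT n.
Proof.
rewrite (_ : n = fun x => Num.sqrt (dens u x)); last first.
  by apply/funext => x; rewrite sqrtr_sqr ger0_norm ?normc_ge0.
have := measurable_dens u2.1 => md; mfun.
Qed.

Lemma trunc_normc_sq r x :
  (trunc3 r n x ^+ 2 = trunc3 r a x ^+ 2 + trunc3 r b x ^+ 2)%R.
Proof.
rewrite /trunc3; case: ifP => _; last by rewrite expr0n/= addr0.
exact: densE.
Qed.

Let N := fine (\int[mu3]_x (dens u x)%:E).
Let NE : \int[mu3]_x (dens u x)%:E = N%:E.
Proof.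
by rewrite fineK// ge0_fin_numE; [exact: u2.2|apply: integral_ge0 => x _; rewrite lee_fin dens_ge0].
Qed.
Let N0 : (0 <= N)%R.
Proof. by apply: fine_ge0; apply: integral_ge0 => x _; rewrite lee_fin dens_ge0. Qed.

Lemma trunc_normc_ge0 r x : (0 <= trunc3 r n x)%R.
Proof. by rewrite /trunc3; case: ifP => _ //; exact: normc_ge0. Qed.

Let trunc_fin2 r : \int[mu3]_x (trunc3 r n x ^+ 2)%:E <= N%:E.
Proof.
have mt := measurable_trunc3 r measurable_normc.
rewrite -NE; apply: le_integral_EFin.
- by move=> x; exact: sqr_ge0.
- by mfun.
- exact: (measurable_dens u2.1).
- by move=> x; rewrite /trunc3 /dens; case: ifP => _ //; rewrite expr0n/= sqr_ge0.
Qed.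

Lemma trunc_normc_fin r : (0 <= r)%R -> \int[mu3]_x (trunc3 r n x)%:E < +oo.
Proof.
move=> r0; have mt := measurable_trunc3 r measurable_normc.
have md := measurable_dens u2.1.
apply: (@le_lt_trans _ _ (\int[mu3]_x ((inball (r ^+ 2) x)%:E + (dens u x)%:E))).
  apply: ge0_le_integral => //.
  - by move=> x _; rewrite lee_fin trunc_normc_ge0.
  - by mfun.
  - by apply: emeasurable_funD; mfun.
  move=> x _; rewrite -EFinD lee_fin /trunc3 /inball norm3_le_nsq//.
  case: ifP => _; last by rewrite add0r sqr_ge0.
  by rewrite /dens -/(n x); have := sqr_ge0 (n x - 1); have := normc_ge0 (u x); rewrite -/(n x); nra.
rewrite ge0_integralD//.
- by rewrite lte_add_pinfty ?inball_fin//; exact: u2.2.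
- by move=> x _; rewrite lee_fin inball_ge0.
- by mfun.
- by move=> x _; rewrite lee_fin dens_ge0.
- by mfun.
Qed.

Let T := fine (\int[mu3]_xi (Num.sqrt (1 + norm3 xi ^+ 2) * dens g xi)%:E).
Let weight_ge0 xi : (0 <= Num.sqrt (1 + norm3 xi ^+ 2) * dens g xi)%R.
Proof. by rewrite mulr_ge0 ?sqrtr_ge0 ?dens_ge0. Qed.
Let T0 : (0 <= T)%R.
Proof. by apply: fine_ge0; apply: integral_ge0 => x _; rewrite lee_fin. Qed.
Let TE : \int[mu3]_xi (Num.sqrt (1 + norm3 xi ^+ 2) * dens g xi)%:E = T%:E.
Proof. by rewrite fineK// ge0_fin_numE//; apply: integral_ge0 => x _; rewrite lee_fin. Qed.

Let err k := \int[mu3]_xi ((normc (g xi - fourier_trunc u k xi) ^+ 2)%:E).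

(** The high frequencies of the truncation are those of the transform [g], up to
    the error of the truncation, and the weight of the Sobolev space controls
    them. *)
Let energy_trunc_le (e : R) (k : nat) : (0 < e)%R ->
  energy e (trunc3 k%:R a) + energy e (trunc3 k%:R b) <=
  (6 * M * e * T)%:E + (2 * M)%:E * err k.
Proof.
move=> e0; have [p [q [mp mq upq]]] := radial_profile u2.1 ru.
pose cut (f : R -> R) (s : R) : R := if (Num.sqrt s <= k%:R)%R then f s else 0%R.
have mcut f : measurable_fun setT f -> measurable_fun setT (cut f).
  move=> mf; apply: measurable_fun_ifT => //; apply: measurable_fun_ler; mfun.
have k0 : (0 <= k%:R :> R)%R by [].
have mta := measurable_trunc3 k%:R ma.
have mtb := measurable_trunc3 k%:R mb.
apply: le_trans; first apply: (energy_le_frequencies mta mtb (measurable_trunc3 k%:R measurable_normc)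
  (mcut _ mp) (mcut _ mq) (trunc_normc_ge0 k%:R) (trunc_normc_sq k%:R) (trunc_normc_fin k0) _ _ _ e0).
- exact: (le_lt_trans (trunc_fin2 _) (ltry _)).
- move: upq; apply: filterS => x [_ ux]; rewrite /trunc3 /cut /norm3 -/(nsq x).
  by rewrite /a ux.
- move: upq; apply: filterS => x [_ ux]; rewrite /trunc3 /cut /norm3 -/(nsq x).
  by rewrite /b ux.
have mft := measurable_ft_sq mta mtb.
have [mft1 mft2] := measurable_ft mta mtb.
have mnorm := @measurable_norm R.
have mexp : measurable_fun setT (fun xi : R3 R => exp3 e xi).
  by apply: measurable_exp3; mfun.
have [[mg1 mg2] _] := ug.1.
have mg := measurable_dens ug.1.1.
have merr : measurable_fun setT (fun xi => (normc (g xi - fourier_trunc u k xi) ^+ 2)%:E).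
  apply: mfun_EFin; apply: (measurable_dens (u := fun xi => (g xi - fourier_trunc u k xi)%R)).
  split.
    rewrite (_ : (fun x => _) = fun xi => complex.Re (g xi) -
      fourier_cst * ft_re (trunc3 k%:R a) (trunc3 k%:R b) xi)%R; first by mfun.
    apply/funext => xi; rewrite fourier_truncE /fourier_of.
    by move: (g xi) fourier_cst (ft_re _ _ _) (ft_im _ _ _) => [z w] kk s t /=; ring.
  rewrite (_ : (fun x => _) = fun xi => complex.Im (g xi) -
      fourier_cst * ft_im (trunc3 k%:R a) (trunc3 k%:R b) xi)%R; first by mfun.
  apply/funext => xi; rewrite fourier_truncE /fourier_of.
  by move: (g xi) fourier_cst (ft_re _ _ _) (ft_im _ _ _) => [z w] kk s t /=; ring.
have -> : (6 * M * e * T)%:E = (6 * M * e)%:E * T%:E by rewrite -EFinM.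
have c1 : (0 <= 6 * M * e)%R by rewrite mulr_ge0 ?ltW// mulr_gt0.
have c2 : (0 <= 2 * M)%R by rewrite mulr_ge0// ltW.
rewrite -TE -ge0_integralZl_fin//; last by mfun.
rewrite /err -ge0_integralZl_fin//; last first.
  by move=> x; rewrite lee_fin sqr_ge0.
rewrite -ge0_integralD//; last 4 first.
- by move=> x _; rewrite mule_ge0// lee_fin.
- by apply: emeasurable_funM => //; mfun.
- by move=> x _; rewrite mule_ge0// lee_fin sqr_ge0.
- exact: emeasurable_funM.
apply: ge0_le_integral => //.
- by move=> x _; rewrite lee_fin mulr_ge0 ?ft_sq_ge0// subr_ge0 exp3_le1.
- by mfun.
- apply: emeasurable_funD; last exact: emeasurable_funM.
  by apply: emeasurable_funM => //; mfun.
move=> xi _; rewrite -[X in _ <= X + _]EFinM -[X in _ <= _ + X]EFinM -EFinD lee_fin.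
have -> : (ft_sq (trunc3 k%:R a) (trunc3 k%:R b) xi = M * dens (fourier_trunc u k) xi)%R.
  rewrite /dens fourier_truncE fourier_of_sq mulrA divff ?mul1r//.
  by rewrite gt_eqF.
have s0 := sqrtr_ge0 (1 + norm3 xi ^+ 2).
have := one_sub_exp3 xi e0; have := exp3_le1 xi e0; have := exp3_ge0 e xi.
move: s0; rewrite !densE normcE2.
move: (g xi) (fourier_trunc u k xi) (Num.sqrt _) (exp3 e xi) => [p1 q1] [p2 q2] s E /=.
move=> s0 E0 E1 Es.
have h1 : (0 <= (1 - E) * ((p2 - 2 * p1) ^+ 2 + (q2 - 2 * q1) ^+ 2))%R.
  by rewrite mulr_ge0 ?subr_ge0// addr_ge0 ?sqr_ge0.
have h2 : (0 <= E * ((p1 - p2) ^+ 2 + (q1 - q2) ^+ 2))%R.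
  by rewrite mulr_ge0// addr_ge0 ?sqr_ge0.
have h3 : (0 <= (p1 ^+ 2 + q1 ^+ 2) * (e * (3 * s) - (1 - E)))%R.
  by rewrite mulr_ge0 ?subr_ge0// addr_ge0 ?sqr_ge0.
rewrite [leLHS](_ : _ = M * ((1 - E) * (p2 ^+ 2 + q2 ^+ 2)))%R; last by ring.
rewrite [leRHS](_ : _ = M * (6 * e * s * (p1 ^+ 2 + q1 ^+ 2) +
  2 * ((p1 - p2) ^+ 2 + (q1 - q2) ^+ 2)))%R; last by ring.
rewrite ler_pM2l//; nra.
Qed.


Let mass S := \int[mu3]_x (inball S x * dens u x)%:E.

Let V := fine (\int[mu3]_x (inball 1 x)%:E).
Let V_ge0 : 0 <= \int[mu3]_x (inball 1 x)%:E.
Proof. by apply: integral_ge0 => x _; rewrite lee_fin inball_ge0. Qed.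
Let VE : \int[mu3]_x (inball 1 x)%:E = V%:E.
Proof. by rewrite fineK// ge0_fin_numE// inball_fin. Qed.
Let V0 : (0 <= V)%R. Proof. exact: fine_ge0. Qed.

(** In the limit of large truncation radii the error term of the transform
    disappears, and the ball of radius [r <= 1] does not see the truncation. *)
Let mass_le (e r : R) : (0 < e)%R -> (0 < r)%R -> (r <= 1)%R ->
  M%:E * mass (r ^+ 2) <=
  (24 * M * e * T + 2 * (2 / e) ^+ 3 * (r ^+ 3 * V * N))%:E.
Proof.
move=> e0 r0 r1.
apply/lee_addgt0Pr => d d0.
have d8 : (0 < d / (8 * M))%R by rewrite divr_gt0// mulr_gt0.
have [K _ HK] := cvge0_lt d8 ug.2.
(* a positive truncation radius, so that it contains the unit ball *)
have {}HK := HK K.+1 (leqnSn K).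
have measurable_normc' := measurable_trunc3 K.+1%:R measurable_normc.
have := ball_mass (r ^+ 2) (measurable_trunc3 K.+1%:R ma) (measurable_trunc3 K.+1%:R mb)
  measurable_normc' (trunc_normc_sq K.+1%:R) e0.
have -> : \int[mu3]_x (inball (r ^+ 2) x * trunc3 K.+1%:R n x ^+ 2)%:E = mass (r ^+ 2).
  apply: eq_integral => x _; rewrite /inball /trunc3; case: ifPn => [xr|_]; last by rewrite !mul0r.
  rewrite ifT// (@norm3_le_nsq K.+1%:R)// (le_trans xr)//.
  by apply: (@le_trans _ _ 1%R); [exact: exprn_ile1 (ltW r0) r1|rewrite exprn_ege1// ler1n].
move=> /le_trans; apply.
rewrite inball_scale// VE.
have en := energy_trunc_le K.+1 e0.
have c0 : (0 <= 2 * (2 / e) ^+ 3)%R by rewrite mulr_ge0// exprn_ge0// divr_ge0// ltW.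
have M8 : (0 < 8 * M)%R by rewrite mulr_gt0.
apply: (@le_trans _ _ (4%:E * ((6 * M * e * T)%:E + (2 * M)%:E * (d / (8 * M))%:E) +
    (2 * (2 / e) ^+ 3)%:E * ((r ^+ 3)%:E * V%:E * N%:E))).
  apply: leeD; apply: lee_wpmul2l => //; last first.
    by apply: lee_wpmul2l => //; rewrite -EFinM lee_fin mulr_ge0// exprn_ge0// ltW.
  apply: (le_trans en); apply: leeD2l; apply: lee_wpmul2l; last exact: ltW.
  by rewrite lee_fin mulr_ge0// ltW.
change ((4 * (6 * M * e * T + 2 * M * (d / (8 * M))) +
  2 * (2 / e) ^+ 3 * (r ^+ 3 * V * N))%:E <=
  (24 * M * e * T + 2 * (2 / e) ^+ 3 * (r ^+ 3 * V * N) + d)%:E).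
rewrite lee_fin.
rewrite [leLHS](_ : _ = 24 * M * e * T + d + 2 * (2 / e) ^+ 3 * (r ^+ 3 * V * N))%R.
  by rewrite addrAC.
rewrite mulrDr; congr (_ + _ + _)%R; first by ring.
by move: M0; clearbody M => M0'; field; rewrite gt_eqF.
Qed.

Let C : R := ((24 * M * T + 16 * V * N) / M)%R.
Let C0 : (0 <= C)%R.
Proof.
have M1 : (0 <= M)%R by exact: ltW.
by apply: divr_ge0 => //; apply: addr_ge0; (do 2 apply: mulr_ge0 => //).
Qed.

(** Radii [16 ^- j] and scales [8 ^- j] balance the two contributions: the mass
    of the ball of radius [r] is of order [r `^ (3 / 4)]. *)
Let mass_decay (j : nat) : mass ((16^-1 ^+ j) ^+ 2) <= (C * 8^-1 ^+ j)%:E.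
Proof.
have i16 : (0 < 16^-1 ^+ j :> R)%R by rewrite exprn_gt0.
have i8 : (0 < 8^-1 ^+ j :> R)%R by rewrite exprn_gt0.
have i16' : (16^-1 ^+ j <= 1 :> R)%R by rewrite exprn_ile1// invf_le1// ler1n.
rewrite -(@lee_pmul2l _ M%:E)// ?lte_fin//.
apply: (le_trans (mass_le i8 i16 i16')).
rewrite -EFinM lee_fin.
have re : ((2 / 8^-1 ^+ j) ^+ 3 * (16^-1 ^+ j) ^+ 3 = 8 * 8^-1 ^+ j :> R)%R.
  rewrite -exprMn mulrAC -mulrA -expr_div_n exprMn exprAC.
  by congr (_ * _)%R; [ring|congr (_ ^+ _)%R; field].
rewrite [leLHS](_ : _ = 24 * M * T * 8^-1 ^+ j +
    2 * V * N * ((2 / 8^-1 ^+ j) ^+ 3 * (16^-1 ^+ j) ^+ 3))%R; last by ring.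
rewrite re /C.
move: (8^-1 ^+ j)%R => z; rewrite [leRHS](_ : _ = (24 * M * T + 16 * V * N) * z)%R; last first.
  by move: M0; clearbody M => M0'; field; rewrite gt_eqF.
by rewrite le_eqVlt; apply/orP; left; apply/eqP; ring.
Qed.

Let W (x : R3 R) : R := (Num.sqrt (norm3 x))^-1%R.
Let W0 x : (0 <= W x)%R. Proof. by rewrite invr_ge0 sqrtr_ge0. Qed.

Let shell (j : nat) (x : R3 R) : \bar R :=
  ((4 ^+ j.+1) * (inball ((16^-1 ^+ j) ^+ 2) x * dens u x))%:E.
Let shell_ge0 j x : 0 <= shell j x.
Proof. by rewrite lee_fin mulr_ge0// ?exprn_ge0// mulr_ge0 ?inball_ge0 ?dens_ge0. Qed.

Let dyadic (x : R3 R) : (norm3 x <= 1)%R -> (0 < norm3 x)%R ->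
  exists j, (norm3 x <= 16^-1 ^+ j /\ 16^-1 ^+ j.+1 < norm3 x)%R.
Proof.
move=> x1 x0.
have ex : exists j, (16^-1 ^+ j.+1 < norm3 x)%R.
  have z1 : (`|16^-1 : R| < 1)%R by rewrite gtr0_norm// invf_lt1// ltr1n.
  have /cvgr0Pnorm_lt/(_ _ x0)[K _ /(_ K.+1 (leqnSn K))/= h] := cvg_expr z1.
  by exists K; move: h; rewrite ger0_norm// exprn_ge0.
case: (ex_minnP ex) => j jx jmin; exists j; split => //.
case: j jx jmin => [|j] jx jmin; first by rewrite expr0.
by rewrite leNgt; apply/negP => /jmin; rewrite ltnn.
Qed.

(** Dyadic decomposition of the weight near the origin: the weight is at most
    [4 ^ (j + 1)] between the radii [16 ^- (j + 1)] and [16 ^- j]. *)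
Let weight_le x : (dens u x * W x)%:E <= (dens u x)%:E + \sum_(j <oo) shell j x.
Proof.
have s0 : 0 <= \sum_(j <oo) shell j x by exact: nneseries_ge0.
have := norm3_ge0 x; rewrite le_eqVlt => /orP[/eqP x0|x0].
  by rewrite /W -x0 sqrtr0 invr0 mulr0 adde_ge0// lee_fin dens_ge0.
have sx0 : (0 < Num.sqrt (norm3 x))%R by rewrite sqrtr_gt0.
have [x1|x1] := leP (norm3 x) 1%R; last first.
  apply: (@le_trans _ _ (dens u x)%:E); last by rewrite leeDl.
  rewrite lee_fin ler_piMr ?dens_ge0// invf_le1//.
  by rewrite -[leLHS]sqrtr1 ler_wsqrtr// ltW.
have [j [xj jx]] := dyadic x1 x0.
apply: (@le_trans _ _ (\sum_(j <oo) shell j x)); last by rewrite leeDr// lee_fin dens_ge0.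
apply: (@le_trans _ _ (\sum_(0 <= i < j.+1) shell i x)); last first.
  exact: nneseries_lim_ge.
rewrite big_nat_recr//=; apply: (@le_trans _ _ (shell j x)); last first.
  by rewrite leeDr// sume_ge0.
rewrite lee_fin /inball -norm3_le_nsq ?exprn_ge0// xj mul1r mulrC ler_wpM2r ?dens_ge0//.
rewrite /W -[leRHS]invrK lef_pV2 ?posrE// ?invr_gt0 ?exprn_gt0//.
rewrite -(ler_pXn2r (n := 2)) ?nnegrE ?invr_ge0 ?exprn_ge0 ?sqrtr_ge0//.
rewrite sqr_sqrtr ?norm3_ge0// (le_trans _ (ltW jx))//.
rewrite -exprVn -exprM mulnC exprM.
by rewrite le_eqVlt; apply/orP; left; apply/eqP; congr (_ ^+ _)%R; field.
Qed.

(** The masses of the dyadic balls decay like [8 ^- j], faster than the weights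
    [4 ^ j] grow. *)
Lemma weighted_mass_fin : \int[mu3]_x (dens u x * (Num.sqrt (norm3 x))^-1)%:E < +oo.
Proof.
have md := measurable_dens u2.1.
have mnorm := @measurable_norm R.
have msh j : measurable_fun setT (shell j) by rewrite /shell; mfun.
apply: (@le_lt_trans _ _ (\int[mu3]_x ((dens u x)%:E + \sum_(j <oo) shell j x))).
  apply: ge0_le_integral => //.
  - by move=> x _; rewrite lee_fin mulr_ge0 ?dens_ge0// W0.
  - by mfun.
  - apply: emeasurable_funD; first by mfun.
    exact: ge0_emeasurable_sum.
rewrite ge0_integralD//; last 4 first.
- by move=> x _; rewrite lee_fin dens_ge0.
- by mfun.
- by move=> x _; exact: nneseries_ge0.
- exact: ge0_emeasurable_sum.
apply: lte_add_pinfty; first exact: u2.2.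
rewrite integral_nneseries//.
(* [4 ^ (j + 1) * C * 8 ^- j = 8 * C / 2 ^ (j + 1)] *)
apply: (@le_lt_trans _ _ (\sum_(j <oo) (8 * C / (2 ^ j.+1)%:R)%:E)); last first.
  by apply: le_lt_trans (epsilon_trick0 _ _) (ltry _); rewrite mulr_ge0.
apply: lee_nneseries => [j _ _|j _]; first by apply: integral_ge0.
rewrite /shell; under eq_integral do rewrite EFinM.
rewrite ge0_integralZl_fin; last 3 first.
- by rewrite exprn_ge0.
- by mfun.
- by move=> x; rewrite lee_fin mulr_ge0 ?inball_ge0 ?dens_ge0.
apply: (@le_trans _ _ ((4 ^+ j.+1)%:E * (C * 8^-1 ^+ j)%:E)).
  by apply: lee_wpmul2l; [rewrite lee_fin exprn_ge0|exact: mass_decay].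
rewrite -EFinM lee_fin natrX.
rewrite le_eqVlt; apply/orP; left; apply/eqP.
have h : (4 ^+ j.+1 * 8^-1 ^+ j = 8 / 2 ^+ j.+1 :> R)%R.
  rewrite !exprS invfM -exprVn mulrAC -mulrA -exprMn.
  rewrite (_ : 8^-1 * 4 = 2^-1 :> R)%R; last by field.
  by rewrite mulrA; congr (_ * _)%R; field.
by rewrite mulrCA h; ring.
Qed.

End mass_decay.

(** * The potential of a radial density *)

Section potential.
Context {R : realType}.
Notation mu3 := (@leb3 R).
Local Open Scope ereal_scope.

Lemma ae_coord_neq0 : {ae mu3, forall x : R3 R, x.1.1 != 0%R :> R}.
Proof.
have mz : measurable ([set 0%R] : set (measurableTypeR R)).
  by exact: (@measurable_set1 R 0%R).
exists ([set 0%R] `*` setT `*` setT); split.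
- by apply: measurableX => //; exact: measurableX.
- change (leb3 (([set 0%R] `*` setT `*` setT) : set (R3 R)) = 0).
  have z2 : leb2 (([set 0%R] `*` setT) : set (measurableTypeR R * measurableTypeR R)) = 0.
    rewrite /leb2 product_measure1E//; apply: (etrans (congr1 (mule^~ _) _) (mul0e _)).
    exact: (@lebesgue_measure_set1 R).
  rewrite /leb3 product_measure1E//; last exact: measurableX.
  exact: (etrans (congr1 (mule^~ _) z2) (mul0e _)).
- by move=> x /= /negP; rewrite negbK => /eqP ->.
Qed.

Lemma norm3_gt0 (x : R3 R) : x.1.1 != 0%R :> R -> (0 < norm3 x)%R.
Proof.
move=> x0; rewrite sqrtr_gt0 /dot3 -!expr2 -addrA ltr_wpDr ?addr_ge0 ?sqr_ge0//.
by rewrite lt_neqAle sqr_ge0 andbT eq_sym sqrf_eq0.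
Qed.

(** The interaction of two uniformly charged spheres centred at the origin, by
    Newton's theorem. *)
Definition invmax (x y : R3 R) : R := (Num.max (norm3 x) (norm3 y))^-1%R.

Lemma invmax_ge0 x y : (0 <= invmax x y)%R.
Proof. by rewrite invr_ge0 le_max norm3_ge0. Qed.

Lemma invmaxC x y : invmax x y = invmax y x.
Proof. by rewrite /invmax maxC. Qed.

Lemma measurable_invmax d (T : measurableType d) (f g : T -> R3 R) :
  measurable_fun setT f -> measurable_fun setT g ->
  measurable_fun setT (fun t => invmax (f t) (g t)).
Proof.
move=> mf mg; apply: mfunV; apply: measurable_maxr.
  exact: (measurableT_comp (@measurable_norm R)).
exact: (measurableT_comp (@measurable_norm R)).
Qed.

Lemma invmax_scale (l : R) x y : (0 < l)%R ->
  invmax (scale3 l x) (scale3 l y) = (l^-1 * invmax x y)%R.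
Proof.
by move=> l0; rewrite /invmax !(norm3_scale _ (ltW l0)) -maxr_pMr ?(ltW l0)// invfM.
Qed.

Lemma invmax_le (x y z : R3 R) : (0 < norm3 x)%R -> (norm3 x <= norm3 z)%R ->
  (invmax z y <= invmax x y)%R.
Proof.
move=> x0 xz; rewrite lef_pV2 ?posrE ?lt_max ?x0 ?(lt_le_trans x0 xz)//.
by rewrite ge_max !le_max xz lexx orbT.
Qed.

Section density.
Variable rho : R3 R -> R.
Hypothesis mrho : measurable_fun setT rho.
Hypothesis rho_ge0 : forall x, (0 <= rho x)%R.
Hypothesis rho_fin : \int[mu3]_x (rho x)%:E < +oo.

Let pot (x : R3 R) : \bar R := \int[mu3]_y (rho y * invmax x y)%:E.

(** Taking [fine] gives the junk value zero where the integral diverges, which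
    can happen at the origin only. *)
Definition potential (x : R3 R) : R := fine (pot x).
Let V := potential.

Let integrand_ge0 x y : 0 <= (rho y * invmax x y)%:E.
Proof. by rewrite lee_fin mulr_ge0 ?invmax_ge0. Qed.

Let mintegrand : measurable_fun setT (fun z : R3 R * R3 R => (rho z.2 * invmax z.1 z.2)%:E).
Proof.
by apply: mfun_EFin; apply: measurable_funM; [mfun|apply: measurable_invmax; mfun].
Qed.

Let mslice x : measurable_fun setT (fun y => (rho y * invmax x y)%:E).
Proof. exact: (measurableT_comp mintegrand (pair1_measurable x)). Qed.

Let pot_ge0 x : 0 <= pot x. Proof. exact: integral_ge0. Qed.

Let mpot : measurable_fun setT pot.
Proof. exact: (mfun_int2 mu3 (f := fun x y => (rho y * invmax x y)%:E)). Qed.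

Lemma potential_ge0 x : (0 <= potential x)%R. Proof. exact: fine_ge0. Qed.

Lemma measurable_potential : measurable_fun setT potential.
Proof. by apply: measurableT_comp. Qed.

Lemma potentialE x : (0 < norm3 x)%R ->
  (potential x)%:E = \int[mu3]_y (rho y * invmax x y)%:E.
Proof.
move=> x0; rewrite /potential fineK// ge0_fin_numE//.
apply: (@le_lt_trans _ _ (\int[mu3]_y ((norm3 x)^-1%:E * (rho y)%:E))).
  apply: ge0_le_integral => //.
  - by apply: emeasurable_funM => //; mfun.
  - move=> y _; rewrite -EFinM lee_fin mulrC ler_wpM2r//.
    by rewrite lef_pV2 ?posrE ?lt_max ?x0// le_max lexx.
rewrite ge0_integralZl_fin//.
- by rewrite lte_mul_pinfty// lee_fin invr_ge0 ltW.
- by rewrite invr_ge0 ltW.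
- by mfun.
Qed.

Let pot_norm x z : norm3 x = norm3 z -> pot x = pot z.
Proof. by move=> xz; rewrite /pot /invmax xz. Qed.

(** The potential decreases along rays, but not faster than the inverse of the
    distance, as the next lemma shows; together they bound its variation under
    a dilation. *)
Lemma potential_scale_le (l : R) x : (1 <= l)%R ->
  (potential (scale3 l x) <= potential x)%R.
Proof.
move=> l1; have l0 : (0 < l)%R by exact: lt_le_trans l1.
have := norm3_ge0 x; rewrite le_eqVlt => /orP[/eqP x0|x0].
  by rewrite /potential (@pot_norm (scale3 l x) x)// norm3_scale ?(ltW l0)// -x0 mulr0.
have lx0 : (0 < norm3 (scale3 l x))%R by rewrite norm3_scale ?(ltW l0)// mulr_gt0.
rewrite -lee_fin !potentialE//; apply: ge0_le_integral => // y _.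
rewrite lee_fin ler_wpM2l// invmax_le//.
by rewrite norm3_scale ?(ltW l0)// ler_peMl// ltW.
Qed.

Lemma potential_scale_ge (l : R) x : (1 <= l)%R ->
  (potential x <= l * potential (scale3 l x))%R.
Proof.
move=> l1; have l0 : (0 < l)%R by exact: lt_le_trans l1.
have := norm3_ge0 x; rewrite le_eqVlt => /orP[/eqP x0|x0].
  rewrite {2}/potential (@pot_norm (scale3 l x) x); last first.
    by rewrite norm3_scale ?(ltW l0)// -x0 mulr0.
  by rewrite ler_peMl// potential_ge0.
have lx0 : (0 < norm3 (scale3 l x))%R by rewrite norm3_scale ?(ltW l0)// mulr_gt0.
rewrite -lee_fin EFinM !potentialE// -ge0_integralZl_fin ?(ltW l0)//.
apply: ge0_le_integral => //; first by apply: emeasurable_funM.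
move=> y _; rewrite -EFinM lee_fin mulrCA ler_wpM2l//.
have -> : (l * invmax (scale3 l x) y = invmax x (scale3 l^-1 y))%R.
  by rewrite -{2}(scale3K (lt0r_neq0 l0) x) invmax_scale ?invr_gt0// invrK.
rewrite invmaxC [leRHS]invmaxC; case: (ltP 0 (norm3 (scale3 l^-1 y)))%R => y0.
  rewrite invmax_le// norm3_scale ?invr_ge0 ?(ltW l0)// ler_piMl ?norm3_ge0//.
  by rewrite invf_le1.
have {y0} : norm3 y = 0%R.
  apply/eqP; rewrite eq_le norm3_ge0 andbT.
  by move: y0; rewrite norm3_scale ?invr_ge0 ?(ltW l0)// pmulr_rle0// invr_gt0.
move=> y0; rewrite /invmax norm3_scale ?invr_ge0 ?(ltW l0)// y0 mulr0.
by [].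
Qed.

Lemma potential_scale_upper (l : R) : (0 < l)%R -> exists2 c, (0 <= c)%R &
  forall x, (potential (scale3 l x) <= c * potential x)%R.
Proof.
move=> l0; have [l1|l1] := leP 1%R l.
  by exists 1%R => // x; rewrite mul1r potential_scale_le.
exists l^-1%R => [|x]; first by rewrite invr_ge0 ltW.
have li : (1 <= l^-1)%R by rewrite invf_ge1// ltW.
have := potential_scale_ge (scale3 l x) li.
by rewrite scale3K// gt_eqF.
Qed.

Let ae_norm_gt0 : {ae mu3, forall x : R3 R, (0 < norm3 x)%R}.
Proof. by apply: filterS ae_coord_neq0 => x; exact: norm3_gt0. Qed.

Let mpair (l : R) : measurable_fun setT (fun z : R3 R * R3 R =>
  (rho z.1 * (rho z.2 * invmax (scale3 l z.1) z.2))%:E).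
Proof.
apply: mfun_EFin; apply: measurable_funM; first by mfun.
apply: measurable_funM; first by mfun.
by apply: measurable_invmax; [apply: measurable_scale3|]; mfun.
Qed.

Let pair_ge0 l x y : 0 <= (rho x * (rho y * invmax (scale3 l x) y))%:E.
Proof. by rewrite lee_fin !mulr_ge0 ?invmax_ge0. Qed.

Let mrhoV (l : R) : measurable_fun setT (fun x => (rho x * potential (scale3 l x))%:E).
Proof.
apply: mfun_EFin; apply: measurable_funM => //.
by apply: (measurableT_comp measurable_potential); apply: measurable_scale3; mfun.
Qed.

Let rhoV_ge0 (l : R) x : 0 <= (rho x * potential (scale3 l x))%:E.
Proof. by rewrite lee_fin mulr_ge0// potential_ge0. Qed.

Let pairE (l : R) : (0 < l)%R ->
  \int[mu3]_x (rho x * potential (scale3 l x))%:E =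
  \int[mu3]_x \int[mu3]_y (rho x * (rho y * invmax (scale3 l x) y))%:E.
Proof.
move=> l0; apply: ge0_ae_eq_integral => //.
- exact: (mfun_int2 mu3 (f := fun x y => (rho x * (rho y * invmax (scale3 l x) y))%:E)).
- by move=> x _; exact: integral_ge0.
apply: filterS ae_norm_gt0 => x x0 _.
rewrite EFinM potentialE; last by rewrite norm3_scale ?ltW// mulr_gt0.
rewrite -ge0_integralZl_fin//.
Qed.

(** Exchanging the two particles turns a dilation of the one into the inverse
    dilation of the other. *)
Lemma potential_dilation (l : R) : (0 < l)%R ->
  \int[mu3]_x (rho x * potential (scale3 l^-1 x))%:E =
  l%:E * \int[mu3]_x (rho x * potential (scale3 l x))%:E.
Proof.
move=> l0; rewrite !pairE ?invr_gt0//.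
rewrite (tonelli_swap mu3 mu3 (mpair l^-1) (pair_ge0 l^-1)).
apply: (etrans _ (ge0_integral2Zl (ltW l0) (mpair l) (pair_ge0 l))).
apply: eq_integral => x _; apply: eq_integral => y _.
rewrite -EFinM; congr EFin.
have -> : invmax (scale3 l^-1 y) x = (l * invmax (scale3 l x) y)%R.
  by rewrite -{1}(scale3K (lt0r_neq0 l0) x) invmax_scale ?invr_gt0// invrK invmaxC.
by ring.
Qed.

(** The maximum of two radii is at least their geometric mean, so that the
    double integral is at most the square of a single one. *)
Lemma interaction_fin : \int[mu3]_x (rho x * (Num.sqrt (norm3 x))^-1)%:E < +oo ->
  \int[mu3]_x (rho x * potential x)%:E < +oo.
Proof.
move=> wfin; pose w x := (rho x * (Num.sqrt (norm3 x))^-1)%R.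
have w0 x : (0 <= w x)%R by rewrite mulr_ge0// invr_ge0 sqrtr_ge0.
have mnorm := @measurable_norm R.
have mw : measurable_fun setT (fun x => (w x)%:E) by rewrite /w; mfun.
pose I := fine (\int[mu3]_x (w x)%:E).
have IE : \int[mu3]_x (w x)%:E = I%:E.
  by rewrite fineK// ge0_fin_numE//; apply: integral_ge0 => x _; rewrite lee_fin.
have I0 : (0 <= I)%R by apply: fine_ge0; apply: integral_ge0 => x _; rewrite lee_fin.
apply: (@le_lt_trans _ _ (\int[mu3]_x (I%:E * (w x)%:E))); last first.
  by rewrite ge0_integralZl_fin ?IE// -EFinM ltry.
apply: ae_ge0_le_integral => //.
- by move=> x _; rewrite lee_fin mulr_ge0// potential_ge0.
- by apply: mfun_EFin; apply: measurable_funM => //; exact: measurable_potential.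
- by move=> x _; rewrite -EFinM lee_fin mulr_ge0.
- by apply: emeasurable_funM.
apply: filterS ae_norm_gt0 => x x0 _.
rewrite EFinM potentialE// -ge0_integralZl_fin// muleC -IE.
rewrite -ge0_integralZl_fin//.
apply: ae_ge0_le_integral => //.
- by move=> y _; rewrite mule_ge0// lee_fin.
- by apply: emeasurable_funM.
- by move=> y _; rewrite mule_ge0// lee_fin.
- by apply: emeasurable_funM.
apply: filterS ae_norm_gt0 => y y0 _.
rewrite -!EFinM lee_fin /w mulrACA -mulrA ler_wpM2l// ler_wpM2l//.
have sx : (0 < Num.sqrt (norm3 x))%R by rewrite sqrtr_gt0.
have sy : (0 < Num.sqrt (norm3 y))%R by rewrite sqrtr_gt0.
rewrite -invfM lef_pV2 ?posrE ?mulr_gt0 ?lt_max ?x0//.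
have := sqr_sqrtr (ltW x0); have := sqr_sqrtr (ltW y0).
move: (Num.sqrt (norm3 x)) (Num.sqrt (norm3 y)) sx sy => a b a0 b0 <- <-.
rewrite le_max; apply/orP; have [ab|ba] := leP a b; [right|left].
  by rewrite expr2 ler_wpM2r// ltW.
by rewrite expr2 ler_wpM2l// ltW.
Qed.

Variable G : R -> R.
Hypothesis mG : measurable_fun setT G.
Hypothesis G_ge0 : forall s, (0 <= G s)%R.
Hypothesis rhoG : {ae mu3, forall x, rho x = G (nsq x)}.

Let msub : measurable_fun setT
  (fun p : R3 R * R3 R => (norm3 ((p.1 : R * R * R) - p.2))^-1)%R.
Proof.
apply: mfunV; rewrite (_ : (fun p => _) = fun p : R3 R * R3 R =>
  Num.sqrt (nsq p.1 - 2 * dot3 p.1 p.2 + nsq p.2)); last first.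
  by apply/funext => p; rewrite norm3B.
have md : measurable_fun setT (fun p : R3 R * R3 R => dot3 p.1 p.2).
  by apply: measurable_dot3; mfun.
have m1 : measurable_fun setT (fun p : R3 R * R3 R => nsq p.1) by apply: measurable_nsq; mfun.
have m2 : measurable_fun setT (fun p : R3 R * R3 R => nsq p.2) by apply: measurable_nsq; mfun.
by mfun.
Qed.

Let coulomb x : x.1.1 != 0%R :> R ->
  \int[mu3]_y (rho y * (norm3 ((x : R * R * R) - y)%R)^-1)%:E = (potential x)%:E.
Proof.
move=> x0; rewrite potentialE ?norm3_gt0//.
have mk : measurable_fun setT (fun y : R3 R => (norm3 ((x : R * R * R) - y))^-1)%R.
  exact: (measurableT_comp msub (pair1_measurable x)).
have mi : measurable_fun setT (fun y : R3 R => invmax x y) by apply: measurable_invmax; mfun.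
have mnsq : measurable_fun setT (@nsq R) by exact: (measurable_nsq (f := id)).
have k0 y : (0 <= (norm3 ((x : R * R * R) - y))^-1)%R by rewrite invr_ge0 norm3_ge0.
transitivity (\int[mu3]_y ((G (nsq y))%:E * ((norm3 ((x : R * R * R) - y)%R)^-1)%:E)).
  apply: ge0_ae_eq_integral => //.
  - by mfun.
  - by apply: emeasurable_funM; mfun.
  - by move=> y _; rewrite lee_fin mulr_ge0.
  - by move=> y _; rewrite mule_ge0// lee_fin.
  - by apply: filterS rhoG => y -> _; rewrite EFinM.
transitivity (\int[mu3]_y ((G (nsq y))%:E * (invmax x y)%:E)).
  by apply: (newton (G := fun s => (G s)%:E)) => //; mfun.
apply: ge0_ae_eq_integral => //.
- by apply: emeasurable_funM; mfun.
- by move=> y _; rewrite mule_ge0// lee_fin ?invmax_ge0.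
- by apply: filterS rhoG => y -> _; rewrite EFinM.
Qed.

(** For a radial charge the double integral of the weak formulation collapses,
    by Newton's theorem, to a single one against the potential. *)
Lemma coulomb_integral (r : R3 R -> R) : measurable_fun setT r ->
  \int[mu3]_x (`|r x| * potential x)%:E < +oo ->
  (\int[(mu3 \x mu3)%E]_p (r p.1 * rho p.2 * (norm3 ((p.1 : R * R * R) - p.2))^-1) =
   \int[mu3]_x (r x * potential x))%R.
Proof.
move=> mr rV; pose f (p : R3 R * R3 R) :=
  (r p.1 * rho p.2 * (norm3 ((p.1 : R * R * R) - p.2))^-1)%:E.
have mf : measurable_fun setT f by rewrite /f; mfun.
have inner x : x.1.1 != 0%R :> R -> \int[mu3]_y `|f (x, y)| = (`|r x| * potential x)%:E.
  move=> x0; rewrite EFinM -(coulomb x0) -ge0_integralZl_fin//.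
  - apply: eq_integral => y _; rewrite /f/= -EFinM; congr EFin.
    rewrite !normrM [`|rho y|%R]ger0_norm// -mulrA; congr (_ * (_ * _))%R.
    by rewrite ger0_norm ?invr_ge0 ?norm3_ge0.
  - apply: mfun_EFin; apply: measurable_funM => //.
    exact: (measurableT_comp msub (pair1_measurable x)).
  - by move=> y; rewrite lee_fin mulr_ge0// invr_ge0 norm3_ge0.
have mV := measurable_potential.
have intf : (mu3 \x mu3)%E.-integrable setT f.
  apply/integrable12ltyP => //; apply: le_lt_trans rV.
  rewrite le_eqVlt; apply/orP; left; apply/eqP.
  apply: ge0_ae_eq_integral => //.
  - apply: (mfun_int2 mu3 (f := fun x y => `|f (x, y)|)) => //.
    by apply: measurableT_comp => //; rewrite (_ : (fun z => _) = f)//; apply/funext => -[].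
  - by mfun.
  - by move=> x _; exact: integral_ge0.
  - by move=> x _; rewrite lee_fin mulr_ge0// potential_ge0.
  - by apply: filterS ae_coord_neq0 => x x0 _; exact: inner.
rewrite /Rintegral; congr fine.
rewrite -[LHS](integral12_prod_meas1 intf).
apply: ae_eq_integral => //.
- exact: (measurable_fubini_F intf).
- by mfun.
apply: filterS ae_coord_neq0 => x x0 _.
pose c (y : R3 R) := (rho y * (norm3 ((x : R * R * R) - y))^-1)%R.
have mc : measurable_fun setT c.
  by apply: measurable_funM => //; exact: (measurableT_comp msub (pair1_measurable x)).
have c0 y : (0 <= c y)%R by rewrite mulr_ge0// invr_ge0 norm3_ge0.
have ic : mu3.-integrable setT (EFin \o c).
  apply/integrableP; split; first exact: mfun_EFin.
  under eq_integral do rewrite /= ger0_norm//.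
  by rewrite coulomb// ltry.
transitivity (\int[mu3]_y ((r x)%:E * (c y)%:E)).
  by apply: eq_integral => y _; rewrite /f/= -EFinM mulrA.
by rewrite (integralZl measurableT ic) coulomb.
Qed.

End density.
End potential.

(** * Dilations *)

Section dilation.
Context {R : realType}.
Notation mu3 := (@leb3 R).
Local Open Scope ereal_scope.

Let M : R := ((2 * pi) ^+ 3)%R.
Let M0 : (0 < M)%R. Proof. by rewrite /M exprn_gt0// mulr_gt0// pi_gt0. Qed.

(** Infinite values are included, so that a dilation can be applied to an
    integral before its convergence is known. *)
Lemma fine_pmulB (k : R) (A B : \bar R) : (0 < k)%R -> 0 <= A -> 0 <= B ->
  fine (k%:E * A - k%:E * B) = (k * fine (A - B))%R.
Proof.
move=> k0; case: A => [a| |]; case: B => [b| |] //= _ _;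
  rewrite ?gt0_muley ?lte_fin//= ?mulr0//.
by rewrite mulrBr.
Qed.

Lemma Rintegral_scale3 (l : R) (f : R3 R -> R) : (0 < l)%R -> measurable_fun setT f ->
  (\int[mu3]_x f (scale3 l x) = l ^- 3 * \int[mu3]_x f x)%R.
Proof.
move=> l0 mf; rewrite /Rintegral [in LHS]integralE [in RHS]integralE.
have mF : measurable_fun setT (EFin \o f) by exact: mfun_EFin.
have -> : \int[mu3]_x (fun x => (f (scale3 l x))%:E)^\+ x =
    (l ^- 3)%:E * \int[mu3]_x (EFin \o f)^\+ x.
  rewrite -leb3_scale//; first by apply: eq_integral => x _; rewrite !funeposE.
  exact: measurable_funepos.
have -> : \int[mu3]_x (fun x => (f (scale3 l x))%:E)^\- x =
    (l ^- 3)%:E * \int[mu3]_x (EFin \o f)^\- x.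
  rewrite -leb3_scale//; first by apply: eq_integral => x _; rewrite !funenegE.
  exact: measurable_funeneg.
apply: fine_pmulB; first by rewrite invr_gt0 exprn_gt0.
- by apply: integral_ge0.
- by apply: integral_ge0.
Qed.

Definition dilate (l : R) (u : R3 R -> R[i]) (x : R3 R) : R[i] := u (scale3 l x).

Lemma cmeasurable_dilate l u : cmeasurable u -> cmeasurable (dilate l u).
Proof.
move=> [m1 m2]; have ms : measurable_fun setT (@scale3 R l) by apply: measurable_scale3; mfun.
by split; [exact: (measurableT_comp m1 ms)|exact: (measurableT_comp m2 ms)].
Qed.

Lemma integral_dens_dilate l u : (0 < l)%R -> cmeasurable u ->
  \int[mu3]_x (dens (dilate l u) x)%:E = (l ^- 3)%:E * \int[mu3]_x (dens u x)%:E.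
Proof.
move=> l0 mu; rewrite -(leb3_scale (f := fun x => (dens u x)%:E))//.
- by apply: mfun_EFin; exact: measurable_dens.
- by move=> x; rewrite lee_fin dens_ge0.
Qed.

Lemma L2_dilate l u : (0 < l)%R -> L2 u -> L2 (dilate l u).
Proof.
move=> l0 [mu iu]; split; first exact: cmeasurable_dilate.
rewrite [X in X < _](integral_dens_dilate l0 mu) lte_mul_pinfty// lee_fin.
by rewrite invr_ge0 exprn_ge0// ltW.
Qed.

Lemma ft_dilate (a b : R3 R -> R) (l : R) xi : (0 < l)%R ->
  measurable_fun setT a -> measurable_fun setT b ->
  (ft_re (fun x => a (scale3 l x)) (fun x => b (scale3 l x)) xi =
    l ^- 3 * ft_re a b (scale3 l^-1 xi))%R /\
  (ft_im (fun x => a (scale3 l x)) (fun x => b (scale3 l x)) xi =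
    l ^- 3 * ft_im a b (scale3 l^-1 xi))%R.
Proof.
move=> l0 ma mb.
have md : measurable_fun setT (fun x : R3 R => dot3 (scale3 l^-1 xi) x).
  by apply: measurable_dot3; mfun.
have dE x : dot3 (scale3 l^-1 xi) (scale3 l x) = dot3 xi x.
  by rewrite /dot3/=; field; rewrite gt_eqF.
rewrite /ft_re /ft_im -!Rintegral_scale3//; last 2 first.
- by mfun.
- by mfun.
by split; apply: eq_Rintegral => x _; rewrite dE.
Qed.

Section transform.
Variables (u g : R3 R -> R[i]) (l : R).
Hypothesis l0 : (0 < l)%R.
Hypothesis u2 : L2 u.
Hypothesis ug : is_fourier u g.

Let a x : R := complex.Re (u x).
Let b x : R := complex.Im (u x).
Let ma : measurable_fun setT a. Proof. by case: u2.1. Qed.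
Let mb : measurable_fun setT b. Proof. by case: u2.1. Qed.
Let n x : R := normc (u x).
Let mn : measurable_fun setT n. Proof. exact: measurable_normc. Qed.

Let ball_transform (r : R) xi : R[i] := fourier_of (trunc3 r a) (trunc3 r b) xi.

Definition dilate_transform (xi : R3 R) : R[i] :=
  ((l ^- 3)%:C%C * g (scale3 l^-1 xi))%R.

Lemma dens_dilate_transform xi :
  (dens dilate_transform xi = (l ^- 3) ^+ 2 * dens g (scale3 l^-1 xi))%R.
Proof.
rewrite !densE /dilate_transform; move: (l ^- 3)%R (g _) => k [z w] /=.
by ring.
Qed.

Lemma L2_dilate_transform : L2 dilate_transform.
Proof.
have [[mg1 mg2] ig] := ug.1.
have ms : measurable_fun setT (@scale3 R l^-1) by apply: measurable_scale3; mfun.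
have m1 := measurableT_comp mg1 ms; have m2 := measurableT_comp mg2 ms.
have li : (0 < l^-1)%R by rewrite invr_gt0.
split.
  split.
    rewrite (_ : (fun x => _) = fun x => l ^- 3 * complex.Re (g (scale3 l^-1 x)))%R.
      by apply: measurable_funM.
    apply/funext => x; rewrite /dilate_transform.
    by move: (l ^- 3)%R (g _) => k [z w] /=; ring.
  rewrite (_ : (fun x => _) = fun x => l ^- 3 * complex.Im (g (scale3 l^-1 x)))%R.
    by apply: measurable_funM.
  apply/funext => x; rewrite /dilate_transform.
  by move: (l ^- 3)%R (g _) => k [z w] /=; ring.
under eq_integral => x _ do rewrite -[(normc _ ^+ 2)%R]/(dens dilate_transform x)
  dens_dilate_transform EFinM.
have md := measurable_dens ug.1.1.
rewrite ge0_integralZl_fin; last 3 first.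
- exact: sqr_ge0.
- by apply: mfun_EFin; exact: (measurableT_comp md ms).
- by move=> x; rewrite lee_fin dens_ge0.
apply: lte_mul_pinfty => //; first by rewrite lee_fin sqr_ge0.
rewrite (leb3_scale (f := fun x => (dens g x)%:E))//.
- apply: lte_mul_pinfty => //; first by rewrite lee_fin invr_ge0 exprn_ge0// ltW.
- by apply: mfun_EFin.
- by move=> x; rewrite lee_fin dens_ge0.
Qed.

Let fourier_trunc_dilate k xi : fourier_trunc (dilate l u) k xi =
  ((l ^- 3)%:C%C * ball_transform (l * k%:R) (scale3 l^-1 xi))%R.
Proof.
rewrite fourier_truncE /ball_transform /fourier_of.
have tr (f : R3 R -> R) : trunc3 k%:R (fun x => f (scale3 l x)) =
    fun x => trunc3 (l * k%:R) f (scale3 l x).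
  apply/funext => x; rewrite /trunc3 norm3_scale ?(ltW l0)//.
  by rewrite ler_pM2l.
rewrite /dilate (tr a) (tr b).
have [-> ->] := ft_dilate xi l0 (measurable_trunc3 (l * k%:R) ma) (measurable_trunc3 (l * k%:R) mb).
move: fourier_cst (ft_re _ _ _) (ft_im _ _ _) (l ^- 3)%R => c s t k'.
by apply/eqP; rewrite eq_complex /=; apply/andP; split; apply/eqP; ring.
Qed.

Let err (r : R) : \bar R := \int[mu3]_xi (dens (fun xi => g xi - ball_transform r xi)%R xi)%:E.

Let mball (r : R) : cmeasurable (ball_transform r).
Proof.
have [m1 m2] := measurable_ft (measurable_trunc3 r ma) (measurable_trunc3 r mb).
split.
  rewrite (_ : (fun x => _) = fun xi => fourier_cst *
      ft_re (trunc3 r a) (trunc3 r b) xi)%R; first by mfun.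
  apply/funext => xi; rewrite /ball_transform /fourier_of.
  by move: fourier_cst (ft_re _ _ _) (ft_im _ _ _) => k s t /=; ring.
rewrite (_ : (fun x => _) = fun xi => fourier_cst *
      ft_im (trunc3 r a) (trunc3 r b) xi)%R; first by mfun.
apply/funext => xi; rewrite /ball_transform /fourier_of.
by move: fourier_cst (ft_re _ _ _) (ft_im _ _ _) => k s t /=; ring.
Qed.

Let csub (f h : R3 R -> R[i]) : cmeasurable f -> cmeasurable h ->
  cmeasurable (fun x => f x - h x)%R.
Proof.
move=> [f1 f2] [h1 h2]; split.
  rewrite (_ : (fun x => _) = fun x => complex.Re (f x) - complex.Re (h x))%R; first by mfun.
  by apply/funext => x; case: (f x) (h x) => [? ?] [? ?].
rewrite (_ : (fun x => _) = fun x => complex.Im (f x) - complex.Im (h x))%R; first by mfun.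
by apply/funext => x; case: (f x) (h x) => [? ?] [? ?].
Qed.

Let err_dilate k :
  \int[mu3]_xi (normc (dilate_transform xi - fourier_trunc (dilate l u) k xi) ^+ 2)%:E =
  (l ^- 3)%:E * err (l * k%:R).
Proof.
have ms : measurable_fun setT (@scale3 R l^-1) by apply: measurable_scale3; mfun.
have li : (0 < l^-1)%R by rewrite invr_gt0.
pose d := dens (fun xi => g xi - ball_transform (l * k%:R) xi)%R.
have md : measurable_fun setT d by apply: measurable_dens; exact: csub ug.1.1 (mball _).
transitivity (\int[mu3]_xi (((l ^- 3) ^+ 2)%:E * (d (scale3 l^-1 xi))%:E)).
  apply: eq_integral => xi _; rewrite fourier_trunc_dilate /dilate_transform /d densE normcE2.
  rewrite -EFinM; congr EFin.
  by move: (l ^- 3)%R (g _) (ball_transform _ _) => c [? ?] [? ?] /=; ring.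
rewrite ge0_integralZl_fin; last 3 first.
- exact: sqr_ge0.
- by apply: mfun_EFin; exact: (measurableT_comp md ms).
- by move=> x; rewrite lee_fin dens_ge0.
rewrite (leb3_scale (f := fun x => (d x)%:E))//; last 2 first.
- exact: mfun_EFin.
- by move=> x; rewrite lee_fin dens_ge0.
have -> : (l^-1 ^- 3 = l ^+ 3)%R by rewrite exprVn invrK.
rewrite muleA -EFinM; congr (_%:E * _).
by rewrite expr2 -mulrA mulVf ?mulr1// expf_neq0// gt_eqF.
Qed.

Let tail (k : nat) : \bar R :=
  \int[mu3]_x (if (norm3 x <= k%:R)%R then 0%R else dens u x)%:E.

Let mdens : measurable_fun setT (dens u). Proof. exact: measurable_dens u2.1. Qed.

Let mnorm := @measurable_norm R.

Let mtail (k : nat) : measurable_fun setT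
  (fun x => if (norm3 x <= k%:R)%R then 0%R else dens u x).
Proof. by apply: measurable_fun_ifT => //; mfun. Qed.

Let tail_cvg0 : tail k @[k --> \oo] --> 0.
Proof.
apply: (cvg_integral0 (g := dens u)) => //.
- by move=> k x; case: ifP => _; rewrite ?lexx ?dens_ge0.
- exact: u2.2.
move=> x; apply: cvg_near_cst; exists (Num.truncn (norm3 x)).+1 => // k /= xk.
rewrite ifT//; apply: (le_trans (ltW (truncnS_gt _))).
by rewrite ler_nat.
Qed.

Let itrunc r (f : R3 R -> R) : (0 <= r)%R -> measurable_fun setT f ->
  (forall x, `|f x| <= n x)%R -> mu3.-integrable setT (EFin \o trunc3 r f).
Proof.
move=> r0 mf fn; have mt := measurable_trunc3 r mf.
apply/integrableP; split; first exact: mfun_EFin.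
apply: le_lt_trans (trunc_normc_fin u2 r0).
apply: (le_integral_EFin mu3 (f := fun x => `|trunc3 r f x|%R)) => //; first by mfun.
- exact: measurable_trunc3.
- by move=> x; rewrite /trunc3; case: ifP => _ //; rewrite normr0.
Qed.

Let an x : (`|a x| <= n x)%R.
Proof.
rewrite -(ler_pXn2r (n := 2)) ?nnegrE ?normc_ge0//.
by rewrite real_normK ?num_real// normcE2 lerDl sqr_ge0.
Qed.

Let bn x : (`|b x| <= n x)%R.
Proof.
rewrite -(ler_pXn2r (n := 2)) ?nnegrE ?normc_ge0//.
by rewrite real_normK ?num_real// normcE2 lerDr sqr_ge0.
Qed.

Let imul (f c : R3 R -> R) : mu3.-integrable setT (EFin \o f) ->
  measurable_fun setT c -> (forall x, `|c x| <= 1)%R ->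
  mu3.-integrable setT (EFin \o (fun x => f x * c x)%R).
Proof.
move=> fi mc c1; have mf := measurable_int _ fi.
have {}mf : measurable_fun setT f by apply/measurable_EFinP.
apply: le_integrable fi => //.
- by apply: mfun_EFin; mfun.
- by move=> x _ /=; rewrite lee_fin normrM ler_piMr.
Qed.

(** Truncating at two radii differs by the transform of what lies between. *)
Let ball_transformB (r s : R) xi : (0 <= r)%R -> (0 <= s)%R ->
  (ball_transform s xi - ball_transform r xi = fourier_of
    (fun x => trunc3 s a x - trunc3 r a x) (fun x => trunc3 s b x - trunc3 r b x) xi)%R.
Proof.
move=> r0 s0.
have mc : measurable_fun setT (fun x => cos (dot3 xi x)).
  by apply: (mfun_comp measurable_cos); apply: measurable_dot3; mfun.
have ms : measurable_fun setT (fun x => sin (dot3 xi x)).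
  by apply: (mfun_comp measurable_sin); apply: measurable_dot3; mfun.
have c1 x : (`|cos (dot3 xi x)| <= 1)%R by rewrite ler_norml cos_geN1 cos_le1.
have s1 x : (`|sin (dot3 xi x)| <= 1)%R by rewrite ler_norml sin_geN1 sin_le1.
have iA t : (0 <= t)%R -> mu3.-integrable setT (EFin \o trunc3 t a).
  by move=> t0; exact: itrunc.
have iB t : (0 <= t)%R -> mu3.-integrable setT (EFin \o trunc3 t b).
  by move=> t0; exact: itrunc.
have re : (ft_re (fun x => trunc3 s a x - trunc3 r a x) (fun x => trunc3 s b x - trunc3 r b x) xi =
    ft_re (trunc3 s a) (trunc3 s b) xi - ft_re (trunc3 r a) (trunc3 r b) xi)%R.
  rewrite /ft_re -RintegralB//.
  - by apply: eq_Rintegral => x _; ring.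
  - by apply: (integrableD measurableT (f := EFin \o _) (g := EFin \o _)) => //;
      apply: imul => //; [exact: iA|exact: iB].
  - by apply: (integrableD measurableT (f := EFin \o _) (g := EFin \o _)) => //;
      apply: imul => //; [exact: iA|exact: iB].
have im : (ft_im (fun x => trunc3 s a x - trunc3 r a x) (fun x => trunc3 s b x - trunc3 r b x) xi =
    ft_im (trunc3 s a) (trunc3 s b) xi - ft_im (trunc3 r a) (trunc3 r b) xi)%R.
  rewrite /ft_im -RintegralB//.
  - by apply: eq_Rintegral => x _; ring.
  - by apply: (integrableB measurableT (f := EFin \o _) (g := EFin \o _)) => //;
      apply: imul => //; [exact: iB|exact: iA].
  - by apply: (integrableB measurableT (f := EFin \o _) (g := EFin \o _)) => //;
      apply: imul => //; [exact: iB|exact: iA].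
rewrite /ball_transform /fourier_of re im.
move: fourier_cst (ft_re _ _ _) (ft_im _ _ _) (ft_re _ _ _) (ft_im _ _ _) => c p1 p2 p3 p4.
by apply/eqP; rewrite eq_complex /=; apply/andP; split; apply/eqP; ring.
Qed.

(** By Bessel's inequality, the transform of what lies between two radii is
    small when the mass outside of the smaller one is. *)
Let shell_transform_le (k : nat) (r : R) : (k%:R <= r)%R ->
  \int[mu3]_xi (dens (fun xi => ball_transform r xi - ball_transform k%:R xi)%R xi)%:E <= tail k.
Proof.
move=> kr; have k0 : (0 <= k%:R :> R)%R by [].
have r0 := le_trans k0 kr.
pose A x := (trunc3 r a x - trunc3 k%:R a x)%R.
pose B x := (trunc3 r b x - trunc3 k%:R b x)%R.
pose S x := (trunc3 r n x - trunc3 k%:R n x)%R.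
have mA : measurable_fun setT A by apply: measurable_funB; exact: measurable_trunc3.
have mB : measurable_fun setT B by apply: measurable_funB; exact: measurable_trunc3.
have mS : measurable_fun setT S by apply: measurable_funB; exact: measurable_trunc3.
have cases x : (A x, B x, S x) = (a x, b x, n x) /\ (norm3 x <= k%:R)%R = false \/
    (A x, B x, S x) = (0%R, 0%R, 0%R).
  rewrite /A /B /S /trunc3; case: ifPn => xr; case: ifPn => xk; rewrite ?subrr ?subr0.
  - by right.
  - by left.
  - by rewrite (le_trans xk kr) in xr.
  - by right.
have S0 x : (0 <= S x)%R.
  by case: (cases x) => [[[_ _ ->] _]|[_ _ ->]]//; exact: normc_ge0.
have SE x : (S x ^+ 2 = A x ^+ 2 + B x ^+ 2)%R.
  case: (cases x) => [[[-> -> ->] _]|[-> -> ->]]; first exact: normcE2.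
  by rewrite expr0n/= addr0.
have mft := measurable_ft_sq mA mB.
have Sfin : \int[mu3]_x (S x)%:E < +oo.
  apply: le_lt_trans (trunc_normc_fin u2 r0); apply: le_integral_EFin => //.
    exact: measurable_trunc3.
  by move=> x; rewrite gerBl trunc_normc_ge0.
apply: (@le_trans _ _ (M^-1%:E * \int[mu3]_xi (ft_sq A B xi)%:E)).
  rewrite -ge0_integralZl_fin; last 3 first.
  - by rewrite invr_ge0 ltW.
  - by mfun.
  - by move=> x; rewrite lee_fin ft_sq_ge0.
  rewrite le_eqVlt; apply/orP; left; apply/eqP; apply: eq_integral => xi _.
  by rewrite /dens ball_transformB// fourier_of_sq.
apply: (@le_trans _ _ (M^-1%:E * (M%:E * \int[mu3]_x (S x ^+ 2)%:E))).
  by apply: lee_wpmul2l; [rewrite lee_fin invr_ge0 ltW|exact: bessel].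
rewrite muleA -EFinM mulVf ?gt_eqF// mul1e.
apply: le_integral_EFin => //.
- by move=> x; exact: sqr_ge0.
- by mfun.
- by move=> x; case: (cases x) => [[[_ _ ->] ->]|[_ _ ->]]//; rewrite expr0n/=; case: ifP => // _; exact: dens_ge0.
Qed.

Let err_le (r : R) : (0 <= r)%R ->
  err r <= 2%:E * err (Num.truncn r)%:R + 2%:E * tail (Num.truncn r).
Proof.
move=> r0; have kr : ((Num.truncn r)%:R <= r)%R by rewrite truncn_le.
move: (Num.truncn r) kr => k kr.
have mg := ug.1.1.
have m1 := measurable_dens (csub mg (mball r)).
have m2 := measurable_dens (csub mg (mball k%:R)).
have m3 := measurable_dens (csub (mball r) (mball k%:R)).
apply: (@le_trans _ _ (2%:E * err k%:R + 2%:E *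
  \int[mu3]_xi (dens (fun xi => ball_transform r xi - ball_transform k%:R xi)%R xi)%:E)); last first.
  by apply: leeD2l; apply: lee_wpmul2l => //; exact: shell_transform_le.
rewrite /err -!ge0_integralZl_fin//; last 4 first.
- exact: mfun_EFin.
- by move=> x; rewrite lee_fin dens_ge0.
- exact: mfun_EFin.
- by move=> x; rewrite lee_fin dens_ge0.
rewrite -ge0_integralD//; last 4 first.
- by move=> x _; rewrite mule_ge0// lee_fin dens_ge0.
- by apply: emeasurable_funM => //; exact: mfun_EFin.
- by move=> x _; rewrite mule_ge0// lee_fin dens_ge0.
- by apply: emeasurable_funM => //; exact: mfun_EFin.
apply: ge0_le_integral => //.
- by move=> x _; rewrite lee_fin dens_ge0.
- exact: mfun_EFin.
- by apply: emeasurable_funD; apply: emeasurable_funM => //; exact: mfun_EFin.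
move=> xi _; rewrite -[X in _ <= X + _]EFinM -[X in _ <= _ + X]EFinM -EFinD lee_fin !densE.
move: (g xi) (ball_transform r xi) (ball_transform k%:R xi) => [p1 q1] [p2 q2] [p3 q3] /=.
have := sqr_ge0 (p1 - p3 + (p2 - p3)); have := sqr_ge0 (q1 - q3 + (q2 - q3)).
nra.
Qed.

(** The dilated function truncated at an integer radius [k] is a dilation of [u]
    truncated at [l * k], which need not be an integer: the truncation at the
    integer part of [l * k] is compared with it by means of the shell between
    the two. *)
Lemma is_fourier_dilate : is_fourier (dilate l u) dilate_transform.
Proof.
split; first exact: L2_dilate_transform.
pose m (k : nat) := Num.truncn (l * k%:R)%R.
have m_oo : m @ \oo --> \oo.
  apply/cvgnyPge => K; near=> k.
  rewrite /m truncn_ge_nat ?mulr_ge0 ?(ltW l0)//.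
  rewrite mulrC -ler_pdivrMr//; near: k; exact: nbhs_infty_ger.
have c0 : 2%:E * err k%:R + 2%:E * tail k @[k --> \oo] --> 0.
  rewrite -[X in _ --> X](adde0 0); apply: cvgeD => //.
    rewrite -[X in _ --> X](mule0 2%:E); apply: cvgeZl => //.
    rewrite (_ : (fun k : nat => err k%:R) = fun k : nat =>
      \int[mu3]_xi ((normc (g xi - fourier_trunc u k xi) ^+ 2)%:E)); first exact: ug.2.
    apply/funext => k; apply: eq_integral => xi _.
    by rewrite fourier_truncE.
  by rewrite -[X in _ --> X](mule0 2%:E); apply: cvgeZl.
have li : 0 <= (l ^- 3)%:E by rewrite lee_fin invr_ge0 exprn_ge0// ltW.
apply: (@squeeze_cvge _ _ _ _ (cst 0) _
  (fun k => (l ^- 3)%:E * (2%:E * err (m k)%:R + 2%:E * tail (m k)))).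
- near=> k; apply/andP; split.
    by apply: integral_ge0 => x _; rewrite lee_fin sqr_ge0.
  by rewrite err_dilate; apply: lee_wpmul2l => //; apply: err_le; rewrite mulr_ge0// ltW.
- exact: cvg_cst.
- rewrite -[X in _ --> X](mule0 (l ^- 3)%:E); apply: cvgeZl => //.
  exact: (cvg_comp m (fun k : nat => 2%:E * err k%:R + 2%:E * tail k) m_oo c0).
Unshelve. all: by end_near. Qed.

Lemma sobolev_dilate_transform :
  \int[mu3]_xi (Num.sqrt (1 + norm3 xi ^+ 2) * dens g xi)%:E < +oo ->
  \int[mu3]_xi (Num.sqrt (1 + norm3 xi ^+ 2) * dens dilate_transform xi)%:E < +oo.
Proof.
move=> gfin; have mg := measurable_dens ug.1.1.
have li : (0 < l^-1)%R by rewrite invr_gt0.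
pose F xi := (Num.sqrt (1 + norm3 (scale3 l xi) ^+ 2) * ((l ^- 3) ^+ 2 * dens g xi))%R.
have mF : measurable_fun setT F.
  apply: measurable_funM; last by mfun.
  apply: (mfun_comp measurable_sqrtr); apply: measurable_funD => //.
  apply: measurable_funX; apply: (measurableT_comp mnorm).
  by apply: measurable_scale3; mfun.
have F0 xi : (0 <= F xi)%R.
  apply: mulr_ge0; first exact: sqrtr_ge0.
  by apply: mulr_ge0; [exact: sqr_ge0|exact: dens_ge0].
rewrite (_ : \int[mu3]_xi _ = \int[mu3]_xi (F (scale3 l^-1 xi))%:E); last first.
  apply: eq_integral => xi _; rewrite dens_dilate_transform /F.
  by rewrite scale3VK// gt_eqF.
rewrite (leb3_scale (f := fun xi => (F xi)%:E))//; last by mfun.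
apply: lte_mul_pinfty => //; first by rewrite lee_fin invr_ge0 exprn_ge0// ltW.
pose c := (Num.sqrt (1 + l ^+ 2) * (l ^- 3) ^+ 2)%R.
have c0 : (0 <= c)%R by apply: mulr_ge0; [exact: sqrtr_ge0|exact: sqr_ge0].
apply: (@le_lt_trans _ _ (\int[mu3]_xi (c * (Num.sqrt (1 + norm3 xi ^+ 2) * dens g xi))%:E)).
  apply: le_integral_EFin => //; first by mfun.
  move=> xi; rewrite [leRHS](_ : _ = Num.sqrt (1 + l ^+ 2) * Num.sqrt (1 + norm3 xi ^+ 2) *
    ((l ^- 3) ^+ 2 * dens g xi))%R; last by rewrite /c mulrACA.
  apply: ler_wpM2r; first by apply: mulr_ge0; [exact: sqr_ge0|exact: dens_ge0].
  rewrite -sqrtrM ?addr_ge0 ?sqr_ge0//; apply: ler_wsqrtr.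
  rewrite norm3_scale ?(ltW l0)// exprMn.
  by have := sqr_ge0 (norm3 xi); have := sqr_ge0 l; nra.
under eq_integral do rewrite EFinM.
rewrite ge0_integralZl_fin//.
- by rewrite lte_mul_pinfty.
- by mfun.
- by move=> x; rewrite lee_fin mulr_ge0 ?sqrtr_ge0 ?dens_ge0.
Qed.

End transform.

Lemma sobolev_half_dilate (u g : R3 R -> R[i]) (l : R) : (0 < l)%R -> L2 u ->
  is_fourier u g ->
  \int[mu3]_xi (Num.sqrt (1 + norm3 xi ^+ 2) * dens g xi)%:E < +oo ->
  sobolev_half (dilate l u).
Proof.
move=> l0 u2 ug gfin; split; first exact: L2_dilate.
exists (dilate_transform g l); first exact: is_fourier_dilate.
exact: (sobolev_dilate_transform l0 ug gfin).
Qed.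

End dilation.

(** * The virial identity *)

Section virial.
Context {R : realType}.
Notation mu3 := (@leb3 R).
Local Open Scope ereal_scope.

Lemma Rintegral_posZl (c : R) (f : R3 R -> R) : (0 < c)%R -> measurable_fun setT f ->
  (\int[mu3]_x (c * f x) = c * \int[mu3]_x f x)%R.
Proof.
move=> c0 mf; rewrite /Rintegral [in LHS]integralE [in RHS]integralE.
have mF : measurable_fun setT (EFin \o f) by exact: mfun_EFin.
have -> : \int[mu3]_x (fun x => (c * f x)%:E)^\+ x =
    c%:E * \int[mu3]_x (EFin \o f)^\+ x.
  rewrite -ge0_integralZl_fin ?(ltW c0)//; last exact: measurable_funepos.
  by apply: eq_integral => x _; exact: (congr1 (@^~ x) (ge0_funeposM (EFin \o f) (ltW c0))).
have -> : \int[mu3]_x (fun x => (c * f x)%:E)^\- x =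
    c%:E * \int[mu3]_x (EFin \o f)^\- x.
  rewrite -ge0_integralZl_fin ?(ltW c0)//; last exact: measurable_funeneg.
  by apply: eq_integral => x _; exact: (congr1 (@^~ x) (ge0_funenegM (EFin \o f) (ltW c0))).
by rewrite fine_pmulB//; apply: integral_ge0.
Qed.

Lemma integrableP_real (f : R3 R -> R) : measurable_fun setT f ->
  \int[mu3]_x (`|f x|)%:E < +oo -> mu3.-integrable setT (EFin \o f).
Proof. by move=> mf fin; apply/integrableP; split => //; exact: mfun_EFin. Qed.

Variables (u g : R3 R -> R[i]) (E : R).
Hypothesis u2 : L2 u.
Hypothesis ug : is_fourier u g.
Hypothesis gfin : \int[mu3]_xi (Num.sqrt (1 + norm3 xi ^+ 2) * dens g xi)%:E < +oo.
Hypothesis ru : radial u.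
Hypothesis weak : weak_solution E u.

Let rho := dens u.
Let V := potential rho.
Let mrho : measurable_fun setT rho. Proof. exact: measurable_dens u2.1. Qed.
Let rho_ge0 x : (0 <= rho x)%R. Proof. exact: dens_ge0. Qed.
Let V_ge0 x : (0 <= V x)%R. Proof. exact: potential_ge0. Qed.
Let mV : measurable_fun setT V. Proof. exact: measurable_potential. Qed.
Let mscale (l : R) : measurable_fun setT (@scale3 R l).
Proof. by apply: measurable_scale3; mfun. Qed.

Lemma dens_potential_fin : \int[mu3]_x (dens u x * potential (dens u) x)%:E < +oo.
Proof. by apply: interaction_fin => //; [exact: u2.2|exact: (weighted_mass_fin u2 ug)]. Qed.

Lemma dens_potential_scale_fin (l : R) : (0 < l)%R ->
  \int[mu3]_x (dens u x * potential (dens u) (scale3 l x))%:E < +oo.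
Proof.
move=> l0; have [c c0 cP] := potential_scale_upper mrho rho_ge0 u2.2 l0.
apply: (@le_lt_trans _ _ (\int[mu3]_x (c * (rho x * V x))%:E)).
  apply: le_integral_EFin.
  - by move=> x; rewrite mulr_ge0//; exact: V_ge0.
  - by apply: measurable_funM => //; exact: (measurableT_comp mV (mscale l)).
  - by mfun.
  - by move=> x; rewrite mulrCA ler_wpM2l//; exact: cP.
under eq_integral do rewrite EFinM.
rewrite ge0_integralZl_fin//.
- by rewrite lte_mul_pinfty//; exact: dens_potential_fin.
- by mfun.
- by move=> x; rewrite lee_fin mulr_ge0.
Qed.

Lemma dens_scale_potential (l : R) : (0 < l)%R ->
  \int[mu3]_x (dens u (scale3 l x) * potential (dens u) x)%:E =
  (l ^- 3)%:E * \int[mu3]_x (dens u x * potential (dens u) (scale3 l^-1 x))%:E.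
Proof.
move=> l0; pose f x := (rho x * V (scale3 l^-1 x))%:E.
have mf : measurable_fun setT f.
  apply: mfun_EFin; apply: measurable_funM => //.
  exact: (measurableT_comp mV (mscale _)).
have f0 x : 0 <= f x by rewrite lee_fin mulr_ge0//; exact: V_ge0.
apply: (etrans _ (leb3_scale l0 mf f0)).
by apply: eq_integral => x _; rewrite /f scale3K// gt_eqF.
Qed.

(** The real part of [conj (u (l x)) * u x], the density of the right-hand side
    of the tested equation. *)
Definition correlation (l : R) (x : R3 R) : R :=
  (complex.Re (u (scale3 l x)) * complex.Re (u x) +
   complex.Im (u (scale3 l x)) * complex.Im (u x))%R.

Lemma correlation_conj l x :
  complex.Re (conjc (dilate l u x) * u x)%R = correlation l x.
Proof.
by rewrite /dilate /correlation; case: (u _) (u x) => [p q] [r s] /=; ring.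
Qed.

Lemma measurable_correlation l : measurable_fun setT (correlation l).
Proof.
have [m1 m2] := u2.1; have m3 := measurableT_comp m1 (mscale l).
have m4 := measurableT_comp m2 (mscale l).
by rewrite /correlation; mfun.
Qed.

Lemma correlation_le l x : (`|correlation l x| <= rho (scale3 l x) + rho x)%R.
Proof.
rewrite /rho !densE /correlation; case: (u _) (u x) => [p q] [r s] /=.
rewrite ler_norml; apply/andP; split.
  by have := sqr_ge0 (p + r); have := sqr_ge0 (q + s);
     have := sqr_ge0 (p - r); have := sqr_ge0 (q - s); nra.
by have := sqr_ge0 (p + r); have := sqr_ge0 (q + s);
   have := sqr_ge0 (p - r); have := sqr_ge0 (q - s); nra.
Qed.

Lemma correlation_inv l x : (0 < l)%R -> correlation l^-1 (scale3 l x) = correlation l x.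
Proof.
move=> l0; rewrite /correlation scale3K ?gt_eqF//.
by rewrite mulrC [X in (_ + X)%R]mulrC.
Qed.

Lemma correlation_potential_fin l : (0 < l)%R ->
  \int[mu3]_x (`|correlation l x| * potential (dens u) x)%:E < +oo.
Proof.
move=> l0; have mc := measurable_correlation l.
have ms : measurable_fun setT (fun x => rho (scale3 l x)) by exact: (measurableT_comp mrho (mscale l)).
apply: (@le_lt_trans _ _ (\int[mu3]_x ((rho (scale3 l x) * V x)%:E + (rho x * V x)%:E))).
  apply: ge0_le_integral => //.
  - by move=> x _; rewrite lee_fin mulr_ge0//; exact: V_ge0.
  - by apply: mfun_EFin; apply: measurable_funM; [mfun|exact: mV].
  - by apply: emeasurable_funD; mfun.
  - by move=> x _; rewrite -EFinD lee_fin -mulrDl ler_wpM2r ?correlation_le//; exact: V_ge0.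
rewrite ge0_integralD//.
- apply: lte_add_pinfty; last exact: dens_potential_fin.
  rewrite [X in X < _](dens_scale_potential l0); apply: lte_mul_pinfty => //.
  + by rewrite lee_fin invr_ge0 exprn_ge0// ltW.
  + by apply: dens_potential_scale_fin; rewrite invr_gt0.
- by move=> x _; rewrite lee_fin mulr_ge0.
- by mfun.
- by move=> x _; rewrite lee_fin mulr_ge0.
- by mfun.
Qed.

Let kinetic (l : R) : R := (\int[mu3]_xi
  complex.Re ((norm3 xi)%:C%C * conjc (dilate_transform g l xi) * g xi))%R.

Let equation (l : R) : (0 < l)%R ->
  (kinetic l - \int[mu3]_x (correlation l x * V x) = E * \int[mu3]_x correlation l x)%R.
Proof.
move=> l0.
have [p [q [mp mq upq]]] := radial_profile u2.1 ru.
have rhoG : {ae mu3, forall x, rho x = (p (nsq x) ^+ 2 + q (nsq x) ^+ 2)%R}.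
  by apply: filterS upq => x [_ ux]; rewrite /rho densE ux.
have mG : measurable_fun setT (fun s : R => p s ^+ 2 + q s ^+ 2)%R by mfun.
have G0 s : (0 <= p s ^+ 2 + q s ^+ 2)%R by rewrite addr_ge0 ?sqr_ge0.
have W := coulomb_integral mrho rho_ge0 u2.2 mG G0 rhoG
  (measurable_correlation l) (correlation_potential_fin l0).
have := weak (sobolev_half_dilate l0 u2 ug gfin) ug (is_fourier_dilate l0 u2 ug).
move=> /(congr1 (@complex.Re R)).
rewrite /cintegral /=; rewrite mul0r subr0.
rewrite -/(kinetic l) => eq1.
rewrite -W.
rewrite [X in (_ - X)%R](_ : _ = \int[(mu3 \x mu3)%E]_p0
  complex.Re (conjc (dilate l u p0.1) * u p0.1 * (normc (u p0.2) ^+ 2)%:C%C /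
   (norm3 ((p0.1 : R * R * R) - p0.2))%:C%C))%R; last first.
  apply: eq_Rintegral => z _; rewrite -correlation_conj -fmorphV /=.
  rewrite /rho /dens; move: (conjc _ * _)%R (_ ^+ 2)%R (_^-1)%R => [c d] s t /=; ring.
rewrite eq1; congr (_ * _)%R; apply: eq_Rintegral => x _.
by rewrite -correlation_conj.
Qed.

(** The substitution [xi := l xi] exchanges the roles of [g] and its dilation. *)
Let kinetic_inv (l : R) : (0 < l)%R -> kinetic l^-1 = (l ^+ 2 * kinetic l)%R.
Proof.
move=> l0; have li : (0 < l^-1)%R by rewrite invr_gt0.
have [[mg1 mg2] _] := ug.1.
have m3 := measurableT_comp mg1 (mscale l^-1).
have m4 := measurableT_comp mg2 (mscale l^-1).
have mnorm := @measurable_norm R.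
pose f (x : R3 R) := (norm3 x * (complex.Re (g x) * complex.Re (g (scale3 l^-1 x)) +
  complex.Im (g x) * complex.Im (g (scale3 l^-1 x))))%R.
have mf : measurable_fun setT f.
  rewrite /f; apply: measurable_funM => //.
  by apply: measurable_funD; apply: measurable_funM.
have -> : kinetic l = (l ^- 3 * \int[mu3]_x f x)%R.
  rewrite -Rintegral_posZl//; last by rewrite invr_gt0 exprn_gt0.
  apply: eq_Rintegral => x _; rewrite /f /dilate_transform.
  by move: (l ^- 3)%R (norm3 x) (g x) (g (scale3 _ _)) => k m [p q] [r s] /=; ring.
rewrite -(Rintegral_scale3 l0 mf) -Rintegral_posZl ?exprn_gt0//; last first.
  exact: (measurableT_comp mf (mscale l)).
apply: eq_Rintegral => x _; rewrite /f /dilate_transform scale3K ?gt_eqF//.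
rewrite norm3_scale ?(ltW l0)// invrK exprVn invrK.
move: (norm3 x) (g x) (g (scale3 _ _)) => m [p q] [r s] /=; ring.
Qed.

(** The equation is tested with the dilation of [u] by [l] and by [l^-1]; the
    kinetic terms of the two identities are proportional, and eliminating them
    leaves a relation that involves the potential alone. *)
Lemma virial (l : R) : (0 < l)%R ->
  (l * (\int[mu3]_x (correlation l x * potential (dens u) (scale3 l x))) -
   \int[mu3]_x (correlation l x * potential (dens u) x) =
   (1 - l) * (E * \int[mu3]_x correlation l x))%R.
Proof.
move=> l0; have li : (0 < l^-1)%R by rewrite invr_gt0.
have mc k : measurable_fun setT (correlation k) by exact: measurable_correlation.
have l3 : (l ^+ 3 * l ^- 3 = 1)%R by rewrite mulfV// expf_neq0// gt_eqF.
(* the two equations are combined with the weights [l ^ 2] and [-1] *)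
have eq1 := equation l0; have := equation li; rewrite kinetic_inv//.
have -> : (\int[mu3]_x (correlation l^-1 x * V x) =
    l ^+ 3 * \int[mu3]_x (correlation l x * V (scale3 l x)))%R.
  have m : measurable_fun setT (fun x => correlation l^-1 x * V x)%R.
    exact: measurable_funM.
  rewrite -[LHS]mul1r -l3 -mulrA -(Rintegral_scale3 l0 m); congr (_ * _)%R.
  by apply: eq_Rintegral => x _; rewrite correlation_inv.
have -> : (\int[mu3]_x (correlation l^-1 x) = l ^+ 3 * \int[mu3]_x (correlation l x))%R.
  rewrite -[LHS]mul1r -l3 -mulrA -(Rintegral_scale3 l0 (mc _)); congr (_ * _)%R.
  by apply: eq_Rintegral => x _; rewrite correlation_inv.
move: eq1; rewrite -/V.
move: (kinetic l) (\int[mu3]_x (correlation l x * V x))%R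
  (\int[mu3]_x (correlation l x * V (scale3 l x)))%R (\int[mu3]_x (correlation l x))%R.
move=> K A1 A2 F eq1 eq2.
have l2 : (l ^+ 2 != 0)%R by rewrite expf_neq0// gt_eqF.
apply: (mulfI l2).
have {}eq2 : (l ^+ 3 * A2 = l ^+ 2 * K - E * (l ^+ 3 * F))%R by rewrite -eq2; ring.
have {}eq1 : (K = A1 + E * F)%R by rewrite -eq1; ring.
have -> : (l ^+ 2 * (l * A2 - A1) = l ^+ 3 * A2 - l ^+ 2 * A1)%R by ring.
by rewrite eq2 eq1; ring.
Qed.

End virial.

(** * The interaction energy and the defect of a dilation *)

Section interaction.
Context {R : realType}.
Notation mu3 := (@leb3 R).
Local Open Scope ereal_scope.

Lemma ge0_integrable (f : R3 R -> R) : measurable_fun setT f -> (forall x, 0 <= f x)%R ->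
  \int[mu3]_x (f x)%:E < +oo -> mu3.-integrable setT (EFin \o f).
Proof.
move=> mf f0 fin; apply: integrableP_real => //.
by under eq_integral do rewrite ger0_norm//.
Qed.

Lemma Rintegral_EFin (f : R3 R -> R) : (forall x, 0 <= f x)%R ->
  \int[mu3]_x (f x)%:E < +oo -> (\int[mu3]_x f x)%:E = \int[mu3]_x (f x)%:E.
Proof.
move=> f0 fin; rewrite /Rintegral fineK// ge0_fin_numE//.
by apply: integral_ge0 => x _; rewrite lee_fin.
Qed.

(** Elimination of the correlation, expressed through the defect for the three
    weights [V], [V] dilated and [1], from the virial identity; the sign of [E]
    makes the mass term favourable. *)
Let interaction_arith (E l c D B dV dVl N d A1 A2 F : R) :
  (0 <= E -> 1 < l -> 0 <= N -> dVl <= dV -> dV = l * B + D - c * A1 ->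
   dVl = D + B - c * A2 -> d = N + N - c * F ->
   l * A2 - A1 = (1 - l) * (E * F) -> D <= dV + E * d)%R.
Proof.
move=> E0 l1 N0 mono e1 e2 e3 vir.
have key : (l * (D + B - dVl) - (l * B + D - dV) = (1 - l) * (E * (2 * N - d)))%R.
  have -> : (l * B + D - dV = c * A1)%R by rewrite e1; ring.
  have -> : (D + B - dVl = c * A2)%R by rewrite e2; ring.
  have -> : (2 * N - d = c * F)%R by rewrite e3; ring.
  by transitivity (c * (l * A2 - A1))%R; [ring|rewrite vir; ring].
have lp : (0 < l - 1)%R by rewrite subr_gt0.
rewrite -(ler_pM2l lp).
have h1 : (l * dVl <= l * dV)%R by rewrite ler_pM2l// (lt_trans _ l1).
have h2 : (0 <= (l - 1) * (E * (2 * N)))%R.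
  by apply: mulr_ge0; [exact: ltW|apply: mulr_ge0 => //; exact: mulr_ge0].
by rewrite -subr_ge0; rewrite [X in (0 <= X)%R](_ : _ = (l * dV - l * dVl) +
    (l - 1) * (E * (2 * N)) + ((l * (D + B - dVl) - (l * B + D - dV)) * -1 +
    (1 - l) * (E * (2 * N - d))))%R; [rewrite key mulrN1 addNr addr0; lra|ring].
Qed.

Variables (u g : R3 R -> R[i]) (E s : R).
Hypothesis E0 : (0 <= E)%R.
Hypothesis u2 : L2 u.
Hypothesis ug : is_fourier u g.
Hypothesis gfin : \int[mu3]_xi (Num.sqrt (1 + norm3 xi ^+ 2) * dens g xi)%:E < +oo.
Hypothesis ru : radial u.
Hypothesis weak : weak_solution E u.
Hypothesis s1 : (1 < s)%R.

(** The square distance between [u] and its dilation, normalized so that the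
    dilation preserves the norm of [L2]. *)
Definition defect (x : R3 R) : R :=
  ((s ^+ 3 * complex.Re (u (scale3 (s ^+ 2) x)) - complex.Re (u x)) ^+ 2 +
   (s ^+ 3 * complex.Im (u (scale3 (s ^+ 2) x)) - complex.Im (u x)) ^+ 2)%R.

Lemma defect_ge0 x : (0 <= defect x)%R.
Proof. by rewrite addr_ge0 ?sqr_ge0. Qed.

Let l := (s ^+ 2)%R.
Let s0 : (0 < s)%R. Proof. exact: lt_trans s1. Qed.
Let l0 : (0 < l)%R. Proof. exact: exprn_gt0. Qed.
Let l1 : (1 < l)%R. Proof. by rewrite /l expr2; apply: mulr_egt1. Qed.

Let rho := dens u.
Let V := potential rho.
Let mrho : measurable_fun setT rho. Proof. exact: measurable_dens u2.1. Qed.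
Let rho_ge0 x : (0 <= rho x)%R. Proof. exact: dens_ge0. Qed.
Let V_ge0 x : (0 <= V x)%R. Proof. exact: potential_ge0. Qed.
Let mV : measurable_fun setT V. Proof. exact: measurable_potential. Qed.
Let mscale : measurable_fun setT (@scale3 R l).
Proof. by apply: measurable_scale3; mfun. Qed.
Let mrhol : measurable_fun setT (fun x => rho (scale3 l x)).
Proof. exact: (measurableT_comp mrho mscale). Qed.
Let mVl : measurable_fun setT (fun x => V (scale3 l x)).
Proof. exact: (measurableT_comp mV mscale). Qed.

Lemma measurable_defect : measurable_fun setT defect.
Proof.
have [m1 m2] := u2.1; have m3 := measurableT_comp m1 mscale.
have m4 := measurableT_comp m2 mscale.
by rewrite /defect; mfun.
Qed.

Let defectE x : (defect x = s ^+ 6 * rho (scale3 l x) + rho x -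
  (2 * s ^+ 3) * correlation u l x)%R.
Proof. by rewrite /defect /rho !densE /correlation -/l; ring. Qed.

Let weighted_defect (W : R3 R -> R) : measurable_fun setT W -> (forall x, 0 <= W x)%R ->
  \int[mu3]_x (rho x * W x)%:E < +oo -> \int[mu3]_x (rho (scale3 l x) * W x)%:E < +oo ->
  (\int[mu3]_x (defect x * W x) = s ^+ 6 * \int[mu3]_x (rho (scale3 l x) * W x) +
     \int[mu3]_x (rho x * W x) - (2 * s ^+ 3) * \int[mu3]_x (correlation u l x * W x))%R /\
  mu3.-integrable setT (EFin \o (fun x => defect x * W x)%R).
Proof.
move=> mW W0 f1 f2.
have mc := measurable_correlation u2 l.
have i1 : mu3.-integrable setT (EFin \o (fun x => rho x * W x)%R).
  by apply: ge0_integrable => //; [mfun|move=> x; exact: mulr_ge0].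
have i2 : mu3.-integrable setT (EFin \o (fun x => rho (scale3 l x) * W x)%R).
  by apply: ge0_integrable => //; [mfun|move=> x; exact: mulr_ge0].
have i12 : mu3.-integrable setT (EFin \o (fun x => rho (scale3 l x) * W x + rho x * W x)%R).
  exact: (integrableD measurableT i2 i1).
have i3 : mu3.-integrable setT (EFin \o (fun x => correlation u l x * W x)%R).
  apply: (le_integrable measurableT _ _ i12); first by apply: mfun_EFin; mfun.
  move=> x _; rewrite /= lee_fin normrM (ger0_norm (W0 x)).
  rewrite (le_trans _ (ler_norm _))// -mulrDl ler_wpM2r//.
  exact: correlation_le.
have i2' : mu3.-integrable setT (EFin \o (fun x => s ^+ 6 * (rho (scale3 l x) * W x))%R).
  exact: (integrableZl measurableT (s ^+ 6)%R i2).
have i3' : mu3.-integrable setT (EFin \o (fun x => (2 * s ^+ 3) * (correlation u l x * W x))%R).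
  exact: (integrableZl measurableT (2 * s ^+ 3)%R i3).
have i4 : mu3.-integrable setT
    (EFin \o (fun x => s ^+ 6 * (rho (scale3 l x) * W x) + rho x * W x)%R).
  exact: (integrableD measurableT i2' i1).
have E1 : (fun x => defect x * W x)%R = (fun x => (s ^+ 6 * (rho (scale3 l x) * W x) +
    rho x * W x) - (2 * s ^+ 3) * (correlation u l x * W x))%R.
  by apply/funext => x; rewrite defectE; ring.
split; last by rewrite E1; exact: (integrableB measurableT i4 i3').
rewrite E1 RintegralB// RintegralD// RintegralZl// RintegralZl//.
Qed.

(** The virial identity is a difference quotient of Pohozaev's identity. Its main
    term is the interaction energy, and monotonicity of the potential along rays
    bounds the remainder by [(l - 1)] times the defect weighted by the
    potential. *)
Lemma interaction_le :
  (\int[mu3]_x (rho x * V x) <=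
   \int[mu3]_x (defect x * V x) + E * \int[mu3]_x defect x)%R.
Proof.
have rV := dens_potential_fin u2 ug gfin ru.
have rVl := dens_potential_scale_fin u2 ug gfin ru l0.
have li : (0 < l^-1)%R by rewrite invr_gt0.
have rVi := dens_potential_scale_fin u2 ug gfin ru li.
have l3 : (l ^- 3 * s ^+ 6 = 1)%R.
  by rewrite /l -exprM mulVf// expf_neq0// gt_eqF.
have l3r : (s ^+ 6 * l ^- 3 = 1)%R by rewrite mulrC.
have l3E : (s ^+ 6)%:E * (l ^- 3)%:E = 1 by rewrite -EFinM l3r.
have l3R (x : R) : (s ^+ 6 * (l ^- 3 * x) = x)%R by rewrite mulrA l3r mul1r.
have lge0 : 0 <= (l ^- 3)%:E by rewrite lee_fin invr_ge0 exprn_ge0// ltW.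
have rN : \int[mu3]_x (rho x)%:E < +oo by exact: u2.2.
have rlV : \int[mu3]_x (rho (scale3 l x) * V x)%:E < +oo.
  rewrite [X in X < _](dens_scale_potential u2 l0).
  exact: (lte_mul_pinfty lge0 isT rVi).
have rlVl : \int[mu3]_x (rho (scale3 l x) * V (scale3 l x))%:E < +oo.
  rewrite (leb3_scale (f := fun x => (rho x * V x)%:E) l0); last 2 first.
  - by mfun.
  - by move=> x; rewrite lee_fin mulr_ge0.
  exact: (lte_mul_pinfty lge0 isT rV).
have rl : \int[mu3]_x (rho (scale3 l x) * 1)%:E < +oo.
  under eq_integral do rewrite mulr1.
  apply: (@le_lt_trans _ _ ((l ^- 3)%:E * \int[mu3]_x (rho x)%:E)).
    by rewrite -(integral_dens_dilate l0 u2.1).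
  exact: (lte_mul_pinfty lge0 isT rN).
have r1 : \int[mu3]_x (rho x * 1)%:E < +oo.
  by under eq_integral do rewrite mulr1.
have [e1 i1] := weighted_defect mV V_ge0 rV rlV.
have [e2 i2] := weighted_defect mVl (fun x => V_ge0 _) rVl rlVl.
have [e3 i3] := weighted_defect (measurable_cst (1%R : R)) (fun x => ler01) r1 rl.
have B1 : (s ^+ 6 * \int[mu3]_x (rho (scale3 l x) * V x) =
    l * \int[mu3]_x (rho x * V (scale3 l x)))%R.
  have h1 x : (0 <= rho (scale3 l x) * V x)%R by apply: mulr_ge0; [exact: rho_ge0|exact: V_ge0].
  have h2 x : (0 <= rho x * V (scale3 l x))%R by apply: mulr_ge0; [exact: rho_ge0|exact: V_ge0].
  have q1 := Rintegral_EFin h1 rlV; have q2 := Rintegral_EFin h2 rVl.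
  apply: EFin_inj; apply: (etrans (EFinM _ _)); apply: (etrans (congr1 (mule _) q1)).
  apply: (etrans _ (esym (etrans (EFinM _ _) (congr1 (mule _) q2)))).
  apply: (etrans (congr1 (mule _) (dens_scale_potential u2 l0))).
  apply: (etrans _ (potential_dilation mrho rho_ge0 u2.2 l0)).
  exact: (etrans (muleA _ _ _) (etrans (congr1 (mule^~ _) l3E) (mul1e _))).
have B2 : (s ^+ 6 * \int[mu3]_x (rho (scale3 l x) * V (scale3 l x)) =
    \int[mu3]_x (rho x * V x))%R.
  have m : measurable_fun setT (fun x => rho x * V x)%R by mfun.
  exact: (etrans (congr1 _ (Rintegral_scale3 l0 m)) (l3R _)).
have B3 : (s ^+ 6 * \int[mu3]_x (rho (scale3 l x) * 1) = \int[mu3]_x (rho x * 1))%R.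
  have m : measurable_fun setT (fun x => rho x * 1)%R by mfun.
  exact: (etrans (congr1 _ (Rintegral_scale3 l0 m)) (l3R _)).
have vir := virial u2 ug gfin ru weak l0.
(* this is where the potential decreases along rays *)
have mono : (\int[mu3]_x (defect x * V (scale3 l x)) <= \int[mu3]_x (defect x * V x))%R.
  apply: (le_Rintegral measurableT i2 i1) => x _; apply: ler_wpM2l; first exact: defect_ge0.
  exact: (potential_scale_le mrho rho_ge0 u2.2 x (ltW l1)).
have N0 : (0 <= \int[mu3]_x (rho x * 1))%R by apply: Rintegral_ge0 => x _; rewrite mulr1.
have c1 : (\int[mu3]_x correlation u l x = \int[mu3]_x (correlation u l x * 1))%R.
  by apply: eq_Rintegral => x _; rewrite mulr1.
have d1 : (\int[mu3]_x defect x = \int[mu3]_x (defect x * 1))%R.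
  by apply: eq_Rintegral => x _; rewrite mulr1.
rewrite d1; rewrite c1 in vir; rewrite B1 in e1; rewrite B2 in e2; rewrite B3 in e3.
exact: (interaction_arith E0 l1 N0 mono e1 e2 e3 vir).
Qed.

End interaction.

(** * Dilations close to the identity *)

Section limit.
Context {R : realType}.
Notation mu3 := (@leb3 R).
Local Open Scope ereal_scope.

Let mnsq : measurable_fun setT (@nsq R).
Proof. exact: (measurable_nsq (f := id)). Qed.

Let mscale (l : R) : measurable_fun setT (@scale3 R l).
Proof. by apply: measurable_scale3; mfun. Qed.

Definition ratio (k : nat) : R := (1 + eps k)%R.

Lemma ratio_gt1 k : (1 < ratio k)%R.
Proof. by rewrite /ratio ltrDl eps_gt0. Qed.

Lemma ratio_le2 k : (ratio k <= 2)%R.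
Proof. by rewrite /ratio -[leRHS]/(1 + 1)%R lerD2l eps_le1. Qed.

Let ratio_gt0 k : (0 < ratio k)%R. Proof. exact: lt_trans (ratio_gt1 k). Qed.

Let dilated (a : R3 R -> R) k x : R :=
  (ratio k ^+ 3 * a (scale3 (ratio k ^+ 2) x) - a x)%R.

Let mdilated (a : R3 R -> R) k : measurable_fun setT a -> measurable_fun setT (dilated a k).
Proof. by move=> ma; have m := measurableT_comp ma (mscale (ratio k ^+ 2)); rewrite /dilated; mfun. Qed.

Let compact_dilated_cvg0 (h : R -> R) (B S : R) : continuous h ->
  (forall s, `|h s| <= B)%R -> (forall s, S < s -> h s = 0)%R ->
  \int[mu3]_x (dilated (fun x => h (nsq x)) k x ^+ 2)%:E @[k --> \oo] --> 0.
Proof.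
move=> ch hB hS.
have mh : measurable_fun setT h by exact: continuous_measurable_fun.
have mhn : measurable_fun setT (fun x : R3 R => h (nsq x)) by mfun.
have minb : measurable_fun setT (@inball R S) by apply: measurable_inball; mfun.
(* [130 = 2 * 2 ^ 6 + 2], the ratio being at most two *)
apply: (cvg_integral0 (g := fun x => 130 * B ^+ 2 * inball S x)%R).
- by move=> k; have m := mdilated k mhn; mfun.
- by mfun.
- move=> k x; apply/andP; split; first exact: sqr_ge0.
  have h1 := compact_sq_le hB hS x.
  have h2 : (h (nsq (scale3 (ratio k ^+ 2) x)) ^+ 2 <= B ^+ 2 * inball S x)%R.
    apply: (le_trans (compact_sq_le hB hS _)); apply: ler_wpM2l; first exact: sqr_ge0.
    rewrite /inball nsq_scale; case: ifPn => [k1|_]; last by case: ifP.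
    rewrite ifT//; apply: le_trans k1; rewrite ler_peMl ?nsq_ge0//.
    by rewrite exprn_ege1// exprn_ege1// ltW// ratio_gt1.
  rewrite /dilated; move: h1 h2.
  have r6 : ((ratio k ^+ 3) ^+ 2 <= 64)%R.
    have -> : (64 = (2 ^+ 3) ^+ 2 :> R)%R by ring.
    have r3 : (ratio k ^+ 3 <= 2 ^+ 3)%R by rewrite ler_pXn2r ?nnegrE ?(ltW (ratio_gt0 k))// ratio_le2.
    by rewrite ler_pXn2r ?nnegrE// exprn_ge0// ltW.
  move: (h (nsq (scale3 _ x))) (h (nsq x)) (ratio k ^+ 3)%R r6 => p q r r6.
  rewrite -[(130 * B ^+ 2 * inball S x)%R]mulrA; move: (B ^+ 2 * inball S x)%R => z p1 q1.
  have : (0 <= (64 - r ^+ 2) * p ^+ 2)%R by rewrite mulr_ge0 ?subr_ge0 ?sqr_ge0.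
  have := sqr_ge0 (r * p + q); nra.
- under eq_integral do rewrite EFinM.
  rewrite ge0_integralZl_fin; last 3 first.
  - by apply: mulr_ge0 => //; exact: sqr_ge0.
  - by mfun.
  - by move=> x; rewrite lee_fin inball_ge0.
  apply: lte_mul_pinfty => //; last exact: inball_fin.
  by rewrite lee_fin; apply: mulr_ge0 => //; exact: sqr_ge0.
- move=> x.
  have c : continuous (fun e : R => ((1 + e) ^+ 3 * h ((((1 + e) ^+ 2) ^+ 2) * nsq x) - h (nsq x)) ^+ 2)%R.
    have c1 (m : nat) : continuous (fun e : R => (1 + e) ^+ m)%R.
      move=> e; apply: (@continuous_comp _ _ _ (fun e : R => 1 + e)%R (fun t : R => t ^+ m)%R).
        by apply: cvgD; [exact: cvg_cst|exact: cvg_id].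
      exact: exprn_continuous.
    move=> e; rewrite /continuous_at expr2; under eq_fun do rewrite expr2.
    apply: cvgM; (apply: cvgB; last exact: cvg_cst); (apply: cvgM; first exact: c1);
      (apply: (@continuous_comp _ _ _ (fun e : R => ((1 + e) ^+ 2) ^+ 2 * nsq x)%R h);
        last exact: ch); (apply: cvgM; last exact: cvg_cst);
      rewrite -exprM; (under eq_fun do rewrite -exprM); exact: c1.
  have := c 0%R; rewrite /continuous_at addr0 !expr1n !mul1r subrr expr0n/= => c0.
  rewrite (_ : (fun k => _) = (fun e : R => ((1 + e) ^+ 3 *
    h ((((1 + e) ^+ 2) ^+ 2) * nsq x) - h (nsq x)) ^+ 2)%R \o (@eps R)).
    exact: (cvg_comp _ _ eps_cvg0 c0).
  by apply/funext => k; rewrite /dilated /= nsq_scale.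
Qed.

(** Dilations by a factor tending to one converge to the identity on radial
    functions: this is clear for continuous functions of compact support, which
    are dense, and dilations are isometries after normalization. *)
Let dilated_small (a : R3 R -> R) (phi : R -> R) (e : R) : measurable_fun setT a ->
  measurable_fun setT phi -> {ae mu3, forall x, a x = phi (nsq x)} ->
  \int[mu3]_x (a x ^+ 2)%:E < +oo -> (0 < e)%R ->
  \forall k \near \oo, \int[mu3]_x (dilated a k x ^+ 2)%:E < e%:E.
Proof.
move=> ma mphi aphi afin e0.
have mphin : measurable_fun setT (fun x : R3 R => phi (nsq x)) by mfun.
have pfin : \int[mu3]_x (phi (nsq x) ^+ 2)%:E < +oo.
  apply: le_lt_trans afin; rewrite le_eqVlt; apply/orP; left; apply/eqP.
  apply: ge0_ae_eq_integral => //.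
  - by mfun.
  - by mfun.
  - by move=> x _; rewrite lee_fin sqr_ge0.
  - by move=> x _; rewrite lee_fin sqr_ge0.
  - by apply: filterS aphi => x -> _.
(* three errors, each with the factor three that bounds the square of a sum *)
have e9 : (0 < e / 9)%R by rewrite divr_gt0.
have [h [B [S [ch S0 hB hS small]]]] := radial_density mphi pfin e9.
have mh : measurable_fun setT h by exact: continuous_measurable_fun.
have mhn : measurable_fun setT (fun x : R3 R => h (nsq x)) by mfun.
pose d x := (a x - h (nsq x))%R.
have md : measurable_fun setT d by rewrite /d; mfun.
have dsmall : \int[mu3]_x (d x ^+ 2)%:E < (e / 9)%:E.
  apply: le_lt_trans small; rewrite le_eqVlt; apply/orP; left; apply/eqP.
  apply: ge0_ae_eq_integral => //.
  - by mfun.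
  - by mfun.
  - by move=> x _; rewrite lee_fin sqr_ge0.
  - by move=> x _; rewrite lee_fin sqr_ge0.
  - by apply: filterS aphi => x ax _; rewrite /d ax.
have := cvge0_lt e9 (compact_dilated_cvg0 ch hB hS).
apply: filterS => k hk.
have mdl := measurableT_comp md (mscale (ratio k ^+ 2)).
have mdh := mdilated k mhn; have mda := mdilated k ma.
pose F1 x := (3 * (ratio k ^+ 6 * d (scale3 (ratio k ^+ 2) x) ^+ 2))%:E.
pose F2 x := (3 * dilated (fun x => h (nsq x)) k x ^+ 2)%:E.
pose F3 x := (3 * d x ^+ 2)%:E.
have F10 x : 0 <= F1 x.
  by rewrite lee_fin; apply: mulr_ge0 => //; apply: mulr_ge0; [exact: exprn_ge0 (ltW (ratio_gt0 k))|exact: sqr_ge0].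
have F20 x : 0 <= F2 x by rewrite lee_fin; apply: mulr_ge0 => //; exact: sqr_ge0.
have F30 x : 0 <= F3 x by rewrite lee_fin; apply: mulr_ge0 => //; exact: sqr_ge0.
have mF1 : measurable_fun setT F1 by rewrite /F1; mfun.
have mF2 : measurable_fun setT F2 by rewrite /F2; mfun.
have mF3 : measurable_fun setT F3 by rewrite /F3; mfun.
apply: (@le_lt_trans _ _ (\int[mu3]_x (F1 x + F2 x + F3 x))).
  apply: ge0_le_integral => //.
  - by move=> x _; rewrite lee_fin sqr_ge0.
  - by mfun.
  - by apply: emeasurable_funD => //; exact: emeasurable_funD.
  move=> x _; rewrite /F1 /F2 /F3 -[X in X + _]EFinD -EFinD lee_fin /dilated /d.
  rewrite -[(ratio k ^+ 6)%R]/(ratio k ^+ (3 * 2))%R exprM.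
  move: (ratio k ^+ 3)%R (h (nsq (scale3 _ x))) (h (nsq x)) (a (scale3 _ x)) (a x) => r p q s t.
  have := sqr_ge0 (r * (s - p) - (r * p - q)); have := sqr_ge0 (r * (s - p) + (t - q)).
  have := sqr_ge0 ((r * p - q) + (t - q)); nra.
rewrite ge0_integralD//; last 2 first.
- by move=> x _; apply: adde_ge0.
- exact: emeasurable_funD.
rewrite ge0_integralD//.
have iF3 : \int[mu3]_x F3 x = 3%:E * \int[mu3]_x (d x ^+ 2)%:E.
  rewrite -ge0_integralZl_fin//; first by mfun.
  by move=> x; rewrite lee_fin sqr_ge0.
have iF2 : \int[mu3]_x F2 x = 3%:E * \int[mu3]_x (dilated (fun x => h (nsq x)) k x ^+ 2)%:E.
  rewrite -ge0_integralZl_fin//; first by mfun.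
  by move=> x; rewrite lee_fin sqr_ge0.
have iF1 : \int[mu3]_x F1 x = 3%:E * \int[mu3]_x (d x ^+ 2)%:E.
  pose G x := (3 * (ratio k ^+ 6 * d x ^+ 2))%:E.
  have mG : measurable_fun setT G by rewrite /G; mfun.
  have G0 x : 0 <= G x.
    by rewrite lee_fin; apply: mulr_ge0 => //; apply: mulr_ge0; [exact: exprn_ge0 (ltW (ratio_gt0 k))|exact: sqr_ge0].
  have r2 : (0 < ratio k ^+ 2)%R by rewrite exprn_gt0.
  apply: (etrans (leb3_scale r2 mG G0)).
  rewrite -!ge0_integralZl_fin//; last 3 first.
  - by mfun.
  - by move=> x; rewrite lee_fin sqr_ge0.
  - by rewrite invr_ge0 exprn_ge0// exprn_ge0// ltW.
  apply: eq_integral => x _; rewrite /G -[LHS]EFinM -[RHS]EFinM; congr EFin.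
  rewrite -exprM; have := ratio_gt0 k; move: (ratio k) (d x) => r t r0.
  by field; rewrite gt_eqF.
rewrite iF1 iF2 iF3.
have -> : e%:E = 3%:E * (e / 9)%:E + 3%:E * (e / 9)%:E + 3%:E * (e / 9)%:E.
  by rewrite -!EFinM -!EFinD; congr EFin; field.
by apply: lteD; [apply: lteD|]; rewrite lte_pmul2l.
Qed.

(** * Vanishing of the interaction energy *)

Section solution.
Variable u : R3 R -> R[i].
Hypothesis u2 : L2 u.
Hypothesis ru : radial u.

Let rho := dens u.
Let V := potential rho.
Let mrho : measurable_fun setT rho. Proof. exact: measurable_dens u2.1. Qed.
Let rho_ge0 x : (0 <= rho x)%R. Proof. exact: dens_ge0. Qed.
Let V_ge0 x : (0 <= V x)%R. Proof. exact: potential_ge0. Qed.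
Let mV : measurable_fun setT V. Proof. exact: measurable_potential. Qed.

(** The defect is the sum of the squares of the dilation errors of the real and
    imaginary parts. *)
Lemma defect_small (e : R) : (0 < e)%R ->
  \forall k \near \oo, \int[mu3]_x (defect u (ratio k) x)%:E < e%:E.
Proof.
move=> e0; have [p [q [mp mq upq]]] := radial_profile u2.1 ru.
have [ma mb] := u2.1.
have e2 : (0 < e / 2)%R by rewrite divr_gt0.
have fin (c : R3 R -> R) : measurable_fun setT c -> (forall x, c x ^+ 2 <= rho x)%R ->
    \int[mu3]_x (c x ^+ 2)%:E < +oo.
  move=> mc cr; apply: le_lt_trans u2.2; apply: le_integral_EFin => //.
  - by move=> x; exact: sqr_ge0.
  - by mfun.
have ha : {ae mu3, forall x, complex.Re (u x) = p (nsq x)}.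
  by apply: filterS upq => x [_ ->].
have hb : {ae mu3, forall x, complex.Im (u x) = q (nsq x)}.
  by apply: filterS upq => x [_ ->].
have fa : \int[mu3]_x (complex.Re (u x) ^+ 2)%:E < +oo.
  by apply: fin => // x; rewrite /rho densE lerDl sqr_ge0.
have fb : \int[mu3]_x (complex.Im (u x) ^+ 2)%:E < +oo.
  by apply: fin => // x; rewrite /rho densE lerDr sqr_ge0.
apply: filterS2 (dilated_small ma mp ha fa e2) (dilated_small mb mq hb fb e2) => k h1 h2.
have m1 := mdilated k ma; have m2 := mdilated k mb.
rewrite /defect; under eq_integral do rewrite EFinD.
rewrite ge0_integralD//; last 4 first.
- by move=> x _; rewrite lee_fin sqr_ge0.
- by apply: mfun_EFin; exact: measurable_funX m1.
- by move=> x _; rewrite lee_fin sqr_ge0.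
- by apply: mfun_EFin; exact: measurable_funX m2.
by rewrite [e]splitr EFinD; exact: lteD.
Qed.

Hypothesis rV : \int[mu3]_x (dens u x * potential (dens u) x)%:E < +oo.

(** The factor four bounds the squared ratio of the dilations that occur. *)
Let excess (j : nat) x : R := Num.max 0%R (4 * V x - j%:R)%R.

Let excess_ge0 j x : (0 <= excess j x)%R. Proof. by rewrite le_max lexx. Qed.

Let mexcess j : measurable_fun setT (excess j).
Proof. by apply: measurable_maxr; mfun. Qed.

Let excess_cvg0 : \int[mu3]_x (4 * (rho x * excess j x))%:E @[j --> \oo] --> 0.
Proof.
have m1 j := mexcess j.
apply: (cvg_integral0 (g := fun x => 16 * (rho x * V x))%R).
- by move=> j; have m := m1 j; mfun.
- by mfun.
- move=> j x; have r0 := rho_ge0 x; have v0 := V_ge0 x; apply/andP; split.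
    by apply: mulr_ge0 => //; exact: mulr_ge0.
  have : (excess j x <= 4 * V x)%R.
    rewrite ge_max; apply/andP; split; first exact: mulr_ge0.
    by rewrite gerBl.
  move: r0; move: (rho x) (excess j x) (V x) => r e v r0 ev.
  have : (0 <= r * (4 * v - e))%R by rewrite mulr_ge0// subr_ge0.
  by nra.
- under eq_integral do rewrite EFinM.
  rewrite ge0_integralZl_fin; last 3 first.
  - by [].
  - by mfun.
  - by move=> x; rewrite lee_fin; apply: mulr_ge0; [exact: rho_ge0|exact: V_ge0].
  by apply: lte_mul_pinfty; [rewrite lee_fin|by []|exact: rV].
- move=> x; apply: cvg_near_cst; exists (Num.truncn (4 * V x)%R).+1 => // j /= xj.
  rewrite /excess max_l ?mulr0// subr_le0; apply: (le_trans (ltW (truncnS_gt _))).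
  by rewrite ler_nat.
Qed.

(** The potential is unbounded only where the density carries little of the
    interaction energy, uniformly over moderate dilations. *)
Lemma defect_potential_small (e : R) : (0 < e)%R ->
  \forall k \near \oo, \int[mu3]_x (defect u (ratio k) x * potential (dens u) x)%:E < e%:E.
Proof.
move=> e0; have e2 : (0 < e / 2)%R by rewrite divr_gt0.
have [j _ /(_ j (leqnn j)) jsmall] := cvge0_lt e2 excess_cvg0.
have c0 : (0 < e / 2 / j.+1%:R)%R by rewrite divr_gt0.
apply: filterS (defect_small c0) => k dk.
have s0 := ratio_gt0 k; set s := ratio k in dk s0 *.
have l0 : (0 < s ^+ 2)%R by rewrite exprn_gt0.
have l1 : (1 <= s ^+ 2)%R by rewrite exprn_ege1// ltW// ratio_gt1.
have l4 : (s ^+ 2 <= 4)%R.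
  have -> : (4 = 2 ^+ 2 :> R)%R by ring.
  by rewrite ler_pXn2r ?nnegrE ?(ltW s0)// ratio_le2.
set l := (s ^+ 2)%R in l0 l1 l4 *.
have mex := mexcess j; have md := measurable_defect s u2.
have msc := measurableT_comp mrho (mscale l).
have msc' := measurableT_comp mex (mscale l).
(* the part of the potential above [j], which a dilation keeps below the excess *)
pose ex x := Num.max 0%R (V x - j%:R)%R.
have ex0 x : (0 <= ex x)%R by rewrite le_max lexx.
have mx : measurable_fun setT ex by apply: measurable_maxr; mfun.
have exE x : (ex (scale3 l^-1 x) <= excess j x)%R.
  rewrite ge_max excess_ge0/= le_max; apply/orP; right; apply: lerB => //.
  have h := potential_scale_ge mrho rho_ge0 u2.2 (scale3 l^-1 x) l1.
  rewrite scale3VK ?gt_eqF// in h; apply: (le_trans h).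
  by apply: ler_wpM2r; first exact: V_ge0.
have ex1 x : (ex x <= excess j x)%R.
  rewrite ge_max excess_ge0/= le_max; apply/orP; right; apply: lerB => //.
  by apply: ler_peMl; [exact: V_ge0|rewrite ler1n].
pose F1 x := (j%:R * defect u s x)%:E.
pose F2 x := (2 * (s ^+ 6 * (rho (scale3 l x) * ex x)))%:E.
pose F3 x := (2 * (rho x * excess j x))%:E.
have s6 : (0 < s ^+ 6)%R by rewrite exprn_gt0.
have F10 x : 0 <= F1 x by rewrite lee_fin; apply: mulr_ge0 => //; exact: defect_ge0.
have F20 x : 0 <= F2 x.
  rewrite lee_fin; apply: mulr_ge0 => //; apply: mulr_ge0; first exact: ltW.
  by apply: mulr_ge0; [exact: rho_ge0|].
have F30 x : 0 <= F3 x.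
  by rewrite lee_fin; apply: mulr_ge0 => //; apply: mulr_ge0; [exact: rho_ge0|exact: excess_ge0].
have mF1 : measurable_fun setT F1 by rewrite /F1; mfun.
have mF2 : measurable_fun setT F2 by rewrite /F2; mfun.
have mF3 : measurable_fun setT F3 by rewrite /F3; mfun.
have mdV : measurable_fun setT (fun x => (defect u s x * V x)%:E) by mfun.
have dV0 x : 0 <= (defect u s x * V x)%:E.
  by rewrite lee_fin; apply: mulr_ge0; [exact: defect_ge0|exact: V_ge0].
have step : \int[mu3]_x (defect u s x * V x)%:E <= \int[mu3]_x (F1 x + F2 x + F3 x).
  apply: ge0_le_integral; [exact: measurableT|by move=> x _; exact: dV0|exact: mdV| |].
    by apply: emeasurable_funD => //; exact: emeasurable_funD.
  move=> x _; rewrite /F1 /F2 /F3 -[X in X + _]EFinD -EFinD lee_fin.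
  have h1 : (V x <= j%:R + ex x)%R.
    by rewrite -lerBlDl le_max lexx orbT.
  have h2 : (defect u s x <= 2 * (s ^+ 6 * rho (scale3 l x)) + 2 * rho x)%R.
    rewrite /defect -/l /rho !densE -[(s ^+ 6)%R]/(s ^+ (3 * 2))%R exprM.
    move: (s ^+ 3)%R (complex.Re (u (scale3 l x))) (complex.Im (u (scale3 l x)))
      (complex.Re (u x)) (complex.Im (u x)) => r a b c d.
    by have := sqr_ge0 (r * a + c); have := sqr_ge0 (r * b + d); nra.
  have := defect_ge0 u s x; have := ex0 x; have := ex1 x; have := rho_ge0 x.
  move: h1 h2.
  move: (V x) (ex x) (excess j x) (defect u s x) (rho x) (rho (scale3 l x)) (s ^+ 6)%R
    (j%:R : R) => v y y' d r r' c n h1 h2 r0 yy' y0 d0.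
  have q1 : (d * v <= d * (n + y))%R by apply: ler_wpM2l.
  have q2 : (d * y <= (2 * (c * r') + 2 * r) * y)%R by apply: ler_wpM2r.
  have q3 : (r * y <= r * y')%R by apply: ler_wpM2l.
  apply: (le_trans q1); rewrite mulrDr; nra.
apply: (le_lt_trans step).
rewrite ge0_integralD//; last 2 first.
- by move=> x _; apply: adde_ge0.
- exact: emeasurable_funD.
rewrite ge0_integralD//.
have iF1 : \int[mu3]_x F1 x < (e / 2)%:E.
  apply: (@le_lt_trans _ _ (\int[mu3]_x (j.+1%:R%:E * (defect u s x)%:E))).
    apply: ge0_le_integral => //.
    - by apply: emeasurable_funM => //; mfun.
    - move=> x _; rewrite -EFinM lee_fin; apply: ler_wpM2r; first exact: defect_ge0.
      by rewrite ler_nat.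
  rewrite ge0_integralZl_fin//; last 2 first.
  - by mfun.
  - by move=> x; rewrite lee_fin defect_ge0.
  have -> : (e / 2)%:E = (j.+1%:R)%:E * (e / 2 / j.+1%:R)%:E.
    by rewrite -EFinM; congr EFin; rewrite [RHS]mulrC divfK ?pnatr_eq0.
  by rewrite lte_pmul2l// lte_fin.
have iF3 : \int[mu3]_x F3 x <= (e / 4)%:E /\ \int[mu3]_x F2 x <= \int[mu3]_x F3 x.
  split.
    rewrite -(@lee_pmul2l _ 2%:E)// -ge0_integralZl_fin//.
    have -> : 2%:E * (e / 4)%:E = (e / 2)%:E by rewrite -EFinM; congr EFin; field.
    apply: le_trans (ltW jsmall); rewrite le_eqVlt; apply/orP; left; apply/eqP.
    by apply: eq_integral => x _; rewrite /F3 -EFinM; congr EFin; ring.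
  pose G x := (2 * (s ^+ 6 * (rho x * ex (scale3 l^-1 x))))%:E.
  have mG : measurable_fun setT G.
    have m := measurableT_comp mx (mscale l^-1).
    by rewrite /G; mfun.
  have G0 x : 0 <= G x.
    rewrite lee_fin; apply: mulr_ge0 => //; apply: mulr_ge0; first exact: ltW.
    by apply: mulr_ge0; [exact: rho_ge0|].
  have -> : \int[mu3]_x F2 x = (l ^- 3)%:E * \int[mu3]_x G x.
    apply: (etrans _ (leb3_scale l0 mG G0)).
    by apply: eq_integral => x _; rewrite /F2 /G scale3K ?gt_eqF.
  rewrite -ge0_integralZl_fin//; last by rewrite invr_ge0 exprn_ge0// ltW.
  apply: ge0_le_integral => //.
  - by move=> x _; apply: mule_ge0 => //; rewrite lee_fin invr_ge0 exprn_ge0// ltW.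
  - by apply: emeasurable_funM.
  move=> x _; rewrite /G /F3 -[X in X <= _]EFinM lee_fin.
  have -> : (l ^- 3 * (2 * (s ^+ 6 * (rho x * ex (scale3 l^-1 x)))) =
      2 * (rho x * ex (scale3 l^-1 x)))%R.
    have sE (t r : R) : (0 < t)%R -> ((t ^+ 2) ^- 3 * (2 * (t ^+ 6 * r)) = 2 * r)%R.
      by move=> t0; rewrite -exprM; field; rewrite gt_eqF.
    exact: sE.
  by apply: ler_wpM2l => //; apply: ler_wpM2l; [exact: rho_ge0|exact: exE].
have -> : e%:E = (e / 2)%:E + (e / 4)%:E + (e / 4)%:E.
  by rewrite -!EFinD; congr EFin; field.
case: iF3 => h3 h2; apply: lte_leD => //.
- by rewrite ge0_fin_numE ?(le_lt_trans h3) ?ltry//; apply: integral_ge0.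
- apply: lte_leD => //; last exact: le_trans h2 h3.
  by rewrite ge0_fin_numE ?(le_lt_trans (le_trans h2 h3)) ?ltry//; apply: integral_ge0.
Qed.

End solution.

(** Either the potential vanishes at some point off the origin, and then so does
    its integrand, or it is positive there, and then the density vanishes. *)
Lemma ae_eq0_of_interaction (rho : R3 R -> R) : measurable_fun setT rho ->
  (forall x, 0 <= rho x)%R -> \int[mu3]_x (rho x)%:E < +oo ->
  \int[mu3]_x (rho x * potential rho x)%:E = 0 -> {ae mu3, forall x, rho x = 0%R}.
Proof.
move=> mrho rho0 fin i0.
have mV := measurable_potential (rho := rho) mrho rho0.
have [[x x0 Vx]|noV] := pselect (exists2 x, (0 < norm3 x)%R & potential rho x = 0%R).
  have := potentialE mrho rho0 fin x0; rewrite Vx => /esym i.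
  have m : measurable_fun setT (fun y => (rho y * invmax x y)%:E).
    by apply: mfun_EFin; apply: measurable_funM => //; apply: measurable_invmax; mfun.
  have p y : 0 <= (rho y * invmax x y)%:E by rewrite lee_fin mulr_ge0 ?invmax_ge0.
  apply: filterS (ge0_integral_eq0_ae m p i) => y [] /eqP.
  rewrite mulf_eq0 => /orP[/eqP//|].
  rewrite /invmax invr_eq0 => /eqP h.
  by move: x0; rewrite ltNge -h le_max lexx.
have m : measurable_fun setT (fun y => (rho y * potential rho y)%:E) by mfun.
have p y : 0 <= (rho y * potential rho y)%:E by rewrite lee_fin mulr_ge0// potential_ge0.
apply: filterS2 (ge0_integral_eq0_ae m p i0) ae_coord_neq0 => y [] /eqP + y0.
rewrite mulf_eq0 => /orP[/eqP//|/eqP h].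
by case: noV; exists y => //; exact: norm3_gt0.
Qed.

End limit.

Theorem proposition1p2 (R : realType) (E : R) (u : R3 R -> R[i]) :
  0 <= E -> sobolev_half u -> radial u -> weak_solution E u ->
  {ae @leb3 R, forall x, u x = 0}.
Proof.
move=> E0 [u2 [g ug gfin]] ru weak.
have mrho := measurable_dens u2.1.
have rV := dens_potential_fin u2 ug gfin ru.
have r0 x : 0 <= dens u x * potential (dens u) x.
  by rewrite mulr_ge0 ?dens_ge0// potential_ge0// => y; exact: dens_ge0.
suff D0 : (\int[@leb3 R]_x (dens u x * potential (dens u) x)%:E = 0)%E.
  have := ae_eq0_of_interaction mrho (dens_ge0 u) u2.2 D0.
  apply: filterS => x; rewrite densE; case: (u x) => p q /= pq.
  have p0 : p ^+ 2 = 0 by apply/eqP; rewrite eq_le sqr_ge0 andbT -pq lerDl sqr_ge0.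
  have q0 : q ^+ 2 = 0 by apply/eqP; rewrite eq_le sqr_ge0 andbT -pq lerDr sqr_ge0.
  by move/eqP: p0; move/eqP: q0; rewrite !sqrf_eq0 => /eqP -> /eqP ->.
rewrite -Rintegral_EFin//; congr EFin; apply/eqP; rewrite eq_le.
apply/andP; split; last by apply: Rintegral_ge0 => x _.
apply/ler_addgt0Pr => e e0; rewrite add0r.
have c0 : 0 < e / 2 / (E + 1) by rewrite !divr_gt0// ltr_wpDl.
have e2 : 0 < e / 2 by rewrite divr_gt0.
have [k _ /(_ k (leqnn k)) [h1 h2]] : \forall k \near \oo,
    ((\int[@leb3 R]_x (defect u (ratio k) x)%:E < (e / 2 / (E + 1))%:E) /\
     (\int[@leb3 R]_x (defect u (ratio k) x * potential (dens u) x)%:E < (e / 2)%:E))%E.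
  by apply: filterS2 (defect_small u2 ru c0) (defect_potential_small u2 ru rV e2) => k.
apply: (le_trans (interaction_le E0 u2 ug gfin ru weak (ratio_gt1 k))).
have d1 : \int[@leb3 R]_x (defect u (ratio k) x * potential (dens u) x) <= e / 2.
  rewrite -lee_fin Rintegral_EFin ?ltW//; last exact: lt_trans h2 (ltry _).
  by move=> x; rewrite mulr_ge0 ?defect_ge0// potential_ge0// => y; exact: dens_ge0.
have d2 : \int[@leb3 R]_x defect u (ratio k) x <= e / 2 / (E + 1).
  by rewrite -lee_fin Rintegral_EFin ?ltW//; [exact: defect_ge0|exact: lt_trans h1 (ltry _)].
rewrite [leRHS]splitr; apply: lerD => //.
apply: (le_trans (ler_wpM2l E0 d2)).
rewrite mulrCA ler_piMr ?(ltW e2)// ler_pdivrMr ?mul1r ?lerDl//.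
by rewrite ltr_wpDl.
Qed.
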